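(* Let $f:\mathbb{R}^n\times\mathbb{R}_+\to\mathbb{R}$, $h:\mathbb{R}^n\times\mathbb{R}_+\to\mathbb{R}^m$ and $g:\mathbb{R}^n\times\mathbb{R}_+\to\mathbb{R}^q$ satisfy assumptions (Smoothness), (Feasibility) and (LICQ) for inequalities of the context, and consider the time-varying problem: for $t\ge0$, $\inf_{x\in\mathbb{R}^n}f(x,t)$ subject to $h(x,t)=0$ and $g(x,t)\le0$ (componentwise), reformulated with slack variables as in the context. Let $V$ be a contracting basin (for the slack reformulation) on some finite open interval $I_0\subset\mathbb{R}_+$, and let $I=[t_0,t_1]\subset I_0$. Then, for any precision $\epsilon>0$ and any reaction time $\nu>0$, there exists $\bar\alpha>0$ such that for all $\alpha\in(0,\bar\alpha]$, $\alpha$ allows for $\epsilon$-tracking within $\nu$-time (on $I$, with respect to $V$).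
   Context: Assumptions. (Smoothness) $f$, $h$ and $g$ are twice continuously differentiable in their first variable $x$, $f$ is continuous in $t$, $h$ and $g$ are continuously differentiable in $t$, and $f(\cdot,t)$ is coercive for every $t\ge0$. (Feasibility) For all $t\ge0$ there exists $x\in\mathbb{R}^n$ with $h(x,t)=0$ and $g(x,t)\le0$. (LICQ) For all $t\ge0$ and all $x$ with $h(x,t)=0$, $g(x,t)\le0$, the gradients in $x$ of the components of $h$ and of the active components of $g$ (those with $g_j(x,t)=0$) are linearly independent. Slack reformulation. Put $N=n+q$, $X=(x,z)\in\mathbb{R}^n\times\mathbb{R}^q$, $F(X,t)=f(x,t)$ and $$H(X,t)=\big(h(x,t),\,g_1(x,t)+z_1^2,\dots,g_q(x,t)+z_q^2\big)\in\mathbb{R}^{m+q}.$$ The reformulated problem is $\inf_{X\in\mathbb{R}^N}F(X,t)$ subject to $H(X,t)=0$. Write $F_t=F(\cdot,t)$, $H_t=H(\cdot,t)$ and $\mathcal{M}(t)=\{X\in\mathbb{R}^N:H(X,t)=0\}$. ODE. For $\alpha>0$ consider $$\dot X(t)=-\tfrac1\alpha\,P\,\nabla_XF(X(t),t)-J^\top(JJ^\top)^{-1}H'(X(t),t),$$ where $J$ is the Jacobian of $H$ with respect to $X$ at $(X(t),t)$, $P=I_N-J^\top(JJ^\top)^{-1}J$, and $H'$ is the partial derivative of $H$ with respect to $t$. Let $\varphi_\alpha^t(X)$ denote the value at time $t$ of the solution with initial condition $X(t_0)=X$. Critical points. $\mathcal{C}_0(t)$ is the set of $X\in\mathcal{M}(t)$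 such that $\nabla_XF(X,t)\in(\ker J)^\perp$, with $J$ the Jacobian of $H_t$ at $X$. Basin. Let $I_0\subset\mathbb{R}_+$ be a finite open interval and $V\subset I_0\times\mathbb{R}^N$ open. Its slicing is $\mathrm{s}V(t)=\{X\in\mathbb{R}^N:(t,X)\in V\}$, $t\in I_0$. A correspondence $\phi:A\rightrightarrows B$ is locally bounded if every $a\in A$ has a neighbourhood whose image under $\phi$ is contained in a compact subset of $B$. $V$ is a basin if $\mathrm{s}V$ is locally bounded, the correspondence $t\mapsto\overline{\mathrm{s}V(t)}$ is upper hemicontinuous, and $\overline{\mathrm{s}V(t)\cap\mathcal{M}(t)}=\overline{\mathrm{s}V(t)}\cap\mathcal{M}(t)$ for all $t\in I_0$. A basin is understood as a neighbourhood of the tracked solution, so that $\mathrm{s}V(t)\cap\mathcal{M}(t)\neq\emptyset$ for all $t\in I_0$. Set $K(t)=\overline{\mathrm{s}V(t)\cap\mathcal{M}(t)}$ (a nonempty compact set), $F^*(t)=\min_{K(t)}F_t$ and $K^*(t)=\operatorname{arg\,min}_{K(t)}F_t$. The basin $V$ is contracting if $\mathrm{s}V(t)\cap\mathcal{C}_0(t)=K^*(t)$ for all $t\in I_0$. The sets $\hat K(t)$. Define $$\hat F(t)=\tfrac12\Big(F^*(t)+\min_{\partial(\mathrm{s}V(t))\cap\mathcal{M}(t)}F_t\Big),\qquad\hat K(t)=\{X\in K(t):F(X,t)\le\hat F(t)\},$$ with the convention that the minimum over an empty set is $+\infty$. Tracking. For $V$ a contracting basin on $I_0$, $I=[t_0,t_1]\subset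 I_0$, $\epsilon>0$, $\nu>0$ and $\alpha>0$, one says that $\alpha$ allows for $\epsilon$-tracking within $\nu$-time when: (1) $\varphi_\alpha$ is defined over $I\times\hat K(t_0)$; (2) for all $t\in I$, $\varphi^t_\alpha(\hat K(t_0))\subset K(t)$; (3) for all $t\in[t_0+\nu,t_1]$ and $X\in\hat K(t_0)$, $F(\varphi_\alpha^t(X),t)-F^*(t)\le\epsilon$. *)

(* Defs.v *)
From HB Require Import structures.
From mathcomp Require Import all_boot all_order all_algebra.
From mathcomp Require Import all_classical all_reals all_analysis.

Set Implicit Arguments.
Unset Strict Implicit.
Unset Printing Implicit Defensive.

Import Order.TTheory GRing.Theory Num.Theory.
Import numFieldNormedType.Exports.

Local Open Scope classical_set_scope.
Local Open Scope ring_scope.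

(** Vectors of R^k are rows ['rV[R]_k].  A function of (x, t) with t in R_+ is
    a function of t : R whose values at t < 0 are never used. *)

Definition nonneg_reals (R : realType) : set R := [set t | 0 <= t].

(** One-sided at an endpoint of the interval A. *)
Definition is_derive_within (R : realType) (W : normedModType R) (A : set R)
    (u : R -> W) (t : R) (d : W) : Prop :=
  (s - t)^-1 *: (u s - u t) @[s --> within A t^'] --> d.

Definition grad (R : realType) (n : nat) (f : 'rV[R]_n -> R) (x : 'rV[R]_n) :
    'rV[R]_n :=
  \row_i 'D_(delta_mx 0 i) f x.

(** The usual Jacobian matrix: entry (i, j) is the derivative of the i-th
    component along the j-th coordinate.  ['J] is its transpose, since it acts
    on row vectors by right multiplication. *)
Definition Jac (R : realType) (n p : nat) (f : 'rV[R]_n -> 'rV[R]_p)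
    (x : 'rV[R]_n) : 'M[R]_(p, n) :=
  ('J f x)^T.

(** ** Assumptions on the data *)

(** Continuity of the derivatives in x is joint in (x, t): with continuity in x
    alone, the right-hand side of the tracking ODE could be discontinuous in t
    and have no classical solution. *)
Definition C2_in_x (R : realType) (n : nat) (W : normedModType R)
    (f : 'rV[R]_n -> R -> W) : Prop :=
  [/\ forall (t : R) (x : 'rV[R]_n), 0 <= t -> differentiable (f ^~ t) x,
      forall v : 'rV[R]_n,
        {within [set: 'rV[R]_n] `*` @nonneg_reals R,
          continuous (fun p : 'rV[R]_n * R => 'D_v (f ^~ p.2) p.1)},
      forall (v : 'rV[R]_n) (t : R) (x : 'rV[R]_n), 0 <= t ->
        differentiable (fun y => 'D_v (f ^~ t) y) x &
      forall v w : 'rV[R]_n,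
        {within [set: 'rV[R]_n] `*` @nonneg_reals R,
          continuous (fun p : 'rV[R]_n * R =>
            'D_w (fun y => 'D_v (f ^~ p.2) y) p.1)}].

Definition C1_in_t (R : realType) (n : nat) (W : normedModType R)
    (f : 'rV[R]_n -> R -> W) : Prop :=
  exists df : 'rV[R]_n -> R -> W,
    (forall (x : 'rV[R]_n) (t : R), 0 <= t ->
       is_derive_within (@nonneg_reals R) (f x) t (df x t)) /\
    {within [set: 'rV[R]_n] `*` @nonneg_reals R,
      continuous (fun p : 'rV[R]_n * R => df p.1 p.2)}.

Definition coercive (R : realType) (n : nat) (f : 'rV[R]_n -> R) : Prop :=
  forall A : R, exists B : R, forall x : 'rV[R]_n, B <= `|x| -> A <= f x.

Definition smoothness (R : realType) (n m q : nat) (f : 'rV[R]_n -> R -> R)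
    (h : 'rV[R]_n -> R -> 'rV[R]_m) (g : 'rV[R]_n -> R -> 'rV[R]_q) : Prop :=
  [/\ [/\ @C2_in_x R n R^o f, C2_in_x h & C2_in_x g],
      forall x : 'rV[R]_n, {within @nonneg_reals R, continuous (f x)},
      C1_in_t h /\ C1_in_t g &
      forall t : R, 0 <= t -> coercive (f ^~ t)].

Definition feasible (R : realType) (n m q : nat)
    (h : 'rV[R]_n -> R -> 'rV[R]_m) (g : 'rV[R]_n -> R -> 'rV[R]_q)
    (x : 'rV[R]_n) (t : R) : Prop :=
  h x t = 0 /\ forall j : 'I_q, g x t 0 j <= 0.

Definition feasibility (R : realType) (n m q : nat)
    (h : 'rV[R]_n -> R -> 'rV[R]_m) (g : 'rV[R]_n -> R -> 'rV[R]_q) : Prop :=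
  forall t : R, 0 <= t -> exists x : 'rV[R]_n, feasible h g x t.

Definition LICQ (R : realType) (n m q : nat)
    (h : 'rV[R]_n -> R -> 'rV[R]_m) (g : 'rV[R]_n -> R -> 'rV[R]_q) : Prop :=
  forall (t : R) (x : 'rV[R]_n), 0 <= t -> feasible h g x t ->
    free ([seq grad (fun y => h y t 0 i) x | i : 'I_m] ++
          [seq grad (fun y => g y t 0 j) x | j in [pred j : 'I_q | g x t 0 j == 0]]).

(** ** Slack reformulation *)

Definition slack_obj (R : realType) (n q : nat) (f : 'rV[R]_n -> R -> R)
    (X : 'rV[R]_(n + q)) (t : R) : R :=
  f (lsubmx X) t.

Definition slack_cons (R : realType) (n m q : nat)
    (h : 'rV[R]_n -> R -> 'rV[R]_m) (g : 'rV[R]_n -> R -> 'rV[R]_q)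
    (X : 'rV[R]_(n + q)) (t : R) : 'rV[R]_(m + q) :=
  row_mx (h (lsubmx X) t)
         (\row_(j < q) (g (lsubmx X) t 0 j + rsubmx X 0 j ^+ 2)).

(** ** The equality-constrained problem: inf F(X, t) subject to H(X, t) = 0 *)

Definition manifold (R : realType) (N p : nat) (H : 'rV[R]_N -> R -> 'rV[R]_p)
    (t : R) : set 'rV[R]_N :=
  [set X | H X t = 0].

Definition critical (R : realType) (N p : nat) (F : 'rV[R]_N -> R -> R)
    (H : 'rV[R]_N -> R -> 'rV[R]_p) (t : R) : set 'rV[R]_N :=
  [set X | manifold H t X /\
    forall v : 'rV[R]_N, Jac (H ^~ t) X *m v^T = 0 ->
      grad (F ^~ t) X *m v^T = 0].

Definition ode_rhs (R : realType) (N p : nat) (F : 'rV[R]_N -> R -> R)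
    (H : 'rV[R]_N -> R -> 'rV[R]_p) (alpha : R) (X : 'rV[R]_N) (t : R) :
    'rV[R]_N :=
  let J := Jac (H ^~ t) X in
  let Jpinv := J^T *m invmx (J *m J^T) in
  let P := 1%:M - Jpinv *m J in
  (- (alpha^-1 *: (P *m (grad (F ^~ t) X)^T)) - Jpinv *m (derive1 (H X) t)^T)^T.

(** Since [invmx] is total, invertibility of J J^T along the trajectory, without
    which the equation has no meaning, is part of being a solution. *)
Definition ode_solution (R : realType) (N p : nat) (F : 'rV[R]_N -> R -> R)
    (H : 'rV[R]_N -> R -> 'rV[R]_p) (alpha t0 t1 : R) (X0 : 'rV[R]_N)
    (Y : R -> 'rV[R]_N) : Prop :=
  Y t0 = X0 /\
  forall t : R, t0 <= t <= t1 ->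
    Jac (H ^~ t) (Y t) *m (Jac (H ^~ t) (Y t))^T \in unitmx /\
    is_derive_within `[t0, t1] Y t (ode_rhs F H alpha (Y t) t).

(** ** Basins *)

Definition locally_bounded_corr (T U : topologicalType) (A : set T)
    (phi : T -> set U) : Prop :=
  forall a : T, A a -> exists2 C : set U, compact C &
    \forall s \near within A (nbhs a), phi s `<=` C.

Definition upper_hemicontinuous (T U : topologicalType) (A : set T)
    (phi : T -> set U) : Prop :=
  forall a : T, A a -> forall O : set U, open O -> phi a `<=` O ->
    \forall s \near within A (nbhs a), phi s `<=` O.

Definition slicing (R : realType) (N : nat) (V : set (R * 'rV[R]_N)) (t : R) :
    set 'rV[R]_N :=
  [set X | V (t, X)].

(** The last clause says that the basin surrounds the tracked solution. *)
Definition basin (R : realType) (N p : nat) (H : 'rV[R]_N -> R -> 'rV[R]_p)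
    (I0 : set R) (V : set (R * 'rV[R]_N)) : Prop :=
  [/\ open V /\ V `<=` I0 `*` [set: 'rV[R]_N],
      locally_bounded_corr I0 (slicing V),
      upper_hemicontinuous I0 (fun t => closure (slicing V t)),
      forall t : R, I0 t ->
        closure (slicing V t `&` manifold H t) =
        closure (slicing V t) `&` manifold H t &
      forall t : R, I0 t -> slicing V t `&` manifold H t !=set0].

Definition boundary (T : topologicalType) (A : set T) : set T :=
  closure A `\` interior A.

(** An infimum, attained when F is continuous and A is compact and nonempty;
    it is +oo when A is empty. *)
Definition min_over (R : realType) (N : nat) (F : 'rV[R]_N -> R)
    (A : set 'rV[R]_N) : \bar R :=
  ereal_inf [set (F X)%:E | X in A].

Definition basin_K (R : realType) (N p : nat) (H : 'rV[R]_N -> R -> 'rV[R]_p)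
    (V : set (R * 'rV[R]_N)) (t : R) : set 'rV[R]_N :=
  closure (slicing V t `&` manifold H t).

Definition Fstar (R : realType) (N p : nat) (F : 'rV[R]_N -> R -> R)
    (H : 'rV[R]_N -> R -> 'rV[R]_p) (V : set (R * 'rV[R]_N)) (t : R) :
    \bar R :=
  min_over (F ^~ t) (basin_K H V t).

Definition Kstar (R : realType) (N p : nat) (F : 'rV[R]_N -> R -> R)
    (H : 'rV[R]_N -> R -> 'rV[R]_p) (V : set (R * 'rV[R]_N)) (t : R) :
    set 'rV[R]_N :=
  [set X | basin_K H V t X /\
    forall Y : 'rV[R]_N, basin_K H V t Y -> F X t <= F Y t].

Definition contracting_basin (R : realType) (N p : nat)
    (F : 'rV[R]_N -> R -> R) (H : 'rV[R]_N -> R -> 'rV[R]_p)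
    (I0 : set R) (V : set (R * 'rV[R]_N)) : Prop :=
  basin H I0 V /\
  forall t : R, I0 t -> slicing V t `&` critical F H t = Kstar F H V t.

Definition Fhat (R : realType) (N p : nat) (F : 'rV[R]_N -> R -> R)
    (H : 'rV[R]_N -> R -> 'rV[R]_p) (V : set (R * 'rV[R]_N)) (t : R) :
    \bar R :=
  ((2^-1)%:E * (Fstar F H V t +
     min_over (F ^~ t) (boundary (slicing V t) `&` manifold H t)))%E.

Definition Khat (R : realType) (N p : nat) (F : 'rV[R]_N -> R -> R)
    (H : 'rV[R]_N -> R -> 'rV[R]_p) (V : set (R * 'rV[R]_N)) (t : R) :
    set 'rV[R]_N :=
  [set X | basin_K H V t X /\ ((F X t)%:E <= Fhat F H V t)%E].

(** ** Tracking *)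

(** [phi t X] is the value at time t of the solution started from X at t0.  That
    it is defined on [t0, t1] means that there is one and only one solution on
    [t0, t1]. *)
Definition flow_defined (R : realType) (N p : nat) (F : 'rV[R]_N -> R -> R)
    (H : 'rV[R]_N -> R -> 'rV[R]_p) (alpha t0 t1 : R) (D : set 'rV[R]_N)
    (phi : R -> 'rV[R]_N -> 'rV[R]_N) : Prop :=
  forall X : 'rV[R]_N, D X ->
    ode_solution F H alpha t0 t1 X (phi ^~ X) /\
    forall Y : R -> 'rV[R]_N, ode_solution F H alpha t0 t1 X Y ->
      forall t : R, t0 <= t <= t1 -> Y t = phi t X.

Definition allows_tracking (R : realType) (N p : nat) (F : 'rV[R]_N -> R -> R)
    (H : 'rV[R]_N -> R -> 'rV[R]_p) (V : set (R * 'rV[R]_N))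
    (t0 t1 epsilon nu alpha : R) : Prop :=
  exists phi : R -> 'rV[R]_N -> 'rV[R]_N,
    [/\ flow_defined F H alpha t0 t1 (Khat F H V t0) phi,
        forall t : R, t0 <= t <= t1 ->
          phi t @` Khat F H V t0 `<=` basin_K H V t &
        forall (t : R) (X : 'rV[R]_N), t0 + nu <= t <= t1 ->
          Khat F H V t0 X ->
          ((F (phi t X) t)%:E - Fstar F H V t <= epsilon%:E)%E].

(* Main.v *)
(** The normal part of the field keeps H(X(t), t) = 0 along trajectories, so they
    stay on the moving manifold M(t) as long as they are defined. The field is
    only continuous, because H' is: existence comes from Peano's theorem, and
    uniqueness from the fact that the difference D of two trajectories on M(t)
    satisfies J D = O(|D|^2), so the non-Lipschitz normal terms contribute only
    O(|D|^2) to the derivative of |D|^2.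

    Since the critical points of the basin are the minimizers of F_t on K(t),
    which lie inside the open slice, F* is continuous and stays at a positive
    distance below the values of F on the boundary of the basin. Hence there is a
    continuous level l that starts above F on the initial set, lies strictly
    between F* and these boundary values, and is within epsilon of F* after time
    nu. On the compact band of points with l <= F <= l + 2 eta the projected
    gradient does not vanish, so for small alpha the trajectories cannot climb
    across this band: they stay in the basin, below l + 2 eta. *)

Require Import Defs.
From HB Require Import structures.
From mathcomp Require Import all_boot all_order all_algebra.
From mathcomp Require Import all_classical all_reals all_analysis.
From mathcomp Require Import ring lra.

Set Implicit Arguments.
Unset Strict Implicit.
Unset Printing Implicit Defensive.

Import Order.TTheory GRing.Theory Num.Theory.
Import numFieldNormedType.Exports.

Local Open Scope classical_set_scope.
Local Open Scope ring_scope.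

(** * One-sided derivatives *)

(** Two defects of regularity shape the proof. The Gram matrix [J J^T] is known to be invertible
    only on the zero set of [H], so Peano's theorem is applied to a field whose inverse is replaced
    by a truncation continuous everywhere, and the trajectory is then shown to stay where both
    inverses agree. Moreover [F] is only continuous in [t], so [F(X(t), t)] cannot be
    differentiated: descent is measured over short windows with the time argument of [F] frozen.

    The level is [F* + eta] plus a linear ramp, which starts at the supremum of the initial excess
    over [F*] and has vanished at time [t0 + nu]. Uniform constants come from compactness of the
    graph of [K] over [[t0, t1]]. Continuity of [F*] needs feasible points to persist as [t] moves.
    Uniqueness concerns all solutions, trapped or not, because each of them preserves [H = 0]. *)

Definition has_deriv_within (R : realType) (W : normedModType R) (A : set R)
    (u : R -> W) (t : R) (d : W) : Prop :=
  forall e : R, 0 < e -> exists2 del : R, 0 < del &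
    forall s : R, A s -> `|s - t| < del ->
      `|u s - u t - (s - t) *: d| <= e * `|s - t|.

(** The form without division also holds at [s = t], so restriction, sums and composition need no
    punctured neighbourhoods. The quotient form is met only at the interface with the given
    definitions. *)
Lemma is_derive_withinP (R : realType) (W : normedModType R) (A : set R)
    (u : R -> W) (t : R) (d : W) :
  is_derive_within A u t d <-> has_deriv_within A u t d.
Proof.
have quot s : s != t ->
    `|d - (s - t)^-1 *: (u s - u t)| * `|s - t| = `|u s - u t - (s - t) *: d|.
  rewrite -subr_eq0 => st.
  rewrite mulrC -normrZ scalerBr scalerA mulfV // scale1r.
  by rewrite -normrN opprB.
split=> [/cvgrPdist_le h e e0|h].
  have /nbhs_ballP[del /= del0 hdel] := h e e0.
  exists del => // s As st; have [->|sNt] := eqVneq s t.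
    by rewrite !subrr scale0r subrr !normr0 mulr0.
  rewrite -quot // ler_wpM2r //; apply: (hdel s) => //.
  by rewrite /ball /= distrC.
apply/cvgrPdist_le => e e0; have [del del0 hdel] := h e e0.
apply/nbhs_ballP; exists del => //= s; rewrite /ball /= distrC => st sNt As.
have := hdel s As st; rewrite -quot // ler_pM2r // normr_gt0 subr_eq0 //.
Qed.

Definition cont_within (R : realType) (W : normedModType R) (A : set R)
    (u : R -> W) (t : R) : Prop :=
  forall e : R, 0 < e -> exists2 del : R, 0 < del &
    forall s : R, A s -> `|s - t| < del -> `|u s - u t| < e.

Lemma has_deriv_within_cont (R : realType) (W : normedModType R) (A : set R)
    (u : R -> W) (t : R) (d : W) :
  has_deriv_within A u t d -> cont_within A u t.
Proof.
move=> h e e0; have [del del0 hdel] := h 1 ltr01.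
exists (Num.min del (e / (1 + `|d|))).
  by rewrite lt_min del0 divr_gt0 // ltr_wpDr.
move=> s As; rewrite lt_min ltr_pdivlMr ?ltr_wpDr // => /andP[st1 st2].
rewrite -(subrK ((s - t) *: d) (u s - u t)).
apply: le_lt_trans (ler_normD _ _) _; rewrite normrZ.
apply: le_lt_trans st2; rewrite mulrDr mulr1 lerD2r.
by have := hdel s As st1; rewrite mul1r.
Qed.

Lemma has_deriv_within_subset (R : realType) (W : normedModType R)
    (A B : set R) (u : R -> W) (t : R) (d : W) :
  B `<=` A -> has_deriv_within A u t d -> has_deriv_within B u t d.
Proof.
move=> BA h e e0; have [del del0 hdel] := h e e0.
by exists del => // s /BA; exact: hdel.
Qed.

Lemma eq_has_deriv_within (R : realType) (W : normedModType R) (A : set R)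
    (u w : R -> W) (t : R) (d : W) :
  (forall s, A s -> u s = w s) -> A t ->
  has_deriv_within A u t d -> has_deriv_within A w t d.
Proof.
move=> uw At h e e0; have [del del0 hdel] := h e e0.
by exists del => // s As; rewrite -!uw //; exact: hdel.
Qed.

Lemma has_deriv_withinD (R : realType) (W : normedModType R) (A : set R)
    (u w : R -> W) (t : R) (du dw : W) :
  has_deriv_within A u t du -> has_deriv_within A w t dw ->
  has_deriv_within A (fun s => u s + w s) t (du + dw).
Proof.
move=> hu hw e e0; have e20 : 0 < e / 2 by rewrite divr_gt0.
have [d1 d10 h1] := hu _ e20; have [d2 d20 h2] := hw _ e20.
exists (Num.min d1 d2); first by rewrite lt_min d10.
move=> s As; rewrite lt_min => /andP[st1 st2].
rewrite scalerDr !opprD [X in X + _]addrACA [X in `|X|]addrACA.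
apply: le_trans (ler_normD _ _) _.
apply: le_trans (lerD (h1 s As st1) (h2 s As st2)) _.
by rewrite -mulrDl -splitr.
Qed.

Lemma has_deriv_withinZ (R : realType) (W : normedModType R) (A : set R)
    (k : R) (u : R -> W) (t : R) (du : W) :
  has_deriv_within A u t du ->
  has_deriv_within A (fun s => k *: u s) t (k *: du).
Proof.
move=> hu e e0; have ek : 0 < e / (1 + `|k|) by rewrite divr_gt0 // ltr_wpDr.
have [d1 d10 h1] := hu _ ek.
exists d1 => // s As st; rewrite scalerA mulrC -scalerA -!scalerBr normrZ.
apply: le_trans (ler_wpM2l (normr_ge0 k) (h1 s As st)) _.
rewrite mulrA ler_wpM2r // mulrCA; apply: ler_piMr; first exact: ltW.
by rewrite ler_pdivrMr ?ltr_wpDr // mul1r lerDr.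
Qed.

Lemma has_deriv_within_affine (R : realType) (W : normedModType R) (A : set R)
    (c d : W) (t0 t : R) :
  has_deriv_within A (fun s => c + (s - t0) *: d) t d.
Proof.
move=> e e0; exists 1 => // s _ _.
have -> : c + (s - t0) *: d - (c + (t - t0) *: d) - (s - t) *: d = 0.
  rewrite opprD addrACA subrr add0r -!scalerBl.
  by rewrite opprB addrA subrK subrr scale0r.
by rewrite normr0 mulr_ge0 // ltW.
Qed.

(** The supremum of the points up to which [P] holds satisfies [P] by the limit clause, and the step
    clause would move beyond it if it were below [b]. Both clauses receive the whole past, as
    statements about trajectories require. *)
Lemma real_induction (R : realType) (P : R -> Prop) (a b : R) :
  P a ->
  (forall t, a <= t -> t < b -> (forall s, a <= s <= t -> P s) ->
     exists2 d : R, 0 < d & forall s, t < s -> s < t + d -> s <= b -> P s) ->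
  (forall t, a < t -> t <= b -> (forall s, a <= s -> s < t -> P s) -> P t) ->
  forall t, a <= t <= b -> P t.
Proof.
move=> Pa step lim t /andP[at_ tb].
pose S := [set x | a <= x <= b /\ forall s, a <= s <= x -> P s].
have ab : a <= b := le_trans at_ tb.
have Sa : S a.
  split; first by rewrite lexx ab.
  by move=> s; rewrite -eq_le => /eqP <-.
have Sb : ubound S b by move=> x [/andP[]].
have supS : has_sup S by split; [exists a|exists b].
pose c := sup S.
have ac : a <= c by apply: ub_le_sup => //; exists b.
have cb : c <= b by apply: ge_sup => //; exists a.
have belowc s : a <= s -> s < c -> P s.
  move=> as_; rewrite -subr_gt0 => sc.
  have /= [x [_ Px] sx] := sup_adherent sc supS.
  by apply: Px; rewrite as_ /= ltW //; move: sx; rewrite subKr.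
have Pc : P c.
  have [<-//|ac'] := eqVneq a c.
  by apply: lim => //; rewrite lt_neqAle ac' ac.
have allc s : a <= s <= c -> P s.
  move=> /andP[as_]; rewrite le_eqVlt => /orP[/eqP->//|sc]; exact: belowc.
have [cb'|cb'] := ltP c b; last first.
  by apply: allc; rewrite at_ (le_trans tb cb').
have [d d0 hd] := step c ac cb' allc.
pose x := Num.min b (c + d / 2).
have cx : c < x by rewrite lt_min cb' ltrDl divr_gt0.
have Sx : S x.
  split; first by rewrite ge_min lexx /= andbT (le_trans ac) // ltW.
  move=> s /andP[as_ sx]; have [sc|sc] := leP s c; first by apply: allc; rewrite as_.
  apply: hd => //.
    apply: le_lt_trans sx _; rewrite gt_min; apply/orP; right.
    by rewrite ltrD2l ltr_pdivrMr // ltr_pMr // ltr1n.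
  by rewrite (le_trans sx) // ge_min lexx.
by have := ub_le_sup (ex_intro _ b Sb) Sx; rewrite leNgt cx.
Qed.

(** Real induction on the bound with slope [c + e]: the slack [e] absorbs the first-order remainder
    to the right of each point, and costs at most [e0] over the whole interval. *)
Lemma deriv_le_increment (R : realType) (u v : R -> R) (a b c : R) :
  a <= b ->
  (forall t, a <= t <= b -> has_deriv_within `[a, b] (u : R -> R^o) t (v t)) ->
  (forall t, a <= t <= b -> v t <= c) ->
  u b - u a <= c * (b - a).
Proof.
move=> ab du vc; apply/ler_addgt0Pr => e0 e0gt0.
pose e := e0 / (1 + (b - a)).
have ba1 : 0 < 1 + (b - a) by rewrite ltr_wpDr // subr_ge0.
have egt0 : 0 < e by rewrite divr_gt0.
apply: (@le_trans _ _ ((c + e) * (b - a))); last first.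
  rewrite mulrDl lerD2l /e mulrAC ler_pdivrMr // ler_wpM2l ?ltW //.
  by rewrite ltrDr ltr01.
have : forall t, a <= t <= b -> u t - u a <= (c + e) * (t - a).
  apply: real_induction => [|t at_ tb ih|t at_ tb ih].
  - by rewrite !subrr mulr0.
  - have tab : a <= t <= b by rewrite at_ ltW.
    have [d d0 hd] := du t tab e egt0; exists d => // s ts sd sb.
    have As : `[a, b]%classic s by rewrite /= in_itv /= sb (le_trans at_) // ltW.
    have st : `|s - t| = s - t by rewrite gtr0_norm // subr_gt0.
    have := hd s As; rewrite st ltrBlDl => /(_ sd) /ler_normlP[_]; rewrite /GRing.scale /= => h1.
    have h2 := ih t _; rewrite lexx andbT in h2; have {}h2 := h2 at_.
    have h3 := vc t tab.
    have h4 : (s - t) * v t <= (s - t) * c by rewrite ler_wpM2l // subr_ge0 ltW.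
    lra.
  - have tab : a <= t <= b by rewrite tb ltW.
    apply/ler_addgt0Pr => k k0.
    have [d d0 hd] := has_deriv_within_cont (du t tab) (e := k / 2) (divr_gt0 k0 (ltr0n _ 2)).
    (* Moving back from [t] by at most [m] changes the linear bound by at most [k / 2]; continuity
       of [u] pays for the other half of [k]. *)
    pose m := k / 2 / (1 + `|c + e|).
    have m0 : 0 < m by rewrite !divr_gt0 // ltr_wpDr.
    pose s := Num.max a (t - Num.min (d / 2) m).
    have m20 : 0 < Num.min (d / 2) m by rewrite lt_min m0 andbT divr_gt0.
    have as_ : a <= s by rewrite le_max lexx.
    have st : s < t by rewrite gt_max at_ /= gtrBl.
    have tsm : t - s <= Num.min (d / 2) m by rewrite lerBlDr -lerBlDl le_max lexx orbT.
    have As : `[a, b]%classic s by rewrite /= in_itv /= as_ (le_trans (ltW st)).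
    have tsd : t - s < d.
      by apply: le_lt_trans tsm _; rewrite gt_min ltr_pdivrMr // ltr_pMr // ?ltr1n.
    have := hd s As; rewrite ltr0_norm ?subr_lt0 // opprB => /(_ tsd).
    move=> /ltW /ler_normlP[h1 _].
    have h2 := ih s as_ st.
    have h3 : (c + e) * (s - a) <= (c + e) * (t - a) + k / 2.
      suff : (c + e) * (s - t) <= k / 2 by lra.
      apply: le_trans (ler_norm _) _; rewrite normrM.
      rewrite [X in _ * X]ltr0_norm ?subr_lt0 // opprB.
      apply: (@le_trans _ _ ((1 + `|c + e|) * m)); last first.
        by rewrite /m mulrC divfK // gt_eqF // ltr_wpDr.
      apply: ler_pM; [by []|by rewrite subr_ge0 ltW|by rewrite lerDr|].
      by apply: le_trans tsm _; rewrite ge_min lexx orbT.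
    lra.
by move=> /(_ b); rewrite lexx ab; apply.
Qed.

(** Isolates the moment after which a trajectory stays above its level: the supremum of the times
    with [u <= 0], which by continuity is itself such a time. *)
Lemma last_nonpos (R : realType) (u : R -> R) (a b : R) :
  a <= b -> (forall t, a <= t <= b -> cont_within `[a, b] (u : R -> R^o) t) ->
  u a <= 0 ->
  exists2 s, a <= s <= b /\ u s <= 0 & forall t, s < t -> t <= b -> 0 < u t.
Proof.
move=> ab cu ua.
pose S := [set x | a <= x <= b /\ u x <= 0].
have Sa : S a by split => //; rewrite lexx.
have Sb : ubound S b by move=> x [/andP[]].
have supS : has_sup S by split; [exists a|exists b].
pose c := sup S.
have ac : a <= c by apply: ub_le_sup => //; exists b.
have cb : c <= b by apply: ge_sup => //; exists a.
exists c; last first.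
  move=> t ct tb; rewrite ltNge; apply/negP => ut.
  have St : S t by split => //; rewrite tb (le_trans ac) // ltW.
  by have := ub_le_sup (ex_intro _ b Sb) St; rewrite leNgt ct.
split; first by rewrite ac.
rewrite leNgt; apply/negP => uc.
have cab : a <= c <= b by rewrite ac.
have [d d0 hd] := cu c cab _ uc.
have /= [x [xab ux] dx] := sup_adherent d0 supS.
have xc : x <= c by apply: ub_le_sup => //; exists b.
have xcd : `|x - c| < d.
  by rewrite distrC ger0_norm ?subr_ge0 // ltrBlDr -ltrBlDl.
have := hd x; rewrite /= in_itv /= => /(_ xab xcd) /ltr_normlP[]; lra.
Qed.

(** * Peano's theorem *)

Section Peano.
Context {R : realType} {N : nat} (G : 'rV[R]_N -> R -> 'rV[R]_N) (M : R).
Hypothesis G_bounded : forall x t, `|G x t| <= M.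
Hypothesis G_cont : forall x t,
  {for (x, t), continuous (fun p : 'rV[R]_N * R => G p.1 p.2)}.
Variables (t0 : R) (x0 : 'rV[R]_N).

Fixpoint euler (h : R) (k : nat) : 'rV[R]_N :=
  if k is k'.+1 then euler h k' + h *: G (euler h k') (t0 + k'%:R * h) else x0.

Let M_ge0 : 0 <= M. Proof. exact: le_trans (normr_ge0 _) (G_bounded 0 0). Qed.

(** Each Euler step deviates from [h *: g] by at most [e * h], and the deviations add up. With
    [g = 0] this yields the Lipschitz bound, with [g] the field at a limit point it yields the
    derivative. *)
Lemma euler_drift (h e : R) (g : 'rV[R]_N) (i j : nat) : 0 <= h ->
  (forall k, (i <= k < i + j)%N -> `|G (euler h k) (t0 + k%:R * h) - g| <= e) ->
  `|euler h (i + j) - euler h i - (j%:R * h) *: g| <= e * (j%:R * h).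
Proof.
move=> h0; elim: j => [_|j IH hG].
  by rewrite addn0 subrr mul0r scale0r subrr normr0 mulr0.
have {IH} : `|euler h (i + j) - euler h i - (j%:R * h) *: g| <= e * (j%:R * h).
  apply: IH => k /andP[ik kj]; apply: hG; rewrite ik (leq_trans kj) //.
  by rewrite leq_add2l.
have := hG (i + j)%N; rewrite leq_addr ltn_add2l leqnn => /(_ isT) h1 h2.
rewrite addnS /= -natr1 mulrDl mul1r scalerDl.
have -> : euler h (i + j) + h *: G (euler h (i + j)) (t0 + (i + j)%:R * h)
    - euler h i - ((j%:R * h) *: g + h *: g) =
  (euler h (i + j) - euler h i - (j%:R * h) *: g) +
  h *: (G (euler h (i + j)) (t0 + (i + j)%:R * h) - g).
  by apply/rowP => l; rewrite !mxE; ring.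
apply: le_trans (ler_normD _ _) _; rewrite mulrDr lerD //.
by rewrite normrZ ger0_norm // mulrC ler_wpM2r.
Qed.

Lemma euler_lipschitz (h : R) (i j : nat) : 0 <= h ->
  `|euler h (i + j) - euler h i| <= M * (j%:R * h).
Proof.
move=> h0; have := @euler_drift h M 0 i j h0.
by rewrite scaler0 subr0; apply => k _; rewrite subr0.
Qed.

(** The approximation [X n] is a step function of time, without interpolation between nodes. Its
    jumps vanish with [step n], at the price of rounding terms in the estimates. *)
Let step (n : nat) : R := n.+1%:R^-1.
Let idx (n : nat) (t : R) : nat := Num.truncn ((t - t0) * n.+1%:R).
Let X (n : nat) (t : R) := euler (step n) (idx n t).

Let step_ge0 n : 0 <= step n. Proof. by rewrite invr_ge0. Qed.

Let idxP n t : t0 <= t -> `|(idx n t)%:R * step n - (t - t0)| <= step n.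
Proof.
move=> t0t; have : 0 <= (t - t0) * n.+1%:R by rewrite mulr_ge0 // subr_ge0.
move=> /truncn_itv /andP[]; rewrite -/(idx n t) -ler_pdivrMr ?ltr0n // => h1.
rewrite -ltr_pdivlMr ?ltr0n // -natr1 mulrDl mul1r -/(step n) => h2.
by rewrite ler_norml; apply/andP; split; move: (step_ge0 n) h1; rewrite -/(step n); lra.
Qed.

(** The time [d] between the two nodes differs from [s - t] by two rounding errors, whence
    [2 * step n]; the third one in [3 * step n] is the distance from [t] to its own node. *)
Let X_increment (n : nat) (e s t : R) (g : 'rV[R]_N) :
  t0 <= s -> t0 <= t -> 0 <= e ->
  (forall x r, `|x - X n t| <= M * (`|s - t| + 2 * step n) ->
     `|r - t| <= `|s - t| + 3 * step n -> `|G x r - g| <= e) ->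
  `|X n s - X n t - (s - t) *: g| <=
    e * `|s - t| + 2 * step n * (e + `|g|).
Proof.
move=> ts tt e0 hG; pose d : R := (idx n s)%:R * step n - (idx n t)%:R * step n.
have hd : `|d - (s - t)| <= 2 * step n.
  have -> : d - (s - t) = ((idx n s)%:R * step n - (s - t0)) -
     ((idx n t)%:R * step n - (t - t0)) by rewrite /d; ring.
  apply: le_trans (ler_normB _ _) _.
  by have := idxP n ts; have := idxP n tt; lra.
have hd2 : `|d| <= `|s - t| + 2 * step n.
  rewrite -[d](subrK (s - t)) addrC; apply: le_trans (ler_normD _ _) _.
  by rewrite lerD2l.
have near k : `|euler (step n) k - X n t| <= M * `|d| ->
    `|k%:R * step n - (idx n t)%:R * step n| <= `|d| ->
    `|G (euler (step n) k) (t0 + k%:R * step n) - g| <= e.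
  move=> k1 k2; apply: hG.
    by apply: le_trans k1 _; rewrite ler_wpM2l.
  have -> : t0 + k%:R * step n - t = (k%:R * step n - (idx n t)%:R * step n) +
     ((idx n t)%:R * step n - (t - t0)) by ring.
  apply: le_trans (ler_normD _ _) _.
  have := idxP n tt; lra.
suff main : `|X n s - X n t - d *: g| <= e * `|d|.
  have -> : X n s - X n t - (s - t) *: g =
      (X n s - X n t - d *: g) + (d - (s - t)) *: g.
    by apply/rowP => l; rewrite !mxE; ring.
  apply: le_trans (ler_normD _ _) _.
  rewrite normrZ; apply: le_trans (lerD main (ler_wpM2r (normr_ge0 g) hd)) _.
  have := ler_wpM2l e0 hd2; lra.
have [le_ts|/ltnW le_st] := leqP (idx n t) (idx n s).
  have ds : d = (idx n s - idx n t)%:R * step n by rewrite natrB // mulrBl.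
  rewrite /X -(subnKC le_ts) ds ger0_norm ?mulr_ge0 //.
  apply: euler_drift => // k; rewrite subnKC // => /andP[tk ks].
  have ab : ((k - idx n t)%:R * step n) <= `|d|.
    by rewrite ds ger0_norm ?mulr_ge0 // ler_wpM2r // ler_nat leq_sub2r // ltnW.
  apply: near.
    rewrite -{1}(subnKC tk); apply: le_trans (euler_lipschitz _ _ (step_ge0 n)) _.
    by rewrite ler_wpM2l.
  by rewrite -mulrBl -natrB // ger0_norm ?mulr_ge0.
(* Backward in time the nodes exchange roles, and the drift estimate runs from the node of [s] to
   that of [t]. *)
have ds : - d = (idx n t - idx n s)%:R * step n by rewrite natrB // mulrBl opprB.
have -> : X n s - X n t - d *: g = - ((X n t - X n s) - (- d) *: g).
  by apply/rowP => l; rewrite !mxE; ring.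
rewrite normrN -(normrN d) /X -{1}(subnKC le_st) ds [in leRHS]ger0_norm ?mulr_ge0 //.
apply: euler_drift => // k; rewrite subnKC // => /andP[sk kt].
have ab : ((idx n t - k)%:R * step n) <= `|d|.
  by rewrite -normrN ds ger0_norm ?mulr_ge0 // ler_wpM2r // ler_nat leq_sub2l.
apply: near.
  rewrite distrC /X -{1}(subnKC (ltnW kt)).
  apply: le_trans (euler_lipschitz _ _ (step_ge0 n)) _.
  by rewrite ler_wpM2l.
by rewrite distrC -mulrBl -natrB ?(ltnW kt) // ger0_norm ?mulr_ge0.
Qed.

(* A pointwise ultrafilter limit of Euler polygons: the estimate [X_increment] on
   increments passes to the limit without integrals or uniform convergence. *)
Lemma peano : exists Y : R -> 'rV[R]_N, Y t0 = x0 /\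
  forall t, t0 <= t -> has_deriv_within [set s | t0 <= s] Y t (G (Y t) t).
Proof.
have [U [UU sU]] := ultraFilterLemma (eventually_filter : ProperFilter \oo).
have PU : ProperFilter U  := @ultra_proper _ _ UU.
have Xlim t : exists y : 'rV[R]_N, t0 <= t -> X ^~ t @ U --> y.
  have [t0t|tt0] := leP t0 t; last by exists 0.
  pose B := [set x : 'rV[R]_N | `|x - x0| <= M * (t - t0)].
  have cB : compact B.
    apply: bounded_closed_compact.
      exists (`|x0| + M * (t - t0)); split; first exact: num_real.
      move=> r rlt x Bx /=; apply: le_trans (ltW rlt).
      rewrite -[x](subrK x0) addrC; apply: le_trans (ler_normD _ _) _.
      by rewrite lerD2l.
    have -> : B = closed_ball_ Num.norm x0 (M * (t - t0)).
      by apply/seteqP; split => x; rewrite /B /closed_ball_ /= distrC.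
    exact: closed_closed_ball_.
  have UB : (X ^~ t @ U) B.
    apply: (@filterS _ U PU setT) => [n _|]; last exact: filterT.
    rewrite /B /=; have := @euler_lipschitz (step n) 0 (idx n t) (step_ge0 n).
    rewrite add0n => /le_trans; apply; rewrite ler_wpM2l //.
    have : 0 <= (t - t0) * n.+1%:R by rewrite mulr_ge0 // subr_ge0.
    by move=> /truncn_itv /andP[h _]; rewrite ler_pdivrMr.
  have [y [_ cly]] := cB _ _ UB.
  (* A cluster point of an ultrafilter is its limit: otherwise the complement of some neighbourhood
     of [y] would belong to the ultrafilter without meeting that neighbourhood. *)
  exists y => _ A Ay; have [//|nA] := in_ultra_setVsetC (X ^~ t @^-1` A) UU.
  by have [x []] := cly (~` A) A nA Ay.
have [Y HY] := choice Xlim.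
exists Y; split.
  have := HY t0 (lexx _) => /cvg_lim; have -> : X ^~ t0 = fun=> x0.
    by apply/funext => n; rewrite /X /idx subrr mul0r truncn0.
  move=> h; rewrite -[LHS]h //; apply: cvg_lim => //; exact: cvg_cst.
move=> t t0t e e0; pose g := G (Y t) t.
have /cvgrPdist_le/(_ e e0)/nbhs_ballP[r /= r0 Gr] := @G_cont (Y t) t.
(* Keeps the nodes visited between [t] and [s] within [r] of [(Y t, t)]: once [step n] is small,
   their motion uses less than [r / 2] and the distance from [X n t] to [Y t] less than [r / 4]. *)
pose del := Num.min (r / 4) (r / (4 * (1 + M))).
have M1 : 0 < 1 + M by rewrite ltr_pwDl.
have del0 : 0 < del by rewrite lt_min !divr_gt0 // mulr_gt0.
exists del => // s t0s; rewrite lt_min => /andP[st1 st2].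
apply/ler_addgt0Pr => k k0.
have small c : 0 < c -> \forall n \near U, step n < c.
  by move=> c0; apply: sU; exact: (near_infty_natSinv_lt (PosNum c0)).
have close u c : t0 <= u -> 0 < c -> \forall n \near U, `|Y u - X n u| < c.
  by move=> t0u c0; move: (HY u t0u) => /cvgrPdist_lt; apply.
have k3 : 0 < k / 3 by rewrite divr_gt0.
have eg0 : 0 < 2 * (e + `|g| + 1) by rewrite mulr_gt0 // addr_gt0 // ltr_pwDl.
have r4 : 0 < r / 4 by rewrite divr_gt0.
have r16 : 0 < r / (16 * (1 + M)) by rewrite divr_gt0 // mulr_gt0.
have r16' : 0 < r / 16 by rewrite divr_gt0.
have [n [[n1 n2] [[n3 n4] [n5 n6]]]] := filter_ex (filterI
  (filterI (close s _ t0s k3) (close t _ t0t k3)) (filterI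
  (filterI (small _ (divr_gt0 k3 eg0)) (small _ r16))
  (filterI (close t _ t0t r4) (small _ r16')))).
have key := @X_increment n e s t g t0s t0t (ltW e0).
have {}key : `|X n s - X n t - (s - t) *: g| <= e * `|s - t| + k / 3.
  apply: le_trans (key _) _.
    move=> x u hx hu; rewrite distrC; apply: (Gr (x, u)); split => /=.
      rewrite -ball_normE /=; rewrite -(subrK (X n t) (Y t)) -addrA.
      apply: le_lt_trans (ler_normD _ _) _.
      rewrite (distrC (X n t)).
      suff : M * (`|s - t| + 2 * step n) < r / 2 by lra.
      apply: (@le_lt_trans _ _ ((1 + M) * (`|s - t| + 2 * step n))).
        by rewrite ler_wpM2r ?addr_ge0 ?mulr_ge0 // lerDr.
      move: st2 n4; rewrite !invfM !mulrA !ltr_pdivlMr // => a1 a2.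
      lra.
    rewrite -ball_normE /= distrC; apply: le_lt_trans hu _; lra.
  rewrite lerD2l; move: n3; rewrite ltr_pdivlMr // => n3.
  by apply: le_trans (ltW n3); have := step_ge0 n; have := normr_ge0 g; nra.
have -> : Y s - Y t - (s - t) *: G (Y t) t = (Y s - X n s) - (Y t - X n t) +
    (X n s - X n t - (s - t) *: g).
  by apply/rowP => l; rewrite /g !mxE; ring.
apply: le_trans (ler_normD _ _) _.
have := ler_normB (Y s - X n s) (Y t - X n t); lra.
Qed.

End Peano.

(** * Convergence of matrices *)

Lemma cvg_mx (R : realType) (T : Type) (F : set_system T) {FF : Filter F}
    (m n : nat) (A : T -> 'M[R]_(m, n)) (a : 'M[R]_(m, n)) :
  (forall i j, A x i j @[x --> F] --> a i j) -> A @ F --> a.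
Proof.
move=> h; apply/cvgrPdist_lt => e e0.
suff : \forall x \near F, forall ij : 'I_m * 'I_n, `|a ij.1 ij.2 - A x ij.1 ij.2| < e.
  apply: filterS => x hx; rewrite /Num.norm /= mx_normrE.
  by apply: bigmax_lt => // -[i j] _; rewrite !mxE /=; exact: (hx (i, j)).
apply: filter_forall => -[i j] /=.
by have /cvgrPdist_lt := h i j; apply.
Qed.

Lemma cvg_mx_coord (R : realType) (T : Type) (F : set_system T)
    {FF : Filter F} (m n : nat) (A : T -> 'M[R]_(m, n)) (a : 'M[R]_(m, n)) i j :
  A @ F --> a -> A x i j @[x --> F] --> a i j.
Proof.
move=> h; apply: (@cvg_comp _ _ _ A (fun B : 'M[R]_(m, n) => B i j) F (nbhs a)) => //.
exact: coord_continuous.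
Qed.

Section MatrixConvergence.
Context {R : realType} {T : Type} {F : set_system T} {FF : Filter F}.

Lemma cvg_mulmx (m n p : nat) (A : T -> 'M[R]_(m, n)) (B : T -> 'M[R]_(n, p))
    (a : 'M[R]_(m, n)) (b : 'M[R]_(n, p)) :
  A @ F --> a -> B @ F --> b -> A x *m B x @[x --> F] --> a *m b.
Proof.
move=> hA hB; apply: cvg_mx => i j; rewrite mxE.
under eq_cvg do rewrite mxE.
apply: cvg_big => [|k _]; first exact: add_continuous.
by apply: cvgM; apply: cvg_mx_coord.
Qed.

Lemma cvg_trmx (m n : nat) (A : T -> 'M[R]_(m, n)) (a : 'M[R]_(m, n)) :
  A @ F --> a -> (A x)^T @[x --> F] --> a^T.
Proof.
move=> hA; apply: cvg_mx => i j; rewrite mxE.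
by under eq_cvg do rewrite mxE; exact: cvg_mx_coord.
Qed.

Lemma cvg_det (n : nat) (A : T -> 'M[R]_n) (a : 'M[R]_n) :
  A @ F --> a -> \det (A x) @[x --> F] --> \det a.
Proof.
move=> hA; apply: cvg_big => [|s _]; first exact: add_continuous.
apply: cvgM; first exact: cvg_cst.
apply: cvg_big => [|k _]; first exact: mul_continuous.
exact: cvg_mx_coord.
Qed.

Lemma cvg_adj (n : nat) (A : T -> 'M[R]_n) (a : 'M[R]_n) :
  A @ F --> a -> \adj (A x) @[x --> F] --> \adj a.
Proof.
move=> hA; apply: cvg_mx => i j; rewrite mxE.
under eq_cvg do rewrite mxE.
apply: cvgM; first exact: cvg_cst.
apply: cvg_det; apply: cvg_mx => k l; rewrite !mxE.
by under eq_cvg do rewrite !mxE; exact: cvg_mx_coord.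
Qed.

Lemma maxr_lipschitz (x y c : R) : `|Num.max x c - Num.max y c| <= `|x - y|.
Proof.
have h1 := ler_norm (x - y); have h2 := ler_norm (y - x); rewrite distrC in h2.
by rewrite ler_norml; case: (leP x c) => ?; case: (leP y c) => ?;
  apply/andP; split; lra.
Qed.

Lemma cvg_maxr_cst (f : T -> R) (l c : R) :
  f @ F --> l -> Num.max (f x) c @[x --> F] --> Num.max l c.
Proof.
move=> /cvgrPdist_lt h; apply/cvgrPdist_lt => e e0.
by apply: filterS (h e e0) => x; apply: le_lt_trans; exact: maxr_lipschitz.
Qed.

End MatrixConvergence.

(** The norm of row vectors is the maximum norm, whereas projections and the uniqueness argument are
    Euclidean. [ler_dot_norm] and [ler_norm_dot] translate between the two, which is where the
    factors [N%:R] come from. *)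
Definition dot (R : realType) (N : nat) (u v : 'rV[R]_N) : R := (u *m v^T) 0 0.

Section Dot.
Context {R : realType} {N : nat}.
Implicit Types u v w : 'rV[R]_N.

Lemma dotE u v : dot u v = \sum_i u 0 i * v 0 i.
Proof. by rewrite /dot mxE; apply: eq_bigr => i _; rewrite mxE. Qed.

Lemma dotC u v : dot u v = dot v u.
Proof. by rewrite !dotE; apply: eq_bigr => i _; rewrite mulrC. Qed.

Lemma dotDl u v w : dot (u + v) w = dot u w + dot v w.
Proof. by rewrite /dot mulmxDl mxE. Qed.

Lemma dotNl u v : dot (- u) v = - dot u v.
Proof. by rewrite /dot mulNmx mxE. Qed.

Lemma dotZl k u v : dot (k *: u) v = k * dot u v.
Proof. by rewrite /dot -scalemxAl mxE. Qed.

Lemma dotBl u v w : dot (u - v) w = dot u w - dot v w.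
Proof. by rewrite dotDl dotNl. Qed.

Lemma dotBr u v w : dot w (u - v) = dot w u - dot w v.
Proof. by rewrite dotC dotBl !(dotC w). Qed.

Lemma dotZr k u v : dot u (k *: v) = k * dot u v.
Proof. by rewrite dotC dotZl dotC. Qed.

Lemma dot_mulmxl (p : nat) (A : 'M[R]_(N, p)) u (w : 'rV[R]_p) :
  dot (u *m A) w = dot u (w *m A^T).
Proof. by rewrite /dot trmx_mul trmxK mulmxA. Qed.

Lemma ler_coord_norm (m n : nat) (A : 'M[R]_(m, n)) i j : `|A i j| <= `|A|.
Proof.
by rewrite [leRHS]/Num.norm /= mx_normrE; exact: (le_bigmax _ (fun ij => `|A ij.1 ij.2|) (i, j)).
Qed.

Lemma mx_norm_le (m n : nat) (A : 'M[R]_(m, n)) (c : R) :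
  0 <= c -> (forall i j, `|A i j| <= c) -> `|A| <= c.
Proof.
move=> c0 h; rewrite [leLHS]/Num.norm /= mx_normrE.
by apply: bigmax_le => // -[i j] _; exact: h.
Qed.

Lemma normr_mulmx (m n p : nat) (A : 'M[R]_(m, n)) (B : 'M[R]_(n, p)) :
  `|A *m B| <= n%:R * `|A| * `|B|.
Proof.
apply: mx_norm_le => [|i j]; first by rewrite !mulr_ge0.
rewrite mxE; apply: le_trans (ler_norm_sum _ _ _) _.
apply: (@le_trans _ _ (\sum_(k < n) `|A| * `|B|)).
  by apply: ler_sum => k _; rewrite normrM ler_pM // ler_coord_norm.
by rewrite sumr_const card_ord -mulrA [leRHS]mulr_natl.
Qed.

Lemma normr_trmx (m n : nat) (A : 'M[R]_(m, n)) : `|A^T| = `|A|.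
Proof.
apply/eqP; rewrite eq_le; apply/andP; split; apply: mx_norm_le => // i j.
  by rewrite mxE ler_coord_norm.
by have := ler_coord_norm A^T j i; rewrite mxE.
Qed.

Lemma ler_dot_norm u v : `|dot u v| <= N%:R * `|u| * `|v|.
Proof.
by apply: le_trans (ler_coord_norm _ _ _) _; rewrite -(normr_trmx v) normr_mulmx.
Qed.

Lemma ler_norm_dot u : `|u| ^+ 2 <= dot u u.
Proof.
have d0 i : 0 <= u 0 i * u 0 i by rewrite -expr2 sqr_ge0.
have dd : 0 <= dot u u by rewrite dotE sumr_ge0.
rewrite -(sqr_sqrtr dd) ler_sqr ?nnegrE ?sqrtr_ge0 //.
apply: mx_norm_le => [|i j]; first exact: sqrtr_ge0.
rewrite ord1 -sqrtr_sqr ler_sqrt // dotE (bigD1 j) //= expr2 lerDl.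
by rewrite sumr_ge0.
Qed.

Lemma dot_eq0 u : (dot u u == 0) = (u == 0).
Proof.
apply/idP/eqP => [/eqP d0|->]; last by rewrite /dot mul0mx mxE.
have := ler_norm_dot u; rewrite d0 => h.
apply/eqP; rewrite -normr_eq0 -sqrf_eq0 eq_le h sqr_ge0 //.
Qed.

Lemma dot_ge0 u : 0 <= dot u u.
Proof. by apply: le_trans (ler_norm_dot u); rewrite sqr_ge0. Qed.

Lemma cvg_dot (T : Type) (F : set_system T) {FF : Filter F}
    (f g : T -> 'rV[R]_N) (u v : 'rV[R]_N) :
  f @ F --> u -> g @ F --> v -> dot (f x) (g x) @[x --> F] --> dot u v.
Proof. by move=> hf hg; apply: cvg_mx_coord; apply: cvg_mulmx => //; exact: cvg_trmx. Qed.

End Dot.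

Notation jointly_continuous_at phi X t :=
  {for (X, t), continuous (fun p => phi p.1 p.2)}.

Lemma cvg_jointly (R : realType) (N : nat) (W : topologicalType) (T : Type)
    (F : set_system T) {FF : Filter F} (phi : 'rV[R]_N -> R -> W)
    (f : T -> 'rV[R]_N) (g : T -> R) (X : 'rV[R]_N) (t : R) :
  jointly_continuous_at phi X t -> f @ F --> X -> g @ F --> t ->
  phi (f x) (g x) @[x --> F] --> phi X t.
Proof.
move=> h hf hg; apply: (cvg_comp (fun x => (f x, g x)) (fun p => phi p.1 p.2)) h.
exact: (cvg_pair hf hg).
Qed.

(** * Clamping, and Peano's theorem on a time slab *)

Definition clamp (R : realType) (a b x : R) : R := Num.max a (Num.min b x).

Section Clamp.
Context {R : realType}.
Implicit Types a b x y : R.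

Lemma clamp_itv a b x : a <= b -> a <= clamp a b x <= b.
Proof. by move=> ab; rewrite /clamp le_max lexx ge_max ab ge_min lexx. Qed.

Lemma clamp_id a b x : a <= x <= b -> clamp a b x = x.
Proof. by move=> /andP[ax xb]; rewrite /clamp min_r // max_r. Qed.

Lemma clamp_lipschitz a b x y : `|clamp a b x - clamp a b y| <= `|x - y|.
Proof.
have h1 := ler_norm (x - y); have h2 := ler_norm (y - x); rewrite distrC in h2.
rewrite /clamp !(maxC a); apply: le_trans (maxr_lipschitz _ _ _) _.
by rewrite ler_norml; case: (leP b x) => ?; case: (leP b y) => ?;
  apply/andP; split; lra.
Qed.

Lemma cvg_clamp (T : Type) (F : set_system T) {FF : Filter F} (f : T -> R) l a b :
  f @ F --> l -> clamp a b (f x) @[x --> F] --> clamp a b l.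
Proof.
move=> /cvgrPdist_lt h; apply/cvgrPdist_lt => e e0.
by apply: filterS (h e e0) => x; apply: le_lt_trans; exact: clamp_lipschitz.
Qed.

End Clamp.

Lemma rV_norm_compact (R : realType) (N : nat) (M : R) :
  compact [set x : 'rV[R]_N | `|x| <= M].
Proof.
apply: bounded_closed_compact.
  exists M; split; first exact: num_real.
  by move=> r Mr x /= xM; exact: le_trans (ltW Mr).
have -> : [set x : 'rV[R]_N | `|x| <= M] = closed_ball_ Num.norm (0 : 'rV[R]_N) M.
  by apply/seteqP; split => x; rewrite /closed_ball_ /= sub0r normrN.
exact: closed_closed_ball_.
Qed.

(** Clamping time to [[t0, t1]] and each coordinate to [[- M, M]] makes the field bounded and
    continuous everywhere. The clamped field agrees with [G] as long as the trajectory stays in the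
    box, which is the ball of radius [M] for the maximum norm. *)
Lemma peano_slab (R : realType) (N : nat) (G : 'rV[R]_N -> R -> 'rV[R]_N)
    (t0 t1 M : R) (x0 : 'rV[R]_N) :
  t0 <= t1 -> 0 <= M ->
  (forall x t, t0 <= t <= t1 -> jointly_continuous_at G x t) ->
  exists Y : R -> 'rV[R]_N, Y t0 = x0 /\ forall t, t0 <= t <= t1 ->
    cont_within `[t0, t1] Y t /\
    (`|Y t| <= M -> has_deriv_within `[t0, t1] Y t (G (Y t) t)).
Proof.
move=> t01 M0 cG.
pose c (x : 'rV[R]_N) : 'rV[R]_N := \row_i clamp (- M) M (x 0 i).
have MM : - M <= M by lra.
have cM x : `|c x| <= M.
  apply: mx_norm_le => // i j; rewrite mxE ler_norml; exact: clamp_itv.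
pose G' x t := G (c x) (clamp t0 t1 t).
have cG' x t : jointly_continuous_at G' x t.
  rewrite /continuous_at /= /G'.
  have h1 : c p.1 @[p --> (x, t)] --> c x.
    apply: cvg_mx => i j; rewrite mxE; under eq_cvg do rewrite mxE.
    apply: cvg_clamp => //; apply: cvg_mx_coord; exact: cvg_fst.
  have h2 : clamp t0 t1 p.2 @[p --> (x, t)] --> clamp t0 t1 t.
    by apply: cvg_clamp => //; exact: cvg_snd.
  have h3 := cvg_jointly (cG (c x) _ (clamp_itv t t01)) h1 h2.
  exact: h3.
have [B HB] : exists B, forall x t, `|G' x t| <= B.
  pose D := [set x : 'rV[R]_N | `|x| <= M] `*` `[t0, t1]%classic.
  have cD : compact D.
    by apply: compact_setX; [exact: rV_norm_compact|exact: segment_compact].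
  have cont : {within D, continuous (fun p : 'rV[R]_N * R => G p.1 p.2)}.
    apply/continuous_in_subspaceT => -[x t] /set_mem [_ /= tt].
    by apply: cG; move: tt; rewrite in_itv.
  have /compact_bounded [B [_ hB]] := continuous_compact cont cD.
  exists (B + 1) => x t; apply: (hB (B + 1)); first by rewrite ltrDl.
  exists (c x, clamp t0 t1 t) => //; split => /=; first exact: cM.
  by rewrite in_itv /=; exact: clamp_itv.
have [Y [Y0 dY]] := peano HB cG' t0 x0.
exists Y; split => // t /andP[tt0 tt1].
have sub : `[t0, t1] `<=` [set s | t0 <= s].
  by move=> s /=; rewrite in_itv => /andP[].
have {}dY := has_deriv_within_subset sub (dY t tt0).
split; first exact: has_deriv_within_cont dY.
move=> YM; suff -> : G (Y t) t = G' (Y t) t by [].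
rewrite /G' clamp_id ?tt0 //; congr (G _ _); apply/rowP => i; rewrite mxE clamp_id //.
by rewrite -ler_norml (le_trans (ler_coord_norm _ _ _)).
Qed.

(** * Functions with Lipschitz gradient *)

Definition has_grad (R : realType) (N : nat) (f : 'rV[R]_N -> R)
    (X g : 'rV[R]_N) : Prop :=
  forall e : R, 0 < e -> exists2 del : R, 0 < del &
    forall Y, `|Y - X| < del -> `|f Y - f X - dot g (Y - X)| <= e * `|Y - X|.

(** What the proof retains of twice differentiability: a jointly continuous gradient, Lipschitz in
    [X] on balls uniformly over compact time intervals. Regularity of [phi] itself in time is
    supplied separately. *)
Definition C11_in_x (R : realType) (N : nat) (a b : R)
    (phi : 'rV[R]_N -> R -> R) (g : 'rV[R]_N -> R -> 'rV[R]_N) : Prop :=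
  [/\ forall X t, a < t < b -> has_grad (phi ^~ t) X (g X t),
      forall X t, a < t < b -> jointly_continuous_at g X t &
      forall M c d : R, a < c -> d < b -> exists2 L : R, 0 <= L &
        forall X Y t, c <= t <= d -> `|X| <= M -> `|Y| <= M ->
          `|g X t - g Y t| <= L * `|X - Y|].

Lemma jointly_continuous_ball (R : realType) (N : nat) (W : normedModType R)
    (phi : 'rV[R]_N -> R -> W) (X : 'rV[R]_N) (t e : R) :
  jointly_continuous_at phi X t -> 0 < e ->
  exists2 del : R, 0 < del & forall Y s, `|Y - X| < del -> `|s - t| < del ->
    `|phi Y s - phi X t| < e.
Proof.
move=> /cvgrPdist_lt h e0; have /nbhs_ballP[del /= del0 hd] := h e e0.
exists del => // Y s YX st; rewrite distrC; apply: (hd (Y, s)).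
by split; rewrite -ball_normE /= distrC.
Qed.

Lemma ball_jointly_continuous (R : realType) (N : nat) (W : normedModType R)
    (phi : 'rV[R]_N -> R -> W) (X : 'rV[R]_N) (t : R) :
  (forall e : R, 0 < e -> exists2 del : R, 0 < del &
     forall Y s, `|Y - X| < del -> `|s - t| < del ->
       `|phi Y s - phi X t| < e) ->
  jointly_continuous_at phi X t.
Proof.
move=> h; apply/cvgrPdist_lt => e /h[del del0 hd].
exists (ball X del, ball t del); first by split; exact: nbhsx_ballx.
move=> [Y s] [/=]; rewrite -!ball_normE /= => h1 h2.
by rewrite distrC; apply: hd; rewrite distrC.
Qed.

Lemma open_itv_ball (R : realType) (a b t : R) : a < t < b ->
  exists2 del : R, 0 < del & forall s, `|s - t| < del -> a < s < b.
Proof.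
move=> /andP[at_ tb]; exists (Num.min (t - a) (b - t)).
  by rewrite lt_min !subr_gt0 at_.
move=> s; rewrite lt_min !ltr_norml; lra.
Qed.

Lemma has_deriv_within_comp (R : realType) (N : nat) (S : set R)
    (f : 'rV[R]_N -> R) (Y : R -> 'rV[R]_N) (t : R) (g dY : 'rV[R]_N) :
  has_grad f (Y t) g -> has_deriv_within S Y t dY ->
  has_deriv_within S (fun s => f (Y s) : R^o) t (dot g dY).
Proof.
move=> hf hY e e0.
pose e1 := e / 2 / (1 + `|dY|).
pose e2 := Num.min 1 (e / 2 / (1 + N%:R * `|g|)).
have p1 : 0 < 1 + `|dY| by rewrite ltr_wpDr.
have p2 : 0 < 1 + N%:R * `|g| by rewrite ltr_wpDr ?mulr_ge0.
have e20 : 0 < e / 2 by rewrite divr_gt0.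
have e10 : 0 < e1 by rewrite divr_gt0.
have e2_gt0 : 0 < e2 by rewrite lt_min ltr01 divr_gt0.
have [d1 d10 h1] := hf e1 e10; have [d2 d20 h2] := hY e2 e2_gt0.
have [d3 d30 h3] := has_deriv_within_cont hY d10.
exists (Num.min d2 d3); first by rewrite lt_min d20.
move=> s Ss; rewrite lt_min => /andP[st2 st3].
have k1 := h1 _ (h3 s Ss st3); have k2 := h2 s Ss st2.
have k3 : `|Y s - Y t| <= (1 + `|dY|) * `|s - t|.
  rewrite -(subrK ((s - t) *: dY) (Y s - Y t)).
  apply: le_trans (ler_normD _ _) _; rewrite normrZ mulrDl mul1r (mulrC `|dY|) lerD2r.
  by apply: le_trans k2 _; rewrite ler_piMl // ge_min lexx.
have k4 : `|dot g (Y s - Y t - (s - t) *: dY)| <= e / 2 * `|s - t|.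
  apply: le_trans (ler_dot_norm _ _) _.
  apply: (@le_trans _ _ ((1 + N%:R * `|g|) * (e2 * `|s - t|))).
    by apply: ler_pM => //; rewrite ?mulr_ge0 // lerDr.
  rewrite mulrA ler_wpM2r // mulrC -ler_pdivlMr //.
  by rewrite ge_min lexx orbT.
have k5 : `|f (Y s) - f (Y t) - dot g (Y s - Y t)| <= e / 2 * `|s - t|.
  apply: le_trans k1 _; apply: le_trans (ler_wpM2l (ltW e10) k3) _.
  by rewrite mulrA ler_wpM2r // /e1 divfK // gt_eqF.
have -> : f (Y s) - f (Y t) - (s - t) *: (dot g dY : R^o) =
  (f (Y s) - f (Y t) - dot g (Y s - Y t)) + dot g (Y s - Y t - (s - t) *: dY).
  by rewrite (dotBr _ ((s - t) *: dY)) dotZr addrA subrK.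
apply: le_trans (ler_normD _ _) _; lra.
Qed.

Section Increment.
Context {R : realType} {N : nat}.
Variables (f : 'rV[R]_N -> R) (g : 'rV[R]_N -> 'rV[R]_N).
Hypothesis hg : forall X, has_grad f X (g X).

Lemma increment_le (X Y : 'rV[R]_N) (c : R) :
  (forall s, 0 <= s <= 1 -> dot (g (X + s *: (Y - X))) (Y - X) <= c) ->
  f Y - f X <= c.
Proof.
move=> h.
pose Z (s : R) := X + (s - 0) *: (Y - X).
have := @deriv_le_increment R (fun s => f (Z s))
  (fun s => dot (g (Z s)) (Y - X)) 0 1 c ler01.
have -> : Z 1 = Y by apply/rowP => i; rewrite !mxE; ring.
have -> : Z 0 = X by apply/rowP => i; rewrite !mxE; ring.
rewrite subr0 mulr1; apply.
  move=> s s01; apply: has_deriv_within_comp; first exact: hg.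
  exact: has_deriv_within_affine.
by move=> s s01; rewrite /Z subr0; exact: h.
Qed.

Lemma increment_norm_le (X Y v : 'rV[R]_N) (c : R) :
  (forall s, 0 <= s <= 1 -> `|g (X + s *: (Y - X)) - v| <= c) ->
  `|f Y - f X - dot v (Y - X)| <= N%:R * c * `|Y - X|.
Proof.
move=> h.
have bound s : 0 <= s <= 1 ->
    `|dot (g (X + s *: (Y - X))) (Y - X) - dot v (Y - X)| <= N%:R * c * `|Y - X|.
  move=> s01; rewrite -dotBl; apply: le_trans (ler_dot_norm _ _) _.
  by rewrite ler_wpM2r // ler_wpM2l // h.
rewrite ler_norml; apply/andP; split.
  have := @increment_le Y X (N%:R * c * `|Y - X| - dot v (Y - X)).
  suff k s : 0 <= s <= 1 ->
      dot (g (Y + s *: (X - Y))) (X - Y) <= N%:R * c * `|Y - X| - dot v (Y - X).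
    by move=> /(_ k); lra.
  move=> /andP[s0 s1]; have -> : Y + s *: (X - Y) = X + (1 - s) *: (Y - X).
    by apply/rowP => i; rewrite !mxE; ring.
  have s01 : 0 <= 1 - s <= 1 by lra.
  have := bound _ s01; rewrite ler_norml => /andP[+ _].
  by rewrite -(opprB Y X) (dotC _ (- _)) dotNl dotC; lra.
have := @increment_le X Y (N%:R * c * `|Y - X| + dot v (Y - X)).
suff k s : 0 <= s <= 1 ->
    dot (g (X + s *: (Y - X))) (Y - X) <= N%:R * c * `|Y - X| + dot v (Y - X).
  by move=> /(_ k); lra.
by move=> s01; have := bound _ s01; rewrite ler_norml => /andP[_]; lra.
Qed.

End Increment.

Section Regular.
Context {R : realType} {N : nat} {a b : R}.
Variables (phi : 'rV[R]_N -> R -> R) (g : 'rV[R]_N -> R -> 'rV[R]_N).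
Hypothesis phi_reg : C11_in_x a b phi g.

(** On the segment from [Z] to [Y] the gradient at time [s] is within [e / (1 + N%:R)] of [g X t] by
    joint continuity, so the mean value inequality applies. That [s] may differ from [t] is what
    later separates the variation in space from the variation in time. *)
Lemma strict_differentiability (X : 'rV[R]_N) (t e : R) : a < t < b -> 0 < e ->
  exists2 del : R, 0 < del & forall Y Z s, `|Y - X| < del -> `|Z - X| < del ->
    `|s - t| < del -> `|phi Y s - phi Z s - dot (g X t) (Y - Z)| <= e * `|Y - Z|.
Proof.
move=> tab e0; case: (phi_reg) => hg cg _.
have p0 : 0 < e / (1 + N%:R) by rewrite divr_gt0 // ltr_wpDr.
have [d1 d10 h1] := jointly_continuous_ball (cg X t tab) p0.
have [d2 d20 h2] := open_itv_ball tab.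
exists (Num.min d1 d2); first by rewrite lt_min d10.
move=> Y Z s; rewrite !lt_min => /andP[YX _] /andP[ZX _] /andP[st1 st2].
have sab := h2 s st2.
apply: le_trans (increment_norm_le (fun Z => hg Z s sab) (c := e / (1 + N%:R)) _) _.
  move=> r /andP[r0 r1]; apply: ltW; apply: h1 => //.
  have -> : Z + r *: (Y - Z) - X = (1 - r) *: (Z - X) + r *: (Y - X).
    by apply/rowP => i; rewrite !mxE; ring.
  apply: le_lt_trans (ler_normD _ _) _; rewrite !normrZ.
  rewrite (ger0_norm r0) (ger0_norm (_ : 0 <= 1 - r)) ?subr_ge0 //.
  have [->|r1'] := eqVneq r 1; first by rewrite subrr mul0r add0r mul1r.
  have : 0 < 1 - r by rewrite subr_gt0 lt_neqAle r1'.
  have k2 := normr_ge0 (Z - X); have k1 := normr_ge0 (Y - X); nra.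
rewrite ler_wpM2r // mulrC mulrAC ler_pdivrMr ?ltr_wpDr // ler_wpM2l ?lerDr //.
exact: ltW.
Qed.

(** The segment stays in the ball of radius [M], and along it the gradient moves by at most [L]
    times the distance. The quadratic remainder is what makes the normal part of the field harmless
    for uniqueness. *)
Lemma second_order (M c d : R) : a < c -> d < b ->
  exists2 C : R, 0 <= C & forall X Y t, c <= t <= d -> `|X| <= M -> `|Y| <= M ->
    `|phi Y t - phi X t - dot (g X t) (Y - X)| <= C * `|Y - X| ^+ 2.
Proof.
move=> ac db; case: (phi_reg) => hg _ lip; have [L L0 hL] := lip M c d ac db.
exists (N%:R * L); first by rewrite mulr_ge0.
move=> X Y t tcd XM YM.
have tab : a < t < b.
  by case/andP: tcd => ct td; rewrite (lt_le_trans ac ct) (le_lt_trans td db).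
rewrite expr2 mulrA -(mulrA _ L).
apply: (increment_norm_le (fun Z => hg Z t tab)) => s /andP[s0 s1].
have -> : X + s *: (Y - X) = (1 - s) *: X + s *: Y.
  by apply/rowP => i; rewrite !mxE; ring.
have n1s : `|1 - s| = 1 - s by rewrite ger0_norm // subr_ge0.
apply: le_trans (hL _ _ _ tcd _ XM) _.
  apply: le_trans (ler_normD _ _) _; rewrite !normrZ n1s (ger0_norm s0).
  have k : 0 <= 1 - s by rewrite subr_ge0.
  by have := ler_wpM2l k XM; have := ler_wpM2l s0 YM; lra.
rewrite ler_wpM2l //.
have -> : (1 - s) *: X + s *: Y - X = s *: (Y - X).
  by apply/rowP => i; rewrite !mxE; ring.
by rewrite normrZ (ger0_norm s0) ler_piMl.
Qed.

Lemma C11_jointly_continuous (X : 'rV[R]_N) (t : R) : a < t < b ->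
  cont_within `]a, b[ (phi X : R -> R^o) t -> jointly_continuous_at phi X t.
Proof.
move=> tab ct; apply: ball_jointly_continuous => e e0.
have e20 : 0 < e / 2 by rewrite divr_gt0.
have [d1 d10 h1] := strict_differentiability X tab ltr01.
have [d2 d20 h2] := open_itv_ball tab.
have [d3 d30 h3] := ct _ e20.
have p0 : 0 < 1 + N%:R * `|g X t| by rewrite ltr_wpDr ?mulr_ge0.
exists (Num.min (Num.min d1 d2) (Num.min d3 (e / 2 / (1 + N%:R * `|g X t|)))).
  by rewrite !lt_min d10 d20 d30 divr_gt0.
move=> Y s; rewrite !lt_min => /andP[/andP[Y1 _] /andP[_ Y3]] /andP[/andP[s1 s2] /andP[s3 _]].
rewrite ltr_pdivlMr // mulrC in Y3.
have XX : `|X - X| < d1 by rewrite subrr normr0.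
have k1 := h1 Y X s Y1 XX s1; rewrite mul1r in k1.
have k2 : `|phi X s - phi X t| < e / 2.
  by apply: h3 => //=; rewrite in_itv /=; exact: h2.
have k3 := ler_dot_norm (g X t) (Y - X).
have -> : phi Y s - phi X t = (phi Y s - phi X s - dot (g X t) (Y - X)) +
  dot (g X t) (Y - X) + (phi X s - phi X t) by ring.
have := ler_normD (phi Y s - phi X s - dot (g X t) (Y - X) + dot (g X t) (Y - X))
  (phi X s - phi X t).
have := ler_normD (phi Y s - phi X s - dot (g X t) (Y - X)) (dot (g X t) (Y - X)).
lra.
Qed.

Lemma has_deriv_within_joint (S : set R) (Y : R -> 'rV[R]_N) (t : R)
    (dY : 'rV[R]_N) (dt : R) : a < t < b -> S `<=` `]a, b[ -> S t ->
  has_deriv_within `]a, b[ (phi (Y t) : R -> R^o) t dt ->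
  has_deriv_within S Y t dY ->
  has_deriv_within S (fun s => phi (Y s) s : R^o) t (dot (g (Y t) t) dY + dt).
Proof.
move=> tab Sab St ht hY.
have -> : dot (g (Y t) t) dY + dt = dot (g (Y t) t) dY + 0 + dt by rewrite addr0.
apply: (@eq_has_deriv_within _ R^o _ (fun s => dot (g (Y t) t) (Y s) +
    (phi (Y s) s - phi (Y t) s - dot (g (Y t) t) (Y s)) + phi (Y t) s)) => //.
  by move=> s _; ring.
apply: has_deriv_withinD; last exact: has_deriv_within_subset ht.
apply: has_deriv_withinD.
  apply: has_deriv_within_comp hY => e e0; exists 1 => // Z _.
  by rewrite dotBr subrr normr0 mulr_ge0 // ltW.
move=> e e0; have p0 : 0 < 1 + `|dY| by rewrite ltr_wpDr.
have [d1 d10 h1] := strict_differentiability (Y t) tab (divr_gt0 e0 p0).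
have [d2 d20 h2] := hY 1 ltr01.
have [d3 d30 h3] := has_deriv_within_cont hY d10.
exists (Num.min d1 (Num.min d2 d3)); first by rewrite !lt_min d10 d20.
move=> s Ss; rewrite !lt_min => /and3P[s1 s2 s3].
have YY : `|Y t - Y t| < d1 by rewrite subrr normr0.
have := h1 (Y s) (Y t) s (h3 s Ss s3) YY s1.
have k3 : `|Y s - Y t| <= (1 + `|dY|) * `|s - t|.
  rewrite -(subrK ((s - t) *: dY) (Y s - Y t)).
  apply: le_trans (ler_normD _ _) _; rewrite normrZ mulrDl (mulrC `|dY|) lerD2r.
  exact: h2.
move=> /le_trans h; rewrite scaler0 subr0.
have -> : phi (Y s) s - phi (Y t) s - dot (g (Y t) t) (Y s) -
    (phi (Y t) t - phi (Y t) t - dot (g (Y t) t) (Y t)) =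
    phi (Y s) s - phi (Y t) s - dot (g (Y t) t) (Y s - Y t).
  by rewrite dotBr; ring.
apply: h; rewrite mulrAC ler_pdivrMr // -mulrA ler_wpM2l ?(ltW e0) //.
by rewrite mulrC.
Qed.

End Regular.

(** * Moving manifolds and the tracking field *)

Lemma has_deriv_within_coord (R : realType) (N : nat) (S : set R)
    (u : R -> 'rV[R]_N) (t : R) (d : 'rV[R]_N) (i : 'I_N) :
  has_deriv_within S u t d ->
  has_deriv_within S (fun s => u s 0 i : R^o) t (d 0 i).
Proof.
move=> h e /h[del del0 hd]; exists del => // s Ss st.
apply: le_trans (hd s Ss st).
by have := ler_coord_norm (u s - u t - (s - t) *: d) 0 i; rewrite !mxE.
Qed.

Lemma cont_within_jointly (R : realType) (N : nat) (W : normedModType R)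
    (S : set R) (phi : 'rV[R]_N -> R -> W) (Y : R -> 'rV[R]_N) (t : R) :
  jointly_continuous_at phi (Y t) t -> cont_within S Y t ->
  cont_within S (fun s => phi (Y s) s) t.
Proof.
move=> hphi hY e e0; have [d d0 hd] := jointly_continuous_ball hphi e0.
have [d' d'0 hd'] := hY d d0; exists (Num.min d d'); first by rewrite lt_min d0.
by move=> s Ss; rewrite lt_min => /andP[s1 s2]; apply: hd => //; exact: hd'.
Qed.

(** The inversion [I] is a parameter: [invmx] gives the pseudo-inverse of the equation,
    [truncated_inv d] the continuous substitute used for existence. *)
Definition pinv_with (R : realType) (N p : nat) (I : 'M[R]_p -> 'M[R]_p)
    (J : 'M[R]_(p, N)) : 'M[R]_(N, p) := J^T *m I (J *m J^T).

Definition flow_field (R : realType) (N p : nat) (I : 'M[R]_p -> 'M[R]_p)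
    (gF : 'rV[R]_N -> R -> 'rV[R]_N) (A : 'rV[R]_N -> R -> 'M[R]_(p, N))
    (Ht : 'rV[R]_N -> R -> 'rV[R]_p) (alpha : R) (X : 'rV[R]_N) (t : R) :
    'rV[R]_N :=
  let Jp := pinv_with I (A X t) in
  (- (alpha^-1 *: ((1%:M - Jp *m A X t) *m (gF X t)^T)) - Jp *m (Ht X t)^T)^T.

(* Agrees with [invmx] where the squared determinant is at least [d] > 0, and is
   continuous everywhere, so that Peano's theorem applies. *)
Definition truncated_inv (R : realType) (p : nat) (d : R) (K : 'M[R]_p) : 'M[R]_p :=
  (\det K / Num.max (\det K ^+ 2) d) *: \adj K.

Lemma truncated_invE (R : realType) (p : nat) (d : R) (K : 'M[R]_p) :
  0 < d -> d <= \det K ^+ 2 -> K \in unitmx /\ truncated_inv d K = invmx K.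
Proof.
move=> d0 dK; have K0 : \det K != 0.
  by rewrite -sqrf_eq0 gt_eqF // (lt_le_trans d0).
have uK : K \in unitmx by rewrite unitmxE unitfE.
split => //; rewrite /truncated_inv /invmx uK max_l //.
by rewrite expr2 invfM mulrA mulfV // mul1r.
Qed.

Lemma cvg_sqr (R : realType) (T : Type) (F : set_system T) {FF : Filter F}
    (f : T -> R) (l : R) : f @ F --> l -> f x ^+ 2 @[x --> F] --> l ^+ 2.
Proof.
move=> h; have -> : (fun x => f x ^+ 2) = f \* f.
  by apply/funext => x; rewrite /= expr2.
by rewrite expr2; exact: cvgM.
Qed.

(** * Orthogonal projection onto the kernel of a full-rank Jacobian *)

Section Projection.
Context {R : realType} {N p : nat}.
Variable J : 'M[R]_(p, N).
Hypothesis J_full : J *m J^T \in unitmx.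

Let Jp := pinv_with (@invmx R p) J.

Lemma mulmx_pinv : J *m Jp = 1%:M.
Proof. by rewrite /Jp /pinv_with mulmxA mulmxV. Qed.

Lemma mulmx_proj : J *m (1%:M - Jp *m J) = 0.
Proof. by rewrite mulmxBr mulmx1 mulmxA mulmx_pinv mul1mx subrr. Qed.

Lemma trmx_proj : (1%:M - Jp *m J)^T = 1%:M - Jp *m J.
Proof.
rewrite linearB /= trmx1 /Jp /pinv_with !trmx_mul trmxK trmx_inv.
by rewrite trmx_mul trmxK mulmxA.
Qed.

Lemma proj_idem : (1%:M - Jp *m J) *m (1%:M - Jp *m J) = 1%:M - Jp *m J.
Proof. by rewrite [LHS]mulmxBl mul1mx -(mulmxA Jp J) mulmx_proj mulmx0 subr0. Qed.

Lemma proj_ker (v : 'rV[R]_N) : J *m v^T = 0 -> (1%:M - Jp *m J) *m v^T = v^T.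
Proof. by move=> Jv; rewrite mulmxBl mul1mx -mulmxA Jv mulmx0 subr0. Qed.

End Projection.

(** The Jacobian and the time derivative are explicit arguments, so that the results can also be
    applied to the time-reversed constraint. *)
Definition constraint_data (R : realType) (N p : nat) (a b : R)
    (H : 'rV[R]_N -> R -> 'rV[R]_p) (A : 'rV[R]_N -> R -> 'M[R]_(p, N))
    (Ht : 'rV[R]_N -> R -> 'rV[R]_p) : Prop :=
  [/\ forall i, C11_in_x a b (fun X t => H X t 0 i) (fun X t => row i (A X t)),
      forall X t, a < t < b -> has_deriv_within `]a, b[ (H X) t (Ht X t),
      forall X t, a < t < b -> jointly_continuous_at Ht X t &
      forall X t, a < t < b -> H X t = 0 -> A X t *m (A X t)^T \in unitmx].

Section Flow.
Context {R : realType} {N p : nat} {a b : R}.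
Variables (H : 'rV[R]_N -> R -> 'rV[R]_p) (A : 'rV[R]_N -> R -> 'M[R]_(p, N)).
Variables (Ht : 'rV[R]_N -> R -> 'rV[R]_p) (gF : 'rV[R]_N -> R -> 'rV[R]_N).
Hypothesis HA : constraint_data a b H A Ht.
Hypothesis gF_cont : forall X t, a < t < b -> jointly_continuous_at gF X t.

Lemma jacobian_jointly_continuous X t : a < t < b -> jointly_continuous_at A X t.
Proof.
move=> tab; have [hA _ _ _] := HA; apply: cvg_mx => i j.
have [_ cA _] := hA i.
have : row i (A q.1 q.2) 0 j @[q --> (X, t)] --> row i (A X t) 0 j.
  by apply: cvg_mx_coord; exact: cA.
by rewrite mxE; under eq_cvg do rewrite mxE.
Qed.

Lemma constraint_jointly_continuous X t : a < t < b -> jointly_continuous_at H X t.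
Proof.
move=> tab; have [hA hH _ _] := HA; apply: cvg_mx => i j; rewrite ord1.
apply: (C11_jointly_continuous (hA j) tab).
exact/has_deriv_within_cont/has_deriv_within_coord/hH.
Qed.

Lemma gram_det_jointly_continuous X t : a < t < b ->
  jointly_continuous_at (fun X t => \det (A X t *m (A X t)^T) ^+ 2) X t.
Proof.
move=> tab; have cA := jacobian_jointly_continuous (X:=X) tab.
by apply: cvg_sqr; apply: cvg_det; apply: cvg_mulmx => //; apply: cvg_trmx.
Qed.

Lemma pinv_with_cvg (T : Type) (F : set_system T) {FF : Filter F}
    (I : 'M[R]_p -> 'M[R]_p) (J : T -> 'M[R]_(p, N)) (J0 : 'M[R]_(p, N)) :
  J @ F --> J0 -> I (J x *m (J x)^T) @[x --> F] --> I (J0 *m J0^T) ->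
  pinv_with I (J x) @[x --> F] --> pinv_with I J0.
Proof. by move=> hJ hI; apply: cvg_mulmx => //; by apply: cvg_trmx. Qed.

Lemma flow_field_cvg (T : Type) (F : set_system T) {FF : Filter F}
    (I : 'M[R]_p -> 'M[R]_p) (alpha : R) (X : T -> 'rV[R]_N) (s : T -> R)
    (X0 : 'rV[R]_N) (t : R) :
  a < t < b -> X @ F --> X0 -> s @ F --> t ->
  I (A (X x) (s x) *m (A (X x) (s x))^T) @[x --> F] --> I (A X0 t *m (A X0 t)^T) ->
  flow_field I gF A Ht alpha (X x) (s x) @[x --> F] -->
    flow_field I gF A Ht alpha X0 t.
Proof.
move=> tab hX hs hI; have [_ _ cHt _] := HA.
have cA : A (X x) (s x) @[x --> F] --> A X0 t.
  exact: (cvg_jointly (jacobian_jointly_continuous (X:=X0) tab) hX hs).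
have cg : gF (X x) (s x) @[x --> F] --> gF X0 t.
  exact: (cvg_jointly (@gF_cont X0 t tab) hX hs).
have cH : Ht (X x) (s x) @[x --> F] --> Ht X0 t.
  exact: (cvg_jointly (cHt X0 t tab) hX hs).
have cp := @pinv_with_cvg _ _ FF _ _ _ cA hI.
apply: cvg_trmx; apply: cvgB.
  apply: cvgN; apply: cvgZ; first by apply: cvg_cst.
  apply: cvg_mulmx; last by apply: cvg_trmx.
  by apply: cvgB; [apply: cvg_cst|apply: cvg_mulmx].
by apply: cvg_mulmx => //; by apply: cvg_trmx.
Qed.

Lemma truncated_inv_cvg (T : Type) (F : set_system T) {FF : Filter F} (d : R)
    (K : T -> 'M[R]_p) (K0 : 'M[R]_p) : 0 < d ->
  K @ F --> K0 -> truncated_inv d (K x) @[x --> F] --> truncated_inv d K0.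
Proof.
move=> d0 hK; apply: cvgZ; last by apply: cvg_adj.
apply: cvgM; first by apply: cvg_det.
apply: cvgV; first by rewrite gt_eqF // lt_max d0 orbT.
by apply: cvg_maxr_cst; apply: cvg_sqr; by apply: cvg_det.
Qed.

(** With half of [\det K0 ^+ 2] as threshold, the truncated inverse coincides with [invmx] at [K0]
    and eventually along the filter, and it is continuous. *)
Lemma invmx_cvg (T : Type) (F : set_system T) {FF : Filter F}
    (K : T -> 'M[R]_p) (K0 : 'M[R]_p) : K0 \in unitmx ->
  K @ F --> K0 -> invmx (K x) @[x --> F] --> invmx K0.
Proof.
move=> uK hK; have d0 : 0 < \det K0 ^+ 2.
  by rewrite exprn_even_gt0 //= -unitfE -unitmxE.
have d20 : 0 < \det K0 ^+ 2 / 2 by rewrite divr_gt0.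
have d2 : \det K0 ^+ 2 / 2 < \det K0 ^+ 2 by lra.
have [_ <-] := truncated_invE d20 (ltW d2).
apply: cvg_trans (truncated_inv_cvg d20 hK); apply: near_eq_cvg.
have : \det (K x) ^+ 2 @[x --> F] --> \det K0 ^+ 2.
  by apply: cvg_sqr; by apply: cvg_det.
move=> /cvgrPdist_lt/(_ _ d20); apply: filterS => x hx.
have hx2 : \det K0 ^+ 2 / 2 <= \det (K x) ^+ 2.
  by move: hx; rewrite ltr_norml; lra.
by have [_ ->] := truncated_invE d20 hx2.
Qed.

Lemma flow_field_jointly_continuous (d alpha : R) X t : 0 < d -> a < t < b ->
  jointly_continuous_at (flow_field (truncated_inv d) gF A Ht alpha) X t.
Proof.
move=> d0 tab; apply: flow_field_cvg => //; [exact: cvg_fst|exact: cvg_snd|].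
apply: truncated_inv_cvg => //; have cA := jacobian_jointly_continuous (X:=X) tab.
by apply: cvg_mulmx => //; by apply: cvg_trmx.
Qed.

Lemma flow_field_tangent (alpha : R) X t :
  A X t *m (A X t)^T \in unitmx ->
  flow_field (@invmx R p) gF A Ht alpha X t *m (A X t)^T = - Ht X t.
Proof.
move=> u; apply: trmx_inj; rewrite trmx_mul !trmxK linearN /= mulmxBr mulmxN.
by rewrite -scalemxAr mulmxA mulmx_proj // mul0mx scaler0 oppr0 sub0r mulmxA mulmx_pinv // mul1mx.
Qed.

(** The tangential part of the field is killed by the Jacobian and the normal part contributes
    [- Ht], which cancels the explicit time derivative of [H]. No basin is involved, so the
    conclusion covers competing solutions in the uniqueness argument. *)
Lemma constraint_preserved (alpha c d : R) (Y : R -> 'rV[R]_N) :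
  a < c -> d < b -> H (Y c) c = 0 ->
  (forall t, c <= t <= d -> A (Y t) t *m (A (Y t) t)^T \in unitmx /\
     has_deriv_within `[c, d] Y t (flow_field (@invmx R p) gF A Ht alpha (Y t) t)) ->
  forall t, c <= t <= d -> H (Y t) t = 0.
Proof.
move=> ac db H0 hY t /andP[ct td]; have [hA hH _ _] := HA.
have sub : `[c, t] `<=` `[c, d].
  by move=> s /=; rewrite !in_itv /= => /andP[-> /le_trans]; apply.
have subab : `[c, t] `<=` `]a, b[.
  move=> s /=; rewrite !in_itv /= => /andP[cs st].
  by rewrite (lt_le_trans ac) //= (le_lt_trans st) // (le_lt_trans td).
have dH i s : c <= s <= t ->
    has_deriv_within `[c, t] (fun s => H (Y s) s 0 i : R^o) s 0.
  move=> cst; have cs : `[c, t]%classic s by rewrite /= in_itv.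
  have sab : a < s < b by have := subab _ cs; rewrite /= in_itv.
  have cd : c <= s <= d by have := sub _ cs; rewrite /= in_itv.
  have [u dY] := hY s cd.
  have := has_deriv_within_joint (hA i) sab subab cs
    (has_deriv_within_coord i (hH (Y s) s sab)) (has_deriv_within_subset sub dY).
  suff -> : dot (row i (A (Y s) s))
    (flow_field (@invmx R p) gF A Ht alpha (Y s) s) + Ht (Y s) s 0 i = 0 by [].
  have := congr1 (fun M : 'rV[R]_p => M 0 i) (flow_field_tangent alpha u).
  rewrite [RHS]mxE [LHS]mxE => h; rewrite dotC dotE.
  rewrite (eq_bigr (fun k => flow_field (@invmx R p) gF A Ht alpha (Y s) s 0 k *
    (A (Y s) s)^T k i)) ?h ?addNr // => k _; congr (_ * _).
  by rewrite [RHS]mxE [LHS]mxE.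
apply/rowP => i; rewrite mxE; apply/eqP; rewrite eq_le.
(* A zero derivative bounds increments from above only; both signs of the component are needed. *)
have le0 (k : R) : k = 1 \/ k = -1 -> k * H (Y t) t 0 i <= 0.
  move=> hk; have := @deriv_le_increment R (fun s => k * H (Y s) s 0 i) (fun=> 0) c t 0 ct.
  rewrite H0 mxE mulr0 subr0 mul0r; apply => // s hs.
  by have := has_deriv_withinZ k (dH i s hs); rewrite scaler0.
by have := le0 1 (or_introl erefl); have := le0 (-1) (or_intror erefl); lra.
Qed.

End Flow.

(* Feasible points persist because they are carried along by the normal part of
   the flow, which replaces the implicit function theorem. *)
Lemma constraint_forward (R : realType) (N p : nat) (a b : R)
    (H : 'rV[R]_N -> R -> 'rV[R]_p) (A : 'rV[R]_N -> R -> 'M[R]_(p, N))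
    (Ht : 'rV[R]_N -> R -> 'rV[R]_p) (X : 'rV[R]_N) (t e : R) :
  constraint_data a b H A Ht -> a < t < b -> H X t = 0 -> 0 < e ->
  exists2 del : R, 0 < del & forall s, t <= s < t + del ->
    exists2 Y, `|Y - X| < e & H Y s = 0.
Proof.
move=> HA tab HX e0; have [_ _ _ licq] := HA.
pose gF (X : 'rV[R]_N) (t : R) : 'rV[R]_N := 0.
have cg Z s : a < s < b -> jointly_continuous_at gF Z s by move=> _; exact: cvg_cst.
have u0 := licq X t tab HX.
(* Half the value at [X]: for a short time the squared determinant stays above [d], so the truncated
   inverse is the true one. *)
pose d := \det (A X t *m (A X t)^T) ^+ 2 / 2.
have d0 : 0 < d by rewrite divr_gt0 // exprn_even_gt0 //= -unitfE -unitmxE.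
have /andP[at_ tb] := tab.
pose t' := (t + b) / 2.
have tt' : t <= t' by rewrite /t'; lra.
have t'b : t' < b by rewrite /t'; lra.
have tt't : t < t' by rewrite /t'; lra.
have M0 : 0 <= `|X| + 1 by rewrite addr_ge0.
have sab s : t <= s <= t' -> a < s < b by lra.
have [Y [Y0 hY]] := @peano_slab R N (flow_field (truncated_inv d) gF A Ht 1)
  t t' (`|X| + 1) X tt' M0
  (fun x s hs => flow_field_jointly_continuous (alpha:=1) (X:=x) HA cg d0 (sab s hs)).
have tin : t <= t <= t' by rewrite lexx.
have [cY _] := hY t tin.
have cdet : jointly_continuous_at
    (fun X t => \det (A X t *m (A X t)^T) ^+ 2) (Y t) t.
  exact: (gram_det_jointly_continuous (X:=Y t) HA tab).
have e1 : 0 < Num.min e 1 by rewrite lt_min e0 ltr01.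
have [d1 d10 h1] := cY _ e1.
have [d2 d20 h2] := cont_within_jointly (W := R^o)
  (phi := fun X t => \det (A X t *m (A X t)^T) ^+ 2) cdet cY d0.
pose del := Num.min (Num.min d1 d2) (t' - t).
exists del; first by rewrite !lt_min d10 d20 subr_gt0.
move=> s /andP[ts]; rewrite -ltrBlDl !lt_min => /andP[/andP[s1 s2] s3].
have close r : t <= r <= s -> `|Y r - X| < Num.min e 1 /\
    d <= \det (A (Y r) r *m (A (Y r) r)^T) ^+ 2.
  move=> /andP[tr rs].
  have rin : `[t, t']%classic r by rewrite /= in_itv /= tr /=; lra.
  have rt : `|r - t| = r - t by rewrite ger0_norm // subr_ge0.
  split; first by rewrite -{1}Y0; apply: h1 => //; rewrite rt; lra.
  have := h2 r rin; rewrite rt Y0 => /(_ _); rewrite ltr_norml.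
  by have r2 : r - t < d2 by [lra]; move=> /(_ r2) /andP[]; rewrite /d; lra.
have [|YsX _] := close s; first by rewrite ts lexx.
exists (Y s); first by move: YsX; rewrite lt_min => /andP[].
have sub : `[t, s] `<=` `[t, t'].
  by move=> r /=; rewrite !in_itv /= => /andP[-> rs]; lra.
apply: (@constraint_preserved _ _ _ _ _ H A Ht gF HA 1 t s Y) => //; last by rewrite ts lexx.
- by lra.
- by rewrite Y0.
move=> r rin; have [rX rd] := close r rin.
have [u eqI] := truncated_invE d0 rd; split => //.
have rin' : t <= r <= t' by lra.
have [_ hr] := hY r rin'; apply: has_deriv_within_subset sub _.
have -> : flow_field (@invmx R p) gF A Ht 1 (Y r) r =
    flow_field (truncated_inv d) gF A Ht 1 (Y r) r.
  by rewrite /flow_field /pinv_with eqI.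
apply: hr; rewrite -(subrK X (Y r)) addrC (le_trans (ler_normD _ _)) // lerD2l.
by move: rX; rewrite lt_min => /andP[_ /ltW].
Qed.

Lemma jointly_continuous_opp (R : realType) (N : nat) (W : normedModType R)
    (phi : 'rV[R]_N -> R -> W) X t :
  jointly_continuous_at phi X (- t) ->
  jointly_continuous_at (fun X t => phi X (- t)) X t.
Proof.
move=> h; apply: ball_jointly_continuous => e e0.
have [d d0 hd] := jointly_continuous_ball h e0; exists d => // Y s YX st.
by apply: hd => //; rewrite -opprD normrN.
Qed.

(** Reversing time changes the sign of the time derivative and nothing else; persistence of feasible
    points forward in time then gives persistence backward. *)
Lemma constraint_data_reverse (R : realType) (N p : nat) (a b : R)
    (H : 'rV[R]_N -> R -> 'rV[R]_p) (A : 'rV[R]_N -> R -> 'M[R]_(p, N))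
    (Ht : 'rV[R]_N -> R -> 'rV[R]_p) :
  constraint_data a b H A Ht ->
  constraint_data (- b) (- a) (fun X t => H X (- t)) (fun X t => A X (- t))
    (fun X t => - Ht X (- t)).
Proof.
have opp t : - b < t < - a -> a < - t < b by lra.
move=> [hA hH hHt licq]; split=> [i|X t /opp tab|X t /opp tab|X t /opp].
- have [h1 h2 h3] := hA i; split=> [X t /opp|X t /opp tab|M c d bc da].
  + exact: h1.
  + by apply: (@jointly_continuous_opp _ _ _ (fun X t => row i (A X t))); exact: h2.
  + have [||L L0 hL] := h3 M (- d) (- c); [lra|lra|].
    by exists L => // X Y t tcd; apply: hL; lra.
- move=> e e0; have [del del0 hd] := hH X (- t) tab e e0; exists del => // s.
  rewrite /= in_itv /= => /opp sab st.
  have := hd (- s); rewrite /= in_itv /= => /(_ sab).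
  have -> : - s - - t = - (s - t) by ring.
  by rewrite normrN scalerN scaleNr => /(_ st).
- apply: cvgN; by apply: (@jointly_continuous_opp _ _ _ Ht); exact: hHt.
- exact: licq.
Qed.

Lemma constraint_nearby (R : realType) (N p : nat) (a b : R)
    (H : 'rV[R]_N -> R -> 'rV[R]_p) (A : 'rV[R]_N -> R -> 'M[R]_(p, N))
    (Ht : 'rV[R]_N -> R -> 'rV[R]_p) (X : 'rV[R]_N) (t e : R) :
  constraint_data a b H A Ht -> a < t < b -> H X t = 0 -> 0 < e ->
  exists2 del : R, 0 < del & forall s, `|s - t| < del ->
    exists2 Y, `|Y - X| < e & H Y s = 0.
Proof.
move=> HA tab HX e0.
have [d1 d10 h1] := constraint_forward HA tab HX e0.
have tab' : - b < - t < - a by lra.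
have HX' : H X (- - t) = 0 by rewrite opprK.
have [d2 d20 h2] := constraint_forward (constraint_data_reverse HA) tab' HX' e0.
exists (Num.min d1 d2); first by rewrite lt_min d10.
move=> s; rewrite lt_min !ltr_norml => /andP[s1 s2].
have [ts|st] := leP t s; first by apply: h1; lra.
have [|Y YX HY] := h2 (- s); first by lra.
by exists Y => //; rewrite -(opprK s).
Qed.

(** * Basins *)

(** Near-covering form of compactness: each point handles its neighbours for all small [d] at once,
    so no monotonicity of [P] in [d] is required. One number [d] serves at the same time as radius,
    as margin and, through [d^-1], as upper bound. *)
Lemma compact_uniform (R : realType) (T : pseudoMetricType R) (D : set T)
    (P : T -> R -> Prop) : compact D ->
  (forall x, D x -> exists2 r : R, 0 < r & forall y d, D y -> ball x r y ->
     0 < d -> d < r -> P y d) ->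
  exists2 d : R, 0 < d & forall x, D x -> P x d.
Proof.
move=> /compact_near_coveringP/near_covering_withinP cD h.
have : \forall d \near 0^'+, D `<=` P ^~ d.
  apply: cD => x Dx; have [r r0 hr] := h x Dx.
  exists (ball x r, [set d : R | 0 < d] `&` [set d | d < r]).
    split; first exact: nbhsx_ballx.
    by apply: filterI; [exact: nbhs_right_gt|exact: nbhs_right_lt].
  by move=> [y d] [/= xy [d0 dr]] Dy; exact: hr.
move=> h'; have hp : \forall d \near (0 : R)^'+, 0 < d /\ D `<=` P ^~ d.
  by apply: filterI => //; exact: nbhs_right_gt.
by have [d [d0 hd]] := filter_ex hp; exists d.
Qed.

Lemma compact_uniform_jointly (R : realType) (N : nat) (D : set ('rV[R]_N * R))
    (P : 'rV[R]_N -> R -> R -> Prop) : compact D ->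
  (forall X t, D (X, t) -> exists2 r : R, 0 < r & forall Y s d, D (Y, s) ->
     `|Y - X| < r -> `|s - t| < r -> 0 < d -> d < r -> P Y s d) ->
  exists2 d : R, 0 < d & forall X t, D (X, t) -> P X t d.
Proof.
move=> cD h; have [|d d0 hd] := @compact_uniform R _ D (fun x => P x.1 x.2) cD.
  move=> [X t] /h[r r0 hr]; exists r => // -[Y s] d Dy [/=].
  by rewrite -!ball_normE /= => h1 h2; apply: hr => //; rewrite distrC.
by exists d => // X t /hd.
Qed.

Lemma closureP (R : realType) (N : nat) (A : set 'rV[R]_N) (X : 'rV[R]_N) :
  closure A X <-> forall e : R, 0 < e -> exists2 Y, A Y & `|Y - X| < e.
Proof.
split=> [cl e e0|h B /nbhs_ballP[e /= e0 eB]].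
  have [Y [AY]] := cl _ (nbhsx_ballx X e e0).
  by rewrite -ball_normE /= distrC => ?; exists Y.
have [Y AY YX] := h e e0; exists Y; split => //.
by apply: eB; rewrite -ball_normE /= distrC.
Qed.

Section Basin.
Context {R : realType} {N p : nat} {a b : R}.
Variables (F : 'rV[R]_N -> R -> R) (H : 'rV[R]_N -> R -> 'rV[R]_p).
Variables (V : set (R * 'rV[R]_N)).
Hypothesis F_cont : forall X t, a < t < b -> jointly_continuous_at F X t.
Hypothesis H_cont : forall X t, a < t < b -> jointly_continuous_at H X t.
Hypothesis V_basin : basin H `]a, b[ V.

Let K := basin_K H V.

Lemma basin_KE X t : a < t < b ->
  K t X <-> closure (slicing V t) X /\ H X t = 0.
Proof.
move=> tab; have [_ _ _ hcl _] := V_basin.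
by rewrite /K /basin_K hcl //= in_itv.
Qed.

Lemma slicing_basin_K X t : V (t, X) -> H X t = 0 -> K t X.
Proof. by move=> VX HX; apply: subset_closure; split. Qed.

Lemma basin_open X t : V (t, X) -> exists2 r : R, 0 < r &
  forall Y s, `|Y - X| < r -> `|s - t| < r -> V (s, Y).
Proof.
move=> VX; have [[oV _] _ _ _ _] := V_basin.
have : nbhs (t, X) V by apply: open_nbhs_nbhs.
move=> [[B1 B2] [/= /nbhs_ballP[r1 /= r10 h1] /nbhs_ballP[r2 /= r20 h2]] sub].
exists (Num.min r1 r2); first by rewrite lt_min r10.
move=> Y s; rewrite !lt_min => /andP[_ Y2] /andP[s1 _].
by apply: (sub (s, Y)); split; [apply: h1|apply: h2]; rewrite -ball_normE /= distrC.
Qed.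

Lemma slicing_bounded c d : a < c -> d < b ->
  exists2 M : R, 0 <= M & forall t X, c <= t <= d -> V (t, X) -> `|X| <= M.
Proof.
move=> ac db; have [_ bV _ _ _] := V_basin.
have [|e e0 he] := @compact_uniform R R^o `[c, d]
    (fun t e => forall X, V (t, X) -> `|X| <= e^-1) (@segment_compact R c d).
  move=> t /=; rewrite in_itv /= => /andP[ct td].
  have tab : `]a, b[%classic t.
    by rewrite /= in_itv /= (lt_le_trans ac ct) (le_lt_trans td db).
  have [C cC] := bV t tab; have [M [_ hM]] := compact_bounded cC.
  move=> /nbhs_ballP[r /= r0 hr].
  have M0 : 0 < `|M| + 1 by rewrite ltr_wpDl.
  exists (Num.min r (`|M| + 1)^-1); first by rewrite lt_min r0 invr_gt0.
  move=> s e; rewrite /= in_itv /= => /andP[cs sd] st e0.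
  rewrite lt_min => /andP[_ eM] X VX.
  have sr : ball t r s.
    by move: st; rewrite /ball /= => /lt_le_trans; apply; rewrite ge_min lexx.
  have sab : `]a, b[%classic s.
    by rewrite /= in_itv /= (lt_le_trans ac cs) (le_lt_trans sd db).
  have MM : M < `|M| + 1 by apply: le_lt_trans (ler_norm _) _; rewrite ltrDl.
  apply: le_trans (hM _ MM X (hr s sr sab X VX)) _.
  by rewrite -[leLHS]invrK lef_pV2 ?posrE ?invr_gt0 // ltW.
exists e^-1; first by rewrite invr_ge0 ltW.
by move=> t X tcd; apply: he; rewrite /= in_itv.
Qed.

Lemma basin_K_bounded c d : a < c -> d < b ->
  exists2 M : R, 0 <= M & forall t X, c <= t <= d -> K t X -> `|X| <= M.
Proof.
move=> ac db; have [M M0 hM] := slicing_bounded ac db; exists M => // t X tcd.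
move=> /closureP h; apply/ler_addgt0Pr => e e0; have [Y [VY _] YX] := h e e0.
have := hM t Y tcd VY; have := ler_normD (X - Y) Y.
by rewrite subrK distrC; lra.
Qed.

Definition tube (c d : R) : set ('rV[R]_N * R) :=
  [set q | c <= q.2 <= d /\ K q.2 q.1].

(** The constraint passes to the limit by continuity of [H]. Upper hemicontinuity with closed values
    gives a closed graph: a point at positive distance from the closed slice at [t] has a ball that
    the closed slices at nearby times avoid. *)
Lemma tube_compact c d : a < c -> d < b -> compact (tube c d).
Proof.
move=> ac db; have [M M0 hM] := basin_K_bounded ac db.
have cbox : compact ([set X : 'rV[R]_N | `|X| <= M] `*` `[c, d]%classic).
  by apply: compact_setX; [exact: rV_norm_compact|exact: segment_compact].
apply: subclosed_compact cbox _; last first.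
  by move=> [X t] [/= tcd KX]; split => /=; [exact: hM KX|rewrite in_itv].
move=> [X t] cl.
have near e : 0 < e -> exists Y s, [/\ `|Y - X| < e, `|s - t| < e, c <= s <= d & K s Y].
  move=> e0; have [] := cl (ball (X, t) e).
    by exists (ball X e, ball t e) => //; split; exact: nbhsx_ballx.
  move=> [Y s] [[/= scd KY] [/=]]; rewrite -!ball_normE /= => h1 h2.
  by exists Y, s; split => //; rewrite distrC.
have tcd : c <= t <= d.
  by apply/andP; split; apply/ler_addgt0Pr => e /near[Y [s [_]]];
    rewrite ltr_norml; lra.
have tab : a < t < b.
  by case/andP: tcd => ct td; rewrite (lt_le_trans ac ct) (le_lt_trans td db).
split => //=; apply/(basin_KE _ tab); split; last first.
  apply/eqP; rewrite -normr_le0; apply/ler_addgt0Pr => e e0; rewrite add0r.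
  have [r r0 hr] := jointly_continuous_ball (@H_cont X t tab) e0.
  have [Y [s [YX st scd]]] := near r r0.
  have sab : a < s < b.
    by case/andP: scd => ct td; rewrite (lt_le_trans ac ct) (le_lt_trans td db).
  move=> /(basin_KE _ sab)[_ HY].
  by have := hr Y s YX st; rewrite HY sub0r normrN => /ltW.
apply: contrapT => ncl.
have [r r0 hr] : exists2 r : R, 0 < r & forall Y, V (t, Y) -> r <= `|Y - X|.
  apply: contrapT => nr; apply: ncl; apply/closureP => e e0.
  apply: contrapT => nY; apply: nr; exists e => // Y VY; rewrite leNgt.
  by apply/negP => Ye; apply: nY; exists Y.
have [_ _ uV _ _] := V_basin.
pose O := ~` closed_ball_ Num.norm X (r / 3).
have oO : open O by apply: closed_openC; exact: closed_closed_ball_.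
have r3 : 0 < r / 3 by rewrite divr_gt0.
have sO : closure (slicing V t) `<=` O.
  move=> Z /closureP/(_ _ r3)[Y VY YZ]; rewrite /O /closed_ball_ /= => ZX.
  have := hr Y VY; have := ler_distD Z Y X; rewrite (distrC Z X); lra.
have tI : `]a, b[%classic t by rewrite /= in_itv.
have /nbhs_ballP[e /= e0 he] := uV t tI O oO sO.
have er0 : 0 < Num.min e (r / 3) by rewrite lt_min e0.
have [Y [s [YX st scd]]] := near _ er0.
have sab : a < s < b.
  by case/andP: scd => ct td; rewrite (lt_le_trans ac ct) (le_lt_trans td db).
move=> /(basin_KE _ sab)[clY _].
move: YX st; rewrite !lt_min => /andP[_ YX] /andP[st _].
have := he s; rewrite /ball /= distrC in_itv /= => /(_ st sab Y clY).
by apply; rewrite /closed_ball_ /= distrC ltW.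
Qed.

Lemma Kstar_exists t : a < t < b -> exists X, Kstar F H V t X.
Proof.
move=> tab; have [_ _ _ _ ne] := V_basin.
case/andP: (tab) => at_ tb; have [M M0 hM] := basin_K_bounded at_ tb.
have tt : t <= t <= t by rewrite lexx.
have cK : compact (K t).
  apply: bounded_closed_compact; last exact: closed_closure.
  exists M; split; first exact: num_real.
  by move=> r Mr X KX /=; apply: le_trans (ltW Mr); exact: hM KX.
have tI : `]a, b[%classic t by rewrite /= in_itv.
have [X0 [VX0 HX0]] := ne t tI.
have nK : K t !=set0 by exists X0; exact: slicing_basin_K.
have [|X KX hX] := compact_EVT_min nK cK (f := F ^~ t).
  apply/continuous_in_subspaceT => X _.
  apply: (@cvg_jointly _ _ _ _ (nbhs X) _ F id (fun=> t) X t); [|exact: cvg_id|exact: cvg_cst].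
  exact: F_cont.
exists X; split; first by move: KX; rewrite inE.
by move=> Y KY; apply: hX; rewrite inE.
Qed.

Definition Kstar_point (t : R) : 'rV[R]_N := xget 0 (Kstar F H V t).

Definition Fstar_real (t : R) : R := F (Kstar_point t) t.

Lemma Kstar_pointP t : a < t < b -> Kstar F H V t (Kstar_point t).
Proof. by move=> /Kstar_exists[X KX]; exact: (xgetPex 0 (ex_intro _ X KX)). Qed.

Lemma Fstar_real_le t X : a < t < b -> K t X -> Fstar_real t <= F X t.
Proof. by move=> tab KX; have [_] := Kstar_pointP tab; apply. Qed.

Lemma Kstar_Fstar t X : a < t < b -> Kstar F H V t X -> F X t = Fstar_real t.
Proof.
move=> tab [KX minX]; apply/eqP; rewrite eq_le Fstar_real_le // andbT.
by apply: minX; have [] := Kstar_pointP tab.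
Qed.

Lemma FstarE t : a < t < b -> Fstar F H V t = (Fstar_real t)%:E.
Proof.
move=> tab; apply/eqP; rewrite eq_le; apply/andP; split.
  by apply: ereal_inf_lbound; exists (Kstar_point t) => //; have [] := Kstar_pointP tab.
by apply: le_ereal_inf_tmp => _ [X KX <-]; rewrite lee_fin; exact: Fstar_real_le.
Qed.

End Basin.

(** * Level functions *)

Section Levels.
Context {R : realType} {N p : nat} {a b : R}.
Variables (F : 'rV[R]_N -> R -> R) (gF : 'rV[R]_N -> R -> 'rV[R]_N).
Variables (H : 'rV[R]_N -> R -> 'rV[R]_p) (A : 'rV[R]_N -> R -> 'M[R]_(p, N)).
Variables (Ht : 'rV[R]_N -> R -> 'rV[R]_p) (V : set (R * 'rV[R]_N)).
Hypothesis F_cont : forall X t, a < t < b -> jointly_continuous_at F X t.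
Hypothesis F_reg : C11_in_x a b F gF.
Hypothesis HA : constraint_data a b H A Ht.
Hypothesis V_basin : basin H `]a, b[ V.
Hypothesis Kstar_interior : forall t X, a < t < b -> Kstar F H V t X -> V (t, X).
Hypothesis critical_Kstar : forall t X, a < t < b -> V (t, X) -> H X t = 0 ->
  (forall v : 'rV[R]_N, A X t *m v^T = 0 -> gF X t *m v^T = 0) ->
  Kstar F H V t X.
Variables (t0 t1 : R).
Hypotheses (a_lt_t0 : a < t0) (t0_le_t1 : t0 <= t1) (t1_lt_b : t1 < b).

Let K := basin_K H V.
Let Fs := Fstar_real F H V.
Let I_sub t : t0 <= t <= t1 -> a < t < b.
Proof. by move: a_lt_t0 t1_lt_b => at0 t1b tI; lra. Qed.
Let H_cont X t : a < t < b -> jointly_continuous_at H X t.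
Proof. exact: (constraint_jointly_continuous (X:=X) HA). Qed.
Let tubeK := tube_compact H_cont V_basin a_lt_t0 t1_lt_b.

(** Upper bound: the minimizer at [t] lies in the open slice, and [constraint_nearby] provides
    feasible points close to it at nearby times, still in [V]. Lower bound: compactness of the
    tube. *)
Lemma Fstar_continuous t : t0 <= t <= t1 -> cont_within `[t0, t1] Fs t.
Proof.
move=> tI e e0; have tab := I_sub tI; have e20 : 0 < e / 2 by rewrite divr_gt0.
have KX := Kstar_pointP F_cont V_basin tab.
set X := Kstar_point F H V t in KX.
have VX := Kstar_interior tab KX.
have [_ HX] : closure (slicing V t) X /\ H X t = 0.
  by apply/(basin_KE V_basin X tab); case: KX.
have [r r0 hr] := basin_open V_basin VX.
have [d d0 hd] := jointly_continuous_ball (@F_cont X t tab) e20.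
have rd0 : 0 < Num.min r d by rewrite lt_min r0.
have [d1 d10 h1] := constraint_nearby HA tab HX rd0.
have [|d2 d20 h2] := compact_uniform_jointly
    (P := fun Y s d => `|s - t| < d -> Fs t - e < F Y s) tubeK.
  move=> Y s [/= sI KY]; have [st|st] := eqVneq s t.
    have [d2 d20 h2] := jointly_continuous_ball (@F_cont Y t tab) e0.
    exists d2 => // Z u k _ YZ; rewrite st => ut _ _ _.
    have := h2 Z u YZ ut; rewrite ltr_norml => /andP[+ _].
    rewrite st in KY; have := Fstar_real_le F_cont V_basin tab KY.
    by rewrite -/Fs; lra.
  (* Around a point of the tube at a time other than [t] the radius makes the premise of [P]
     false. *)
  have st0 : 0 < `|s - t| / 2 by rewrite divr_gt0 // normr_gt0 subr_eq0.
  exists (`|s - t| / 2) => // Z u k _ _ us _ kst ut; exfalso.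
  by have := ler_distD u s t; rewrite (distrC s u); lra.
exists (Num.min (Num.min r d) (Num.min d1 d2)); first by rewrite !lt_min r0 d0 d10.
move=> s; rewrite /= in_itv /= => sI; rewrite !lt_min.
move=> /andP[/andP[s1 s2] /andP[s3 s4]]; have sab := I_sub sI.
have [Y] := h1 s s3; rewrite lt_min => /andP[Yr Yd] HY.
have KY : K s Y by apply: slicing_basin_K => //; exact: hr.
have k1 := Fstar_real_le F_cont V_basin sab KY.
have := hd Y s Yd s2; rewrite !ltr_norml => /andP[_ k2].
have KsP := Kstar_pointP F_cont V_basin sab.
have k3 : Fs t - e < Fs s by apply: (h2 (Kstar_point F H V s) s) => //; split => //; case: KsP.
have k4 : F X t = Fs t by [].
by rewrite -/Fs in k1; lra.
Qed.

Lemma Fstar_gap : exists2 d : R, 0 < d &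
  forall X t, t0 <= t <= t1 -> K t X -> ~ V (t, X) -> Fs t + d <= F X t.
Proof.
have [|d d0 hd] := compact_uniform_jointly
    (P := fun X t d => ~ V (t, X) -> Fs t + d <= F X t) tubeK; last first.
  by exists d => // X t tI KX; apply: (hd X t).
move=> X t [/= tI KX]; have tab := I_sub tI.
have [VX|nVX] := pselect (V (t, X)).
  have [r r0 hr] := basin_open V_basin VX.
  by exists r => // Y s d _ YX st _ _ []; exact: hr.
have gap : 0 < F X t - Fs t.
  rewrite subr_gt0 lt_neqAle (Fstar_real_le F_cont V_basin tab KX) andbT.
  apply/eqP => FX; apply: nVX; apply: Kstar_interior => //; split => // Y KY.
  by rewrite -FX; exact: (Fstar_real_le F_cont V_basin tab).
(* One third each for the variation of [F], the variation of [Fs] and the margin itself. *)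
have g3 : 0 < (F X t - Fs t) / 3 by rewrite divr_gt0.
have [d1 d10 h1] := jointly_continuous_ball (@F_cont X t tab) g3.
have [d2 d20 h2] := Fstar_continuous tI g3.
exists (Num.min (Num.min d1 d2) ((F X t - Fs t) / 3)); first by rewrite !lt_min d10 d20.
move=> Y s d [/= sI _]; rewrite !lt_min => /andP[/andP[Y1 _] _] /andP[/andP[s1 s2] _].
move=> d0 /andP[_ d3] _; have := h1 Y s Y1 s1.
have sI' : `[t0, t1]%classic s by rewrite /= in_itv.
by have := h2 s sI' s2; rewrite !ltr_norml => /andP[_ k1] /andP[k2 _]; lra.
Qed.

(** Real-valued counterpart of [Khat]: quantifying over the points of [K] outside [V] replaces the
    extended minimum over the boundary, and a vacuous quantifier plays the part of the value
    [+oo]. *)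
Definition initial_set : set 'rV[R]_N :=
  [set X | K t0 X /\ forall Z, K t0 Z -> ~ V (t0, Z) ->
     F X t0 <= (Fs t0 + F Z t0) / 2].

Let t0I : t0 <= t0 <= t1. Proof. by rewrite lexx. Qed.

Let A0 := sup [set F X t0 | X in initial_set].

Let values_has_sup : has_sup [set F X t0 | X in initial_set].
Proof.
have tab := I_sub t0I.
have [KP _] := Kstar_pointP F_cont V_basin tab.
split.
  exists (F (Kstar_point F H V t0) t0); exists (Kstar_point F H V t0) => //.
  split => // Z KZ _; have := Fstar_real_le F_cont V_basin tab KZ.
  have -> : F (Kstar_point F H V t0) t0 = Fs t0 by [].
  by rewrite -/Fs; lra.
have [|d d0 hd] := compact_uniform_jointly
    (P := fun X t d => F X t <= d^-1) tubeK.
  move=> X t [/= tI _]; have [r r0 hr] := jointly_continuous_ball (@F_cont X t (I_sub tI)) ltr01.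
  have q0 : 0 < 1 + `|F X t| by rewrite ltr_wpDr.
  exists (Num.min r (1 + `|F X t|)^-1); first by rewrite lt_min r0 invr_gt0.
  move=> Y s d _; rewrite !lt_min => /andP[Y1 _] /andP[s1 _] d0 /andP[_ d1].
  have := hr Y s Y1 s1; rewrite ltr_norml => /andP[_ k].
  apply: (@le_trans _ _ (1 + `|F X t|)); first by have := ler_norm (F X t); lra.
  by rewrite -[leLHS]invrK lef_pV2 ?posrE ?invr_gt0 // ltW.
by exists d^-1 => _ [X [KX _] <-]; exact: (hd X t0).
Qed.

Let initial_le_A0 X : initial_set X -> F X t0 <= A0.
Proof. by move=> iX; apply: ub_le_sup; [exact: values_has_sup.2|exists X]. Qed.

Let Fs_le_A0 : Fs t0 <= A0.
Proof.
have [[_ [X iX _]] _] := values_has_sup.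
apply: le_trans (initial_le_A0 iX).
by apply: (Fstar_real_le F_cont V_basin (I_sub t0I)); case: iX.
Qed.

(** At [t0] the values outside [V] exceed [Fs t0] by the gap of [Fstar_gap], and [A0] is at most
    halfway up to them, so half of the gap remains above [A0]. Compactness carries a part of it to
    times shortly after [t0]. *)
Let initial_gap : exists2 d : R, 0 < d & forall X t, t0 <= t <= t1 -> K t X ->
  t - t0 < d -> ~ V (t, X) -> A0 + d <= F X t.
Proof.
have [|d d0 hd] := compact_uniform_jointly
    (P := fun X t d => t - t0 < d -> ~ V (t, X) -> A0 + d <= F X t) tubeK; last first.
  by exists d => // X t tI KX; apply: (hd X t).
move=> X t [/= tI KX]; have tab := I_sub tI; have [t0t _] := andP tI.
have [tt|tt] := ltP t0 t.
  have d0 : 0 < (t - t0) / 2 by rewrite divr_gt0 // subr_gt0.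
  exists ((t - t0) / 2) => // Y s d _ _; rewrite ltr_norml => /andP[h1 _] _ h2 h3; lra.
have {}tt : t = t0 by lra.
subst t; have [VX|nVX] := pselect (V (t0, X)).
  have [r r0 hr] := basin_open V_basin VX.
  by exists r => // Y s d _ YX st _ _ _ []; exact: hr.
have A0le : A0 <= (Fs t0 + F X t0) / 2.
  apply: ge_sup; first exact: values_has_sup.1.
  by move=> _ [Y [_ hY] <-]; exact: hY.
have [d d0 hd] := Fstar_gap; have gap := hd X t0 tI KX nVX.
have d40 : 0 < d / 4 by rewrite divr_gt0.
have [d1 d10 h1] := jointly_continuous_ball (@F_cont X t0 tab) d40.
exists (Num.min d1 (d / 4)); first by rewrite lt_min d10.
move=> Y s k _; rewrite !lt_min => /andP[Y1 _] /andP[s1 _] k0 /andP[_ k1] _ _.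
by have := h1 Y s Y1 s1; rewrite ltr_norml => /andP[k2 _]; lra.
Qed.

Lemma level_exists (eps nu : R) : 0 < eps -> 0 < nu ->
  exists (eta : R) (l : R -> R),
  [/\ 0 < eta,
      forall t, t0 <= t <= t1 -> cont_within `[t0, t1] l t,
      forall X, initial_set X -> F X t0 <= l t0,
      forall X t, t0 <= t <= t1 -> K t X -> F X t <= l t + 2 * eta -> V (t, X) &
      (forall t, t0 <= t <= t1 -> Fs t < l t) /\
      (forall t, t0 + nu <= t -> t <= t1 -> l t + 2 * eta <= Fs t + eps)].
Proof.
move=> eps0 nu0.
have [g g0 hg] := Fstar_gap; have [sg sg0 hsg] := initial_gap.
have sg4 : 0 < sg / 4 by rewrite divr_gt0.
have [d1 d10 h1] := Fstar_continuous t0I sg4.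
(* During the ramp [initial_gap] must apply and [Fs] must move by less than [sg / 4]; the ramp must
   be over by [t0 + nu]. *)
pose tau := Num.min (Num.min sg d1) nu.
have tau0 : 0 < tau by rewrite !lt_min sg0 d10.
(* After the ramp [l + 2 * eta] equals [Fs + 3 * eta], which must not exceed [Fs + eps] and must
   stay below the gap [g]. During the ramp it is below [A0 + 3 * eta + sg / 4], which must stay
   below [A0 + sg]. *)
pose eta := Num.min (eps / 3) (Num.min (g / 4) (sg / 8)).
have eta0 : 0 < eta by rewrite !lt_min !divr_gt0.
have [eta1 [eta2 eta3]] : eta <= eps / 3 /\ eta <= g / 4 /\ eta <= sg / 8.
  by rewrite /eta !ge_min !lexx !orbT.
have [tau1 [tau2 tau3]] : tau <= sg /\ tau <= d1 /\ tau <= nu.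
  by rewrite /tau !ge_min !lexx !orbT.
pose ramp t := Num.max ((A0 - Fs t0) * (1 - (t - t0) / tau)) 0.
pose l t := Fs t + eta + ramp t.
have ramp0 t : 0 <= ramp t by rewrite le_max lexx orbT.
have ramp_le t : t0 <= t -> ramp t <= A0 - Fs t0.
  move=> t0t; rewrite ge_max subr_ge0 Fs_le_A0 andbT ler_piMr ?subr_ge0 //.
  by rewrite gerBl divr_ge0 // ?subr_ge0 // ltW.
have ramp_far t : t0 + tau <= t -> ramp t = 0.
  move=> tt; apply/max_idPr; rewrite mulr_ge0_le0 ?subr_ge0 // subr_le0.
  by rewrite ler_pdivlMr // mul1r; lra.
have ramp_cont t e : 0 < e -> exists2 d : R, 0 < d &
    forall s, `|s - t| < d -> `|ramp s - ramp t| < e.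
  move=> e0; pose m := (1 + (A0 - Fs t0)) / tau.
  have c0 : 0 <= A0 - Fs t0 by rewrite subr_ge0.
  have m0 : 0 < m by rewrite divr_gt0 // ltr_wpDr.
  exists (e / m) => [|s]; first by rewrite divr_gt0.
  rewrite ltr_pdivlMr // => st; apply: le_lt_trans (maxr_lipschitz _ _ _) _.
  have -> : (A0 - Fs t0) * (1 - (s - t0) / tau) - (A0 - Fs t0) * (1 - (t - t0) / tau)
    = - ((s - t) * ((A0 - Fs t0) / tau)) by ring.
  rewrite normrN normrM; apply: le_lt_trans st; rewrite ler_wpM2l //.
  rewrite ger0_norm ?divr_ge0 // ?(ltW tau0) //.
  by rewrite /m ler_wpM2r ?invr_ge0 ?(ltW tau0) // lerDr.
exists eta, l; split => //.
- move=> t tI e e0; have e20 : 0 < e / 2 by rewrite divr_gt0.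
  have [d d0 hd] := Fstar_continuous tI e20; have [k k0 hk] := ramp_cont t _ e20.
  exists (Num.min d k) => [|s sI]; first by rewrite lt_min d0.
  rewrite lt_min => /andP[s1 s2]; rewrite /l.
  have -> : Fs s + eta + ramp s - (Fs t + eta + ramp t) =
    (Fs s - Fs t) + (ramp s - ramp t) by ring.
  apply: le_lt_trans (ler_normD _ _) _.
  by have := hd s sI s1; have := hk s s2; lra.
- move=> X iX; apply: le_trans (initial_le_A0 iX) _; rewrite /l.
  have : A0 - Fs t0 <= ramp t0 by rewrite /ramp subrr mul0r subr0 mulr1 le_max lexx.
  lra.
- move=> X t tI KX FX; apply: contrapT => nVX.
  have [t0t _] := andP tI; have [tt|tt] := ltP (t - t0) tau.
    have k1 : A0 + sg <= F X t by apply: hsg => //; lra.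
    have tI' : `[t0, t1]%classic t by rewrite /= in_itv.
    have : `|t - t0| < d1 by rewrite ger0_norm ?subr_ge0 //; lra.
    move=> /(h1 t tI'); rewrite ltr_norml => /andP[_ k2].
    by have := ramp_le t t0t; move: FX; rewrite /l; lra.
  have := hg X t tI KX nVX; move: FX; rewrite /l ramp_far; lra.
split=> t.
  by move=> tI; rewrite /l; have := ramp0 t; lra.
by move=> tnu tt1; rewrite /l ramp_far; lra.
Qed.

(** * Descent and drift of the objective along the field *)

Definition proj_at (X : 'rV[R]_N) (t : R) : 'M[R]_N :=
  1%:M - pinv_with (@invmx R p) (A X t) *m A X t.

(** The field is evaluated at time [t] and the objective is frozen at time [s]: along a trajectory,
    [F(Y(t), s)] has derivative [- alpha^-1 * descent_rate - drift_rate] in [t]. *)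
Definition descent_rate (X : 'rV[R]_N) (t s : R) : R :=
  dot (gF X s) (gF X t *m proj_at X t).

Definition drift_rate (X : 'rV[R]_N) (t s : R) : R :=
  dot (gF X s) (Ht X t *m (pinv_with (@invmx R p) (A X t))^T).

Lemma dot_flow_field (v : 'rV[R]_N) alpha X t : A X t *m (A X t)^T \in unitmx ->
  dot v (flow_field (@invmx R p) gF A Ht alpha X t) =
  - alpha^-1 * dot v (gF X t *m proj_at X t) -
  dot v (Ht X t *m (pinv_with (@invmx R p) (A X t))^T).
Proof.
move=> u; rewrite /flow_field linearB linearN linearZ /= dotBr.
rewrite -scaleNr dotZr !trmx_mul !trmxK trmx_proj //.
Qed.

(** For equal times the rate is the squared Euclidean norm of the projected gradient. If it
    vanished, the point would be critical, hence a minimizer because the basin is contracting. *)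
Lemma descent_rate_gt0 X t : a < t < b -> V (t, X) -> H X t = 0 ->
  Fs t < F X t -> 0 < descent_rate X t t.
Proof.
move=> tab VX HX FX; have [_ _ _ licq] := HA; have u := licq X t tab HX.
rewrite /descent_rate; set P := proj_at X t.
have PT : P^T = P  := trmx_proj _.
have -> : dot (gF X t) (gF X t *m P) = dot (gF X t *m P) (gF X t *m P).
  by rewrite dot_mulmxl PT -mulmxA [P *m P](proj_idem u).
rewrite lt_neqAle dot_ge0 andbT eq_sym dot_eq0; apply/eqP => gP.
suff /(Kstar_Fstar F_cont V_basin tab) : Kstar F H V t X.
  by rewrite -/Fs => FE; rewrite FE ltxx in FX.
apply: critical_Kstar => // v Jv.
by rewrite -(proj_ker Jv) mulmxA [X in X *m _]gP mul0mx.
Qed.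

Let rates_cvg X t : a < t < b -> H X t = 0 ->
  descent_rate q.1.1 q.1.2 q.2 @[q --> ((X, t), t)] --> descent_rate X t t /\
  drift_rate q.1.1 q.1.2 q.2 @[q --> ((X, t), t)] --> drift_rate X t t.
Proof.
move=> tab HX; have [_ _ cHt licq] := HA; have [_ cg _] := F_reg.
have u := licq X t tab HX.
have c1 : q.1.1 @[q --> ((X, t), t)] --> X.
  move=> B XB; exists (B `*` setT, setT); last by move=> [[Y s] r] [[]].
  by split; [exists (B, setT) => //; split => //|]; exact: filterT.
have c2 : q.1.2 @[q --> ((X, t), t)] --> t.
  move=> B tB; exists (setT `*` B, setT); last by move=> [[Y s] r] [[]].
  by split; [exists (setT, B) => //; split => //|]; exact: filterT.
have c3 : q.2 @[q --> ((X, t), t)] --> t by exact: cvg_snd.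
have FF : Filter (nbhs ((X, t), t)) by exact: filter_prod_filter.
have cA := cvg_jointly (FF:=FF) (jacobian_jointly_continuous (X:=X) HA tab) c1 c2.
have cK : A q.1.1 q.1.2 *m (A q.1.1 q.1.2)^T @[q --> ((X, t), t)] -->
    A X t *m (A X t)^T.
  by apply: cvg_mulmx => //; apply: cvg_trmx.
have cp := pinv_with_cvg (FF:=FF) cA (invmx_cvg (FF:=FF) u cK).
have cg2 := cvg_jointly (FF:=FF) (cg X t tab) c1 c3.
split; apply: cvg_dot => //; apply: cvg_mulmx.
- exact: (cvg_jointly (FF:=FF) (cg X t tab) c1 c2).
- by apply: cvgB; [apply: cvg_cst|apply: cvg_mulmx].
- exact: (cvg_jointly (FF:=FF) (cHt X t tab) c1 c2).
- by apply: cvg_trmx.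
Qed.

Let near_triple (Q : 'rV[R]_N -> R -> R -> R) (X : 'rV[R]_N) (t l e : R) : 0 < e ->
  Q q.1.1 q.1.2 q.2 @[q --> ((X, t), t)] --> l ->
  exists2 r : R, 0 < r & forall Y s u, `|Y - X| < r -> `|s - t| < r ->
    `|u - t| < r -> `|Q Y s u - l| < e.
Proof.
move=> e0 /cvgrPdist_lt/(_ e e0)[[B1 B2] [/= [[B3 B4] [/= h3 h4] sub1] h2] sub].
move: h2 h3 h4 => /nbhs_ballP[r2 /= r20 h2] /nbhs_ballP[r3 /= r30 h3].
move=> /nbhs_ballP[r4 /= r40 h4].
exists (Num.min r2 (Num.min r3 r4)); first by rewrite !lt_min r20 r30.
move=> Y s u; rewrite !lt_min => /and3P[_ Y3 _] /and3P[_ _ s4] /and3P[u2 _ _].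
rewrite distrC; apply: (sub ((Y, s), u)); split => /=.
  by apply: sub1; split; [apply: h3|apply: h4]; rewrite -ball_normE /= distrC.
by apply: h2; rewrite -ball_normE /= distrC.
Qed.

Lemma tube_bounds (eta : R) (l : R -> R) : 0 < eta ->
  (forall t, t0 <= t <= t1 -> cont_within `[t0, t1] l t) ->
  (forall X t, t0 <= t <= t1 -> K t X -> F X t <= l t + 2 * eta -> V (t, X)) ->
  (forall t, t0 <= t <= t1 -> Fs t < l t) ->
  exists2 d : R, 0 < d & forall X t s, t0 <= t <= t1 -> K t X ->
    t0 <= s <= t1 -> `|s - t| < d ->
    [/\ l t <= F X t -> F X t <= l t + 2 * eta -> d <= descent_rate X t s,
        `|drift_rate X t s| <= d^-1,
        `|F X s - F X t| <= eta / 2 & `|l s - l t| <= eta / 2].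
Proof.
move=> eta0 cl lV Fl.
have [|d d0 hd] := compact_uniform_jointly (P := fun X t d =>
  forall s, t0 <= s <= t1 -> `|s - t| < d ->
    [/\ l t <= F X t -> F X t <= l t + 2 * eta -> d <= descent_rate X t s,
        `|drift_rate X t s| <= d^-1,
        `|F X s - F X t| <= eta / 2 & `|l s - l t| <= eta / 2]) tubeK; last first.
  by exists d => // X t s tI KX; exact: (hd X t).
move=> X t [/= tI KX]; have tab := I_sub tI.
have [clX HX] : closure (slicing V t) X /\ H X t = 0 by apply/(basin_KE V_basin X tab).
have [c1 c2] := rates_cvg tab HX.
have e4 : 0 < eta / 4 by rewrite divr_gt0.
have [dF dF0 hF] := jointly_continuous_ball (@F_cont X t tab) e4.
have [dl dl0 hl] := cl t tI _ e4.
have [d2 d20 h2] := near_triple ltr01 c2.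
have q0 : 0 < 1 + `|drift_rate X t t| by rewrite ltr_wpDr.
(* In the closed band the rate is positive at [X] and stays above half its value nearby; off the
   band, nearby points are off the band too and the claim is vacuous. *)
have [d1 d10 h1] : exists2 r : R, 0 < r & forall Y s u d, t0 <= s <= t1 ->
    `|Y - X| < r -> `|s - t| < r -> `|u - t| < r -> d < r ->
    l s <= F Y s -> F Y s <= l s + 2 * eta -> d <= descent_rate Y s u.
  have [band|nband] := boolP (l t <= F X t <= l t + 2 * eta).
    have [b1 b2] := andP band; have VX := lV X t tI KX b2.
    have Q0 := descent_rate_gt0 tab VX HX (lt_le_trans (Fl t tI) b1).
    have Q20 : 0 < descent_rate X t t / 2 by rewrite divr_gt0.
    have [r r0 hr] := near_triple Q20 c1.
    exists (Num.min r (descent_rate X t t / 2)); first by rewrite lt_min r0.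
    move=> Y s u d _; rewrite !lt_min => /andP[Y1 _] /andP[s1 _] /andP[u1 _] /andP[_ k] _ _.
    by have := hr Y s u Y1 s1 u1; rewrite ltr_norml => /andP[k1 _]; lra.
  have [m m0 hm] : exists2 m : R, 0 < m & forall x y : R, `|x - F X t| < m -> `|y - l t| < m ->
      ~ (y <= x /\ x <= y + 2 * eta).
    move: nband; rewrite negb_and -!ltNge => /orP[c|c].
      exists ((l t - F X t) / 2); first by rewrite divr_gt0 // subr_gt0.
      by move=> x y; rewrite !ltr_norml => /andP[_ x1] /andP[y1 _] []; lra.
    exists ((F X t - (l t + 2 * eta)) / 2); first by rewrite divr_gt0 // subr_gt0.
    by move=> x y; rewrite !ltr_norml => /andP[x1 _] /andP[_ y1] []; lra.
  have [k1 k10 hk1] := jointly_continuous_ball (@F_cont X t tab) m0.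
  have [k2 k20 hk2] := cl t tI m m0.
  exists (Num.min k1 k2); first by rewrite lt_min k10.
  move=> Y s u d sI; rewrite !lt_min => /andP[Y1 _] /andP[s1 s2] _ _ b1 b2; exfalso.
  have sI' : `[t0, t1]%classic s by rewrite /= in_itv.
  by apply: (hm _ _ (hk1 Y s Y1 s1) (hk2 s sI' s2)).
pose r := Num.min (Num.min dF dl) (Num.min (Num.min d1 d2) (1 + `|drift_rate X t t|)^-1).
have r0 : 0 < r / 2 by rewrite divr_gt0 // !lt_min dF0 dl0 d10 d20 invr_gt0.
have [[rF rl] [r1 [r2 r3]]] : (r <= dF /\ r <= dl) /\ r <= d1 /\ r <= d2 /\
    r <= (1 + `|drift_rate X t t|)^-1.
  by rewrite /r !ge_min !lexx !orbT.
exists (r / 2) => // Y s d [/= sI KY] YX st d0 dr u uI us.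
have ut : `|u - t| < r by have := ler_distD s u t; lra.
have uI' : `[t0, t1]%classic u by rewrite /= in_itv.
have sI' : `[t0, t1]%classic s by rewrite /= in_itv.
have st' : `|s - t| < r by lra.
have YX' : `|Y - X| < r by lra.
split.
- by move=> b1 b2; apply: (h1 Y s u d sI); rewrite // (lt_le_trans _ r1) //; lra.
- apply: (@le_trans _ _ (1 + `|drift_rate X t t|)).
    have := h2 Y s u (lt_le_trans YX' r2) (lt_le_trans st' r2) (lt_le_trans ut r2).
    have := ler_normD (drift_rate Y s u - drift_rate X t t) (drift_rate X t t).
    by rewrite subrK; lra.
  by rewrite -[leLHS]invrK lef_pV2 ?posrE ?invr_gt0 //; lra.
- have := hF Y s (lt_le_trans YX' rF) (lt_le_trans st' rF).
  have := hF Y u (lt_le_trans YX' rF) (lt_le_trans ut rF).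
  by have := ler_distD (F X t) (F Y u) (F Y s); rewrite (distrC (F X t)); lra.
- have := hl u uI' (lt_le_trans ut rl); have := hl s sI' (lt_le_trans st' rl).
  by have := ler_distD (l t) (l u) (l s); rewrite (distrC (l t)); lra.
Qed.

End Levels.

(** * Trapping of trajectories *)

Section Trapping.
Context {R : realType} {N p : nat} {a b : R}.
Variables (F : 'rV[R]_N -> R -> R) (gF : 'rV[R]_N -> R -> 'rV[R]_N).
Variables (H : 'rV[R]_N -> R -> 'rV[R]_p) (A : 'rV[R]_N -> R -> 'M[R]_(p, N)).
Variables (Ht : 'rV[R]_N -> R -> 'rV[R]_p) (V : set (R * 'rV[R]_N)).
Hypothesis F_cont : forall X t, a < t < b -> jointly_continuous_at F X t.
Hypothesis F_reg : C11_in_x a b F gF.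
Hypothesis HA : constraint_data a b H A Ht.
Hypothesis V_basin : basin H `]a, b[ V.
Variables (t0 t1 : R).
Hypotheses (a_lt_t0 : a < t0) (t0_le_t1 : t0 <= t1) (t1_lt_b : t1 < b).
Variables (eta d : R) (l : R -> R).
Hypotheses (eta_gt0 : 0 < eta) (d_gt0 : 0 < d).
Hypothesis l_cont : forall t, t0 <= t <= t1 -> cont_within `[t0, t1] l t.
Hypothesis l_interior : forall X t, t0 <= t <= t1 -> basin_K H V t X ->
  F X t <= l t + 2 * eta -> V (t, X).
Hypothesis bounds : forall X t s, t0 <= t <= t1 -> basin_K H V t X ->
  t0 <= s <= t1 -> `|s - t| < d ->
  [/\ l t <= F X t -> F X t <= l t + 2 * eta -> d <= descent_rate gF A X t s,
      `|drift_rate gF A Ht X t s| <= d^-1,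
      `|F X s - F X t| <= eta / 2 & `|l s - l t| <= eta / 2].
Variable alpha : R.
Hypotheses (alpha_gt0 : 0 < alpha) (alpha_small : alpha * (d^-1 + 8 * eta / d) <= d).

Let K := basin_K H V.
Let I_sub t : t0 <= t <= t1 -> a < t < b.
Proof. by move: a_lt_t0 t1_lt_b => at0 t1b tI; lra. Qed.
Let H_cont X t : a < t < b -> jointly_continuous_at H X t.
Proof. exact: (constraint_jointly_continuous (X:=X) HA). Qed.

(* [F] need not be differentiable in time: over a window of length less than [d]
   its time argument is frozen. *)
Lemma barrier (Y : R -> 'rV[R]_N) (T : R) : t0 <= T <= t1 ->
  (forall t, t0 <= t <= T -> [/\ K t (Y t), F (Y t) t <= l t + 2 * eta &
     has_deriv_within `[t0, T] Y t (flow_field (@invmx R p) gF A Ht alpha (Y t) t)]) ->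
  F (Y t0) t0 <= l t0 -> F (Y T) T < l T + 2 * eta.
Proof.
move=> /andP[t0T Tt1] hY F0; have d0 := d_gt0; have eta0 := eta_gt0.
pose u t := F (Y t) t - l t.
have cu t : t0 <= t <= T -> cont_within `[t0, T] u t.
  move=> tT; have tI : t0 <= t <= t1 by lra.
  have [KY _ dY] := hY t tT; move=> e e0; have e20 : 0 < e / 2 by rewrite divr_gt0.
  have [d1 d10 h1] := cont_within_jointly (W := R^o) (@F_cont (Y t) t (I_sub tI))
    (has_deriv_within_cont dY) e20.
  have [d2 d20 h2] := l_cont tI e20; exists (Num.min d1 d2); first by rewrite lt_min d10.
  move=> s sT; rewrite lt_min => /andP[s1 s2]; rewrite /u.
  have sI : `[t0, t1]%classic s by move: sT; rewrite /= !in_itv /=; lra.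
  have := h1 s sT s1; have := h2 s sI s2.
  have -> : F (Y s) s - l s - (F (Y t) t - l t) = (F (Y s) s - F (Y t) t) - (l s - l t).
    by ring.
  have := ler_normB (F (Y s) s - F (Y t) t) (l s - l t).
  by move=> k1 k2 k3; apply: le_lt_trans k1 _; rewrite (splitr e) ltrD.
have u0 : u t0 <= 0 by rewrite /u subr_le0.
(* From this time [s] on the trajectory is above the level, hence in the band, where the descent
   rate is bounded below. *)
have [s [/andP[t0s sT] us] upos] := last_nonpos t0T cu u0.
have [sT'|sT'] := ltP s T; last first.
  have -> : T = s by lra.
  by move: us; rewrite /u; lra.
have sI : t0 <= s <= t1 by lra.
have us0 : u s = 0.
  apply/eqP; rewrite eq_le us leNgt /=; apply/negP => usn.
  have nu0 : 0 < - u s by rewrite oppr_gt0.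
  have sTT : t0 <= s <= T by lra.
  have [e e0 he] := cu s sTT _ nu0.
  pose r := Num.min T (s + e / 2).
  have sr : s < r by rewrite lt_min sT' ltrDl divr_gt0.
  have rT : r <= T by rewrite ge_min lexx.
  have re : r <= s + e / 2 by rewrite ge_min lexx orbT.
  have rin : `[t0, T]%classic r by rewrite /= in_itv /=; lra.
  have := he r rin; rewrite gtr0_norm ?subr_gt0 // => /(_ _) h.
  have {h} : `|u r - u s| < - u s by apply: h; lra.
  by rewrite ltr_norml; have := upos r sr rT; lra.
pose r := Num.min T (s + d / 2).
have sr : s < r by rewrite lt_min sT' ltrDl divr_gt0.
have rT : r <= T by rewrite ge_min lexx.
have re : r <= s + d / 2 by rewrite ge_min lexx orbT.
have near t : s <= t <= r -> `|s - t| < d.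
  by move=> str; rewrite ler0_norm ?subr_le0; lra.
(* By the bound on [alpha], the descent term [alpha^-1 * d] outweighs the drift [d^-1] and leaves
   the slope [- kap]. *)
pose kap := 8 * eta / d.
have dec : F (Y r) s - F (Y s) s <= - kap * (r - s).
  apply: (@deriv_le_increment R (fun t => F (Y t) s) (fun t =>
    dot (gF (Y t) s) (flow_field (@invmx R p) gF A Ht alpha (Y t) t)) s r (- kap) (ltW sr)).
    move=> t str; have tT : t0 <= t <= T by lra.
    have [KY _ dY] := hY t tT; case: F_reg => hg _ _.
    apply: (has_deriv_within_comp (f := F ^~ s)); first exact/hg/I_sub.
    apply: has_deriv_within_subset dY => q /=; rewrite !in_itv /=; lra.
  move=> t str; have tT : t0 <= t <= T by lra.
  have tI : t0 <= t <= t1 by lra.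
  have [KY Fl dY] := hY t tT; have [_ _ _ licq] := HA.
  have [_ HYt] : closure (slicing V t) (Y t) /\ H (Y t) t = 0.
    by apply/(basin_KE V_basin (Y t) (I_sub tI)).
  have uK := licq (Y t) t (I_sub tI) HYt.
  rewrite dot_flow_field // -/(descent_rate gF A (Y t) t s) -/(drift_rate gF A Ht (Y t) t s).
  have [q1 q2 _ _] := bounds tI KY sI (near t str).
  have lF : l t <= F (Y t) t.
    have [->|ts] := eqVneq t s; first by move: us0; rewrite /u; lra.
    have st : s < t by rewrite lt_neqAle eq_sym ts; case/andP: str.
    have tleT : t <= T by case/andP: tT.
    by have := upos t st tleT; rewrite /u subr_gt0 => /ltW.
  have {}q1 := q1 lF Fl; move: q2; rewrite ler_norml => /andP[q2 _].
  have k1 : d^-1 + kap <= alpha^-1 * d.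
    by rewrite mulrC ler_pdivlMr // mulrC.
  have k2 : alpha^-1 * d <= alpha^-1 * descent_rate gF A (Y t) t s.
    by rewrite ler_pM2l // invr_gt0.
  lra.
have rI : t0 <= r <= t1 by lra.
have rTT : t0 <= r <= T by lra.
have [KYr _ _] := hY r rTT; have rr : s <= r <= r by lra.
have [_ _ b1 b2] := bounds rI KYr sI (near r rr).
move: b1 b2; rewrite !ler_norml => /andP[b1 b1'] /andP[b2 b2'].
have kap0 : 0 <= kap by rewrite divr_ge0 ?mulr_ge0 // ltW.
have usE : F (Y s) s = l s by move: us0; rewrite /u; lra.
(* If the window reaches [T], freezing costs at most [eta / 2] for each of [F] and [l], less than
   [2 * eta]. Otherwise the drop [kap * (d / 2) = 4 * eta] brings the trajectory below [l] after
   [s], which contradicts the choice of [s]. *)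
have [rE|rE] : r = T \/ r = s + d / 2.
  by rewrite /r; case: leP; [left|right].
  have k : 0 <= kap * (r - s) by rewrite mulr_ge0 // subr_ge0 ltW.
  by rewrite -rE; lra.
have kE : kap * (r - s) = 4 * eta.
  by rewrite rE /kap; field; rewrite gt_eqF.
by have := upos r sr rT; rewrite /u; lra.
Qed.

(** Real induction on being in [K] and below [l + 2 * eta]. The barrier makes the second bound
    strict, which puts the point in the open set [V] and lets the property extend to the right;
    closedness of the tube gives the limit clause. *)
Lemma trapped_solution (X0 : 'rV[R]_N) : K t0 X0 -> F X0 t0 <= l t0 ->
  exists Y : R -> 'rV[R]_N, Y t0 = X0 /\ forall t, t0 <= t <= t1 ->
    [/\ K t (Y t), F (Y t) t <= l t + 2 * eta,
        A (Y t) t *m (A (Y t) t)^T \in unitmx &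
        has_deriv_within `[t0, t1] Y t (flow_field (@invmx R p) gF A Ht alpha (Y t) t)].
Proof.
move=> KX0 FX0; have eta0 := eta_gt0.
have tubeK := tube_compact H_cont V_basin a_lt_t0 t1_lt_b.
have [M M0 hM] := basin_K_bounded V_basin a_lt_t0 t1_lt_b.
have [_ _ _ licq] := HA; have [_ cg _] := F_reg.
(* The squared determinant is at least [2 * d0] on the tube, so it remains above the threshold [d0]
   for a while before membership in [K] has been re-established; the radius [M + 1] leaves similar
   room. *)
have [|d0 d00 hd0] := compact_uniform_jointly (P := fun X t e =>
    2 * e <= \det (A X t *m (A X t)^T) ^+ 2) tubeK.
  move=> X t [/= tI KX]; have tab := I_sub tI.
  have [_ HX] : closure (slicing V t) X /\ H X t = 0 by apply/(basin_KE V_basin X tab).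
  have D0 : 0 < \det (A X t *m (A X t)^T) ^+ 2.
    by rewrite exprn_even_gt0 //= -unitfE -unitmxE licq.
  have D20 : 0 < \det (A X t *m (A X t)^T) ^+ 2 / 4 by rewrite divr_gt0.
  have [r r0 hr] := jointly_continuous_ball (W := R^o)
    (phi := fun X t => \det (A X t *m (A X t)^T) ^+ 2)
    (gram_det_jointly_continuous (X:=X) HA tab) D20.
  exists (Num.min r (\det (A X t *m (A X t)^T) ^+ 2 / 4)); first by rewrite lt_min r0.
  move=> Z s e _; rewrite !lt_min => /andP[Z1 _] /andP[s1 _] _ /andP[_ e1].
  by have := hr Z s Z1 s1; rewrite ltr_norml => /andP[k _]; lra.
have M10 : 0 <= M + 1 by rewrite addr_ge0.
have [Y [Y0 hY]] := @peano_slab R N (flow_field (truncated_inv d0) gF A Ht alpha)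
  t0 t1 (M + 1) X0 t0_le_t1 M10
  (fun x t tI => flow_field_jointly_continuous (alpha:=alpha) (X:=x) HA
     (fun X t => cg X t) d00 (I_sub tI)).
have cY t : t0 <= t <= t1 -> cont_within `[t0, t1] Y t by move=> /hY[].
exists Y; split => //.
have good t : t0 <= t <= t1 -> `|Y t| <= M + 1 ->
    d0 <= \det (A (Y t) t *m (A (Y t) t)^T) ^+ 2 ->
    A (Y t) t *m (A (Y t) t)^T \in unitmx /\
    has_deriv_within `[t0, t1] Y t (flow_field (@invmx R p) gF A Ht alpha (Y t) t).
  move=> tI YM Yd; have [uK eqI] := truncated_invE d00 Yd; split => //.
  have [_ /(_ YM)] := hY t tI.
  by rewrite /flow_field /pinv_with eqI.
have Kgood t : t0 <= t <= t1 -> K t (Y t) -> `|Y t| <= M + 1 /\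
    d0 <= \det (A (Y t) t *m (A (Y t) t)^T) ^+ 2.
  move=> tI KY; split; first by have := hM t (Y t) tI KY; lra.
  have D := hd0 (Y t) t (conj tI KY); lra.
have main : forall t, t0 <= t <= t1 -> K t (Y t) /\ F (Y t) t <= l t + 2 * eta; last first.
  move=> t tI; have [KY Fl] := main t tI.
  by have [YM Yd] := Kgood t tI KY; have [] := good t tI YM Yd.
have sub t : t <= t1 -> `[t0, t] `<=` `[t0, t1].
  by move=> tt1 s /=; rewrite !in_itv /=; lra.
have t0I : t0 <= t0 <= t1 by rewrite lexx.
pose u t := F (Y t) t - l t.
have cu t : t0 <= t <= t1 -> cont_within `[t0, t1] u t.
  move=> tI e e0; have e20 : 0 < e / 2 by rewrite divr_gt0.
  have [d1 d10 h1] := cont_within_jointly (W := R^o) (@F_cont (Y t) t (I_sub tI))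
    (cY t tI) e20.
  have [d2 d20 h2] := l_cont tI e20; exists (Num.min d1 d2); first by rewrite lt_min d10.
  move=> s sI; rewrite lt_min => /andP[s1 s2]; rewrite /u.
  have := h1 s sI s1; have := h2 s sI s2.
  have -> : F (Y s) s - l s - (F (Y t) t - l t) = (F (Y s) s - F (Y t) t) - (l s - l t).
    by ring.
  have := ler_normB (F (Y s) s - F (Y t) t) (l s - l t).
  by move=> k1 k2 k3; apply: le_lt_trans k1 _; rewrite (splitr e) ltrD.
apply: (@real_induction _ (fun t => K t (Y t) /\ F (Y t) t <= l t + 2 * eta)).
- by rewrite Y0; split => //; lra.
- move=> t t0t tt1 ih; have tI : t0 <= t <= t1 by lra.
  have tt : t0 <= t <= t by lra.
  have strict : F (Y t) t < l t + 2 * eta.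
    apply: (@barrier Y t tI); last by rewrite Y0.
    move=> s st; have sI : t0 <= s <= t1 by lra.
    have [KY Fl] := ih s st; have [YM Yd] := Kgood s sI KY.
    have [_ dY] := good s sI YM Yd; split => //.
    exact: has_deriv_within_subset (sub t (ltW tt1)) dY.
  have [KYt Flt] := ih t tt; have VY := l_interior tI KYt (ltW strict).
  have [r r0 hr] := basin_open V_basin VY.
  have g0 : 0 < - (u t - 2 * eta) by rewrite /u; lra.
  have [e1 e10 h1] := cu t tI _ g0.
  have [e2 e20 h2] := cY t tI r r0.
  have [e3 e30 h3] := cY t tI 1 ltr01.
  have tab := I_sub tI.
  have [e4 e40 h4] := cont_within_jointly (W := R^o)
    (phi := fun X t => \det (A X t *m (A X t)^T) ^+ 2)
    (gram_det_jointly_continuous (X:=Y t) HA tab) (cY t tI) d00.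
  pose e := Num.min (Num.min r e1) (Num.min e2 (Num.min e3 e4)).
  have e0 : 0 < e by rewrite !lt_min r0 e10 e20 e30.
  have [[er ee1] [ee2 [ee3 ee4]]] : (e <= r /\ e <= e1) /\ e <= e2 /\ e <= e3 /\ e <= e4.
    by rewrite /e !ge_min !lexx !orbT.
  have Dt := hd0 (Y t) t (conj tI KYt).
  have YtM := hM t (Y t) tI KYt.
  have after s : t < s -> s < t + e -> s <= t1 -> [/\ V (s, Y s), u s < 2 * eta,
      `|Y s| <= M + 1 & d0 <= \det (A (Y s) s *m (A (Y s) s)^T) ^+ 2].
    move=> ts se st1; have st : `|s - t| < e.
      by rewrite gtr0_norm ?subr_gt0 // ltrBlDl.
    have sI' : `[t0, t1]%classic s.
      by rewrite /= in_itv /= st1 (le_trans t0t) // ltW.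
    have k1 := h1 s sI' (lt_le_trans st ee1); have k2 := h2 s sI' (lt_le_trans st ee2).
    have k3 := h3 s sI' (lt_le_trans st ee3); have k4 := h4 s sI' (lt_le_trans st ee4).
    split.
    + by apply: hr => //; exact: lt_le_trans st er.
    + by move: k1; rewrite ltr_norml opprB ltrBlDr subrK => /andP[].
    + rewrite -(subrK (Y t) (Y s)) addrC; apply: le_trans (ler_normD _ _) _.
      by rewrite lerD // ltW.
    + move: k4; rewrite ltr_norml ltrBrDr => /andP[/ltW k4 _].
      by apply: le_trans k4; rewrite addrC lerBrDr -mulr2n -mulr_natl.
  exists e; first exact: e0.
  move=> s ts se st1; have [VYs us YsM Ysd] := after s ts se st1.
  split; last by move: us; rewrite /u ltrBlDl => /ltW.
  apply: slicing_basin_K => //.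
  have sb : s < b by apply: le_lt_trans st1 t1_lt_b.
  have HX0 : H (Y t0) t0 = 0.
    by rewrite Y0; have [/(_ KX0)[]] := basin_KE V_basin X0 (I_sub t0I).
  (* Just after [t] it is only known that the truncated field is the true one; preservation of
     [H = 0] from [t0] on then returns the trajectory to [K]. *)
  apply: (@constraint_preserved _ _ _ _ _ H A Ht gF HA alpha t0 s Y) => //; last first.
    by rewrite lexx andbT (le_trans t0t) // ltW.
  move=> q /andP[t0q qs]; have qt1 := le_trans qs st1.
  have qI : t0 <= q <= t1 by rewrite t0q.
  have [qt|tq] := leP q t.
    have qt' : t0 <= q <= t by rewrite t0q.
    have [KY _] := ih q qt'; have [YM Yd] := Kgood q qI KY.
    have [uq dq] := good q qI YM Yd; split => //.
    exact: has_deriv_within_subset (sub s st1) dq.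
  have qe : q < t + e := le_lt_trans qs se.
  have [_ _ YM Yd] := after q tq qe qt1.
  have [uq dq] := good q qI YM Yd; split => //.
  exact: has_deriv_within_subset (sub s st1) dq.
move=> t t0t tt1 ih; have tI : t0 <= t <= t1 by lra.
have before e : 0 < e -> exists s, [/\ t0 <= s, s < t & `|s - t| < e].
  move=> e0; exists (Num.max t0 (t - e / 2)).
  have h1 : t - e / 2 <= Num.max t0 (t - e / 2) by rewrite le_max lexx orbT.
  have h2 : Num.max t0 (t - e / 2) < t by rewrite gt_max t0t /= gtrBl divr_gt0.
  split => //; first by rewrite le_max lexx.
  by rewrite ltr0_norm ?subr_lt0 //; lra.
split.
  suff [] : tube H V t0 t1 (Y t, t) by [].
  have clT : closed (tube H V t0 t1).
    by apply: compact_closed => //; exact: norm_hausdorff.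
  apply: clT => B [[B1 B2] [/= /nbhs_ballP[e1 /= e10 h1] /nbhs_ballP[e2 /= e20 h2]] sB].
  have [e e0 he] := cY t tI e1 e10.
  have ee : 0 < Num.min e e2 by rewrite lt_min e0.
  have [s [t0s st]] := before _ ee; rewrite lt_min => /andP[s1 s2].
  have sI' : `[t0, t1]%classic s by rewrite /= in_itv /=; lra.
  exists (Y s, s); split; first by split; [rewrite /=; lra|have [] := ih s t0s st].
  apply: (sB (Y s, s)); split; [apply: h1|apply: h2]; rewrite -ball_normE /= distrC //.
  exact: he.
rewrite leNgt; apply/negP => ut.
have g0 : 0 < u t - 2 * eta by rewrite /u; lra.
have [e e0 he] := cu t tI _ g0; have [s [t0s st se]] := before e e0.
have sI' : `[t0, t1]%classic s by rewrite /= in_itv /=; lra.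
have := he s sI' se; rewrite ltr_norml => /andP[k _].
by have [_] := ih s t0s st; move: k; rewrite /u; lra.
Qed.

End Trapping.

(** * Uniqueness of trajectories *)

Lemma cont_within_bounded (R : realType) (W : normedModType R) (c d : R) (u : R -> W) :
  (forall t, c <= t <= d -> cont_within `[c, d] u t) ->
  exists2 B : R, 0 <= B & forall t, c <= t <= d -> `|u t| <= B.
Proof.
move=> cu; have [|e e0 he] := @compact_uniform R R^o `[c, d]
    (fun t e => `|u t| <= e^-1) (@segment_compact R c d).
  move=> t /=; rewrite in_itv /= => tI; have [r r0 hr] := cu t tI 1 ltr01.
  have q0 : 0 < 1 + `|u t| by rewrite ltr_wpDr.
  exists (Num.min r (1 + `|u t|)^-1); first by rewrite lt_min r0 invr_gt0.
  move=> s e sI; rewrite /ball /= distrC lt_min => /andP[st _] e0.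
  rewrite lt_min => /andP[_ eu]; apply: (@le_trans _ _ (1 + `|u t|)).
    by have := hr s sI st; have := ler_normD (u s - u t) (u t); rewrite subrK; lra.
  by rewrite -[leLHS]invrK lef_pV2 ?posrE ?invr_gt0 // ltW.
exists e^-1; first by rewrite invr_ge0 ltW.
by move=> t tI; apply: he; rewrite /= in_itv.
Qed.

(** Real induction in place of the exponential: on an interval of length below [1 / (2 * (C + 1))]
    that starts at a zero of [w], the supremum of [w] is at most half of itself. *)
Lemma gronwall_eq0 (R : realType) (w dw : R -> R) (C t0 t1 : R) :
  0 <= C -> w t0 = 0 ->
  (forall t, t0 <= t <= t1 -> [/\ 0 <= w t, dw t <= C * w t &
     has_deriv_within `[t0, t1] (w : R -> R^o) t (dw t)]) ->
  forall t, t0 <= t <= t1 -> w t = 0.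
Proof.
move=> C0 w0 hw.
have cw t : t0 <= t <= t1 -> cont_within `[t0, t1] (w : R -> R^o) t.
  by move=> /hw[_ _]; exact: has_deriv_within_cont.
have [B B0 hB] := cont_within_bounded cw.
apply: real_induction => // [t t0t tt1 ih|t t0t tt1 ih].
- have wt : w t = 0 by apply: ih; rewrite lexx t0t.
  have C1 : 0 < 2 * (C + 1) by lra.
  exists (2 * (C + 1))^-1 => [|s ts sd st1]; first by rewrite invr_gt0.
  pose E := [set w r | r in `[t, s]].
  have supE : has_sup E.
    split; first by exists (w t), t => //=; rewrite in_itv /= lexx ltW.
    exists B => _ [r /= + <-]; rewrite in_itv /= => rts.
    have rI : t0 <= r <= t1 by lra.
    by apply: le_trans (ler_norm _) (hB r rI).
  have wE r : t <= r <= s -> w r <= sup E.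
    by move=> rts; apply: ub_le_sup; [exact: supE.2|exists r => //=; rewrite in_itv].
  have sI : t0 <= s <= t1 by lra.
  have E0 : 0 <= sup E by rewrite -wt wE // lexx ltW.
  have : sup E <= sup E / 2.
    apply: ge_sup; first exact: supE.1.
    move=> _ [r /= + <-]; rewrite in_itv /= => /andP[tr rs].
    have k : w r - w t <= C * sup E * (r - t).
      apply: (@deriv_le_increment R w dw t r _ tr) => q tqr.
        have qI : t0 <= q <= t1 by lra.
        have [_ _] := hw q qI; apply: has_deriv_within_subset => x /=.
        by rewrite !in_itv /=; lra.
      have qI : t0 <= q <= t1 by lra.
      have [_ h _] := hw q qI; apply: le_trans h _; rewrite ler_wpM2l // wE //.
      lra.
    have k2 : C * (r - t) <= 2^-1.
      have rd : r - t <= (2 * (C + 1))^-1 by lra.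
      have rt0 : 0 <= r - t by lra.
      apply: (@le_trans _ _ ((C + 1) * (2 * (C + 1))^-1)).
        by apply: ler_pM => //; lra.
      by rewrite invfM mulrCA mulfV ?mulr1 // gt_eqF // ltr_wpDl.
    have : C * sup E * (r - t) <= sup E * 2^-1.
      by rewrite mulrAC mulrC ler_wpM2l.
    by rewrite wt subr0 in k; lra.
  move=> h; have [ws _ _] := hw s sI.
  have ss : t <= s <= s by rewrite lexx ltW.
  by have := wE s ss; lra.
have tI : t0 <= t <= t1 by lra.
have [wt0 _ _] := hw t tI; apply/eqP; rewrite eq_le wt0 andbT leNgt; apply/negP => wt.
have [e e0 he] := cw t tI _ wt.
pose s := Num.max t0 (t - e / 2).
have h1 : t - e / 2 <= s by rewrite le_max lexx orbT.
have h2 : s < t by rewrite gt_max t0t /= gtrBl divr_gt0.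
have h3 : t0 <= s by rewrite le_max lexx.
have sI : `[t0, t1]%classic s by rewrite /= in_itv /=; lra.
have : `|s - t| < e by rewrite ltr0_norm ?subr_lt0 //; lra.
by move=> /(he s sI); rewrite (ih s h3 h2) sub0r normrN gtr0_norm // ltxx.
Qed.

Section Uniqueness.
Context {R : realType} {N p : nat} {a b : R}.
Variables (F : 'rV[R]_N -> R -> R) (gF : 'rV[R]_N -> R -> 'rV[R]_N).
Variables (H : 'rV[R]_N -> R -> 'rV[R]_p) (A : 'rV[R]_N -> R -> 'M[R]_(p, N)).
Variables (Ht : 'rV[R]_N -> R -> 'rV[R]_p).
Hypothesis F_reg : C11_in_x a b F gF.
Hypothesis HA : constraint_data a b H A Ht.
Variables (t0 t1 alpha : R).
Hypotheses (a_lt_t0 : a < t0) (t1_lt_b : t1 < b) (alpha_gt0 : 0 < alpha).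

Let I_sub t : t0 <= t <= t1 -> a < t < b.
Proof. by move: a_lt_t0 t1_lt_b => at0 t1b tI; lra. Qed.

(** The multiplier in the decomposition of the field as [- alpha^-1 *: gF] plus a combination of the
    rows of the Jacobian. Being continuous, it is bounded along a trajectory. *)
Definition normal_coef (X : 'rV[R]_N) (t : R) : 'rV[R]_p :=
  let J := A X t in
  alpha^-1 *: (gF X t *m pinv_with (@invmx R p) J) - Ht X t *m (invmx (J *m J^T))^T.

Let flow := flow_field (@invmx R p) gF A Ht alpha.

(* The first term is Lipschitz in [X]; the rest lies in the row space of the
   Jacobian, with a merely continuous coefficient. *)
Lemma dot_flow_normal (v X : 'rV[R]_N) t : A X t *m (A X t)^T \in unitmx ->
  dot v (flow X t) =
  - alpha^-1 * dot v (gF X t) + dot (v *m (A X t)^T) (normal_coef X t).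
Proof.
move=> u; rewrite /flow dot_flow_field // /proj_at mulmxBr mulmx1 dotBr.
rewrite dot_mulmxl trmxK /normal_coef mulmxBl -scalemxAl dotBr dotZr.
by rewrite /pinv_with !trmx_mul !trmxK !mulmxA; ring.
Qed.

(* Two points of the same manifold differ by a tangent vector up to second
   order. *)
Lemma normal_defect M : exists2 C : R, 0 <= C &
  forall X Y t, t0 <= t <= t1 -> `|X| <= M -> `|Y| <= M -> H X t = 0 -> H Y t = 0 ->
    `|(Y - X) *m (A X t)^T| <= C * `|Y - X| ^+ 2.
Proof.
have [hA _ _ _] := HA.
have /choice[C hC] : forall i : 'I_p, exists C : R, 0 <= C /\ forall X Y t,
    t0 <= t <= t1 -> `|X| <= M -> `|Y| <= M ->
    `|H Y t 0 i - H X t 0 i - dot (row i (A X t)) (Y - X)| <= C * `|Y - X| ^+ 2.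
  by move=> i; have [C C0 hC] := second_order (hA i) M a_lt_t0 t1_lt_b; exists C.
exists (\sum_i C i); first by apply: sumr_ge0 => i _; exact: (hC i).1.
move=> X Y t tI XM YM HX HY.
have S0 : 0 <= \sum_i C i by apply: sumr_ge0 => i _; exact: (hC i).1.
apply: mx_norm_le => [|j i]; first by rewrite mulr_ge0 // sqr_ge0.
have -> : ((Y - X) *m (A X t)^T) j i = dot (row i (A X t)) (Y - X).
  rewrite ord1 dotC /dot mxE [RHS]mxE; apply: eq_bigr => k _.
  by rewrite ![_^T _ _]mxE [row _ _ _ _]mxE.
have := (hC i).2 X Y t tI XM YM; rewrite HX HY !mxE subrr sub0r normrN => /le_trans.
apply; rewrite ler_wpM2r ?sqr_ge0 // (bigD1 i) //= lerDl sumr_ge0 // => k _.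
exact: (hC k).1.
Qed.

Lemma normal_coef_jointly_continuous X t : a < t < b ->
  A X t *m (A X t)^T \in unitmx -> jointly_continuous_at normal_coef X t.
Proof.
move=> tab u; have [_ _ cHt _] := HA; have [_ cg _] := F_reg.
have cA := jacobian_jointly_continuous (X:=X) HA tab.
have cI : invmx (A q.1 q.2 *m (A q.1 q.2)^T) @[q --> (X, t)] -->
    invmx (A X t *m (A X t)^T).
  by apply: invmx_cvg => //; apply: cvg_mulmx => //; apply: cvg_trmx.
apply: cvgB.
  apply: cvgZ; first by apply: cvg_cst.
  apply: cvg_mulmx; first exact: cg.
  by apply: pinv_with_cvg.
apply: cvg_mulmx; first exact: cHt.
by apply: cvg_trmx.
Qed.

Lemma flow_unique (Y Z : R -> 'rV[R]_N) : H (Y t0) t0 = 0 -> Y t0 = Z t0 ->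
  (forall t, t0 <= t <= t1 -> A (Y t) t *m (A (Y t) t)^T \in unitmx /\
     has_deriv_within `[t0, t1] Y t (flow (Y t) t)) ->
  (forall t, t0 <= t <= t1 -> A (Z t) t *m (A (Z t) t)^T \in unitmx /\
     has_deriv_within `[t0, t1] Z t (flow (Z t) t)) ->
  forall t, t0 <= t <= t1 -> Z t = Y t.
Proof.
move=> HY0 YZ0 hY hZ; have HZ0 : H (Z t0) t0 = 0 by rewrite -YZ0.
have HY := constraint_preserved HA a_lt_t0 t1_lt_b HY0 hY.
have HZ := constraint_preserved HA a_lt_t0 t1_lt_b HZ0 hZ.
have cY t (tI : t0 <= t <= t1) := has_deriv_within_cont (hY t tI).2.
have cZ t (tI : t0 <= t <= t1) := has_deriv_within_cont (hZ t tI).2.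
have [MY MY0 hMY] := cont_within_bounded cY.
have [MZ MZ0 hMZ] := cont_within_bounded cZ.
pose M := Num.max MY MZ.
have YM t : t0 <= t <= t1 -> `|Y t| <= M by move=> tI; rewrite le_max hMY.
have ZM t : t0 <= t <= t1 -> `|Z t| <= M by move=> tI; rewrite le_max hMZ ?orbT.
have [C C0 hC] := normal_defect M.
have [_ _ /(_ M t0 t1 a_lt_t0 t1_lt_b)[L L0 hL]] := F_reg.
have [BY BY0 hBY] : exists2 B : R, 0 <= B & forall t, t0 <= t <= t1 ->
    `|normal_coef (Y t) t| <= B.
  apply: cont_within_bounded => t tI; apply: cont_within_jointly; last exact: cY.
  by apply: normal_coef_jointly_continuous; [exact: I_sub|exact: (hY t tI).1].
have [BZ BZ0 hBZ] : exists2 B : R, 0 <= B & forall t, t0 <= t <= t1 ->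
    `|normal_coef (Z t) t| <= B.
  apply: cont_within_bounded => t tI; apply: cont_within_jointly; last exact: cZ.
  by apply: normal_coef_jointly_continuous; [exact: I_sub|exact: (hZ t tI).1].
pose D t := Y t - Z t.
(* The Lipschitz constant of the gradient, plus the second-order defect weighted by the multipliers
   of both trajectories: the difference is tested against the Jacobian at [Y t] and against that at
   [Z t]. The factors [N%:R] and [p%:R] come from [ler_dot_norm]. *)
pose G := alpha^-1 * (N%:R * L) + p%:R * C * (BY + BZ).
have G0 : 0 <= G.
  by rewrite addr_ge0 // ?mulr_ge0 ?addr_ge0 ?invr_ge0 // ltW.
have rate t : t0 <= t <= t1 -> dot (D t) (flow (Y t) t - flow (Z t) t) <= G * dot (D t) (D t).
  move=> tI; have [uY _] := hY t tI; have [uZ _] := hZ t tI.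
  rewrite dotBr !dot_flow_normal //.
  have e1 : `|dot (D t) (gF (Y t) t - gF (Z t) t)| <= N%:R * L * `|D t| ^+ 2.
    apply: le_trans (ler_dot_norm _ _) _.
    have := hL (Y t) (Z t) t tI (YM t tI) (ZM t tI); rewrite -/(D t) => h.
    rewrite expr2 mulrA -(mulrA N%:R L) -(mulrA N%:R `|D t|) -(mulrA N%:R).
    by rewrite ler_wpM2l // mulrC ler_wpM2r.
  have e2 : `|dot (D t *m (A (Y t) t)^T) (normal_coef (Y t) t)| <= p%:R * C * BY * `|D t| ^+ 2.
    apply: le_trans (ler_dot_norm _ _) _.
    have := hC (Y t) (Z t) t tI (YM t tI) (ZM t tI) (HY t tI) (HZ t tI).
    rewrite -(opprB (Y t)) mulNmx !normrN -/(D t) => h.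
    apply: (@le_trans _ _ (p%:R * (C * `|D t| ^+ 2) * BY)); last first.
      by rewrite le_eqVlt; apply/orP; left; apply/eqP; ring.
    by apply: ler_pM; rewrite ?mulr_ge0 //; [rewrite ler_wpM2l|exact: hBY].
  have e3 : `|dot (D t *m (A (Z t) t)^T) (normal_coef (Z t) t)| <= p%:R * C * BZ * `|D t| ^+ 2.
    apply: le_trans (ler_dot_norm _ _) _.
    have := hC (Z t) (Y t) t tI (ZM t tI) (YM t tI) (HZ t tI) (HY t tI).
    rewrite -/(D t) => h.
    apply: (@le_trans _ _ (p%:R * (C * `|D t| ^+ 2) * BZ)); last first.
      by rewrite le_eqVlt; apply/orP; left; apply/eqP; ring.
    by apply: ler_pM; rewrite ?mulr_ge0 //; [rewrite ler_wpM2l|exact: hBZ].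
  apply: (@le_trans _ _ (G * `|D t| ^+ 2)); last by rewrite ler_wpM2l // ler_norm_dot.
  have ia : 0 <= alpha^-1 by rewrite invr_ge0 ltW.
  move: e1 e2 e3; rewrite dotBr !ler_norml => /andP[e1 _] /andP[_ e2] /andP[e3 _].
  have := ler_wpM2l ia e1; rewrite /G; lra.
have D0 : dot (D t0) (D t0) = 0 by rewrite /D YZ0 subrr /dot mul0mx mxE.
have sq X : has_grad (fun X : 'rV[R]_N => dot X X) X (2 *: X).
  move=> e e0; have N1 : 0 < 1 + (N%:R : R) by rewrite ltr_wpDr.
  exists (e / (1 + N%:R)) => [|U]; first by rewrite divr_gt0.
  rewrite ltr_pdivlMr // => UX.
  have -> : dot U U - dot X X - dot (2 *: X) (U - X) = dot (U - X) (U - X).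
    by rewrite !(dotBl, dotBr, dotZl) (dotC X U); ring.
  apply: le_trans (ler_dot_norm _ _) _; rewrite ler_wpM2r //.
  by apply: le_trans (ltW UX); rewrite mulrC ler_wpM2l // lerDr.
have w0 := @gronwall_eq0 R (fun t => dot (D t) (D t))
  (fun t => dot (2 *: D t) (flow (Y t) t - flow (Z t) t)) (2 * G) t0 t1 _ D0.
move=> t tI; apply/esym/eqP; rewrite -subr_eq0 -dot_eq0; apply/eqP.
apply: w0 => //; first by rewrite mulr_ge0.
move=> s sI; split; first exact: dot_ge0.
  by rewrite dotZl -mulrA ler_wpM2l // rate.
apply: (has_deriv_within_comp (f := fun X => dot X X) (Y := D)) => //.
apply: has_deriv_withinD; first exact: (hY s sI).2.
have := has_deriv_withinZ (-1) (hZ s sI).2; rewrite scaleN1r.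
apply: eq_has_deriv_within; last by rewrite /= in_itv.
by move=> r _; rewrite scaleN1r.
Qed.

End Uniqueness.

(** * Tracking for equality constraints *)

(** A point of [K] outside the slice lies in its closure but not in its interior, so its value
    bounds the minimum over the boundary from above. *)
Lemma Khat_initial (R : realType) (N p : nat) (a b : R)
    (F : 'rV[R]_N -> R -> R) (H : 'rV[R]_N -> R -> 'rV[R]_p)
    (V : set (R * 'rV[R]_N)) (t0 : R) :
  (forall X t, a < t < b -> jointly_continuous_at F X t) ->
  basin H `]a, b[ V -> a < t0 < b ->
  Khat F H V t0 `<=` initial_set F H V t0.
Proof.
move=> F_cont V_basin tab X [KX FX]; split=> // Z KZ nVZ.
have mZ : (min_over (F ^~ t0) (boundary (slicing V t0) `&` manifold H t0) <= (F Z t0)%:E)%E.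
  apply: ereal_inf_lbound; exists Z => //.
  have [/(_ KZ)[clZ HZ] _] := basin_KE V_basin Z tab.
  by split => //; split => // /interior_subset.
rewrite mulrC -lee_fin EFinM EFinD; apply: le_trans FX _.
rewrite /Fhat (FstarE F_cont V_basin tab) lee_pmul2l // ?lte_fin ?invr_gt0 //.
exact: leeD2l.
Qed.

Lemma tracking (R : realType) (N p : nat) (a b : R)
    (F : 'rV[R]_N -> R -> R) (gF : 'rV[R]_N -> R -> 'rV[R]_N)
    (H : 'rV[R]_N -> R -> 'rV[R]_p) (A : 'rV[R]_N -> R -> 'M[R]_(p, N))
    (Ht : 'rV[R]_N -> R -> 'rV[R]_p) (V : set (R * 'rV[R]_N))
    (t0 t1 eps nu : R) :
  (forall X t, a < t < b -> jointly_continuous_at F X t) ->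
  C11_in_x a b F gF -> constraint_data a b H A Ht ->
  (forall X t, a < t < b -> [/\ grad (F ^~ t) X = gF X t,
     Jac (H ^~ t) X = A X t & derive1 (H X) t = Ht X t]) ->
  contracting_basin F H `]a, b[ V ->
  a < t0 -> t0 <= t1 -> t1 < b -> 0 < eps -> 0 < nu ->
  exists2 alpha_bar : R, 0 < alpha_bar & forall alpha : R, 0 < alpha <= alpha_bar ->
    allows_tracking F H V t0 t1 eps nu alpha.
Proof.
move=> F_cont F_reg HA derivs [V_basin V_contr] at0 t01 t1b eps0 nu0.
have I_sub t : t0 <= t <= t1 -> a < t < b by move=> tI; lra.
have t0I : t0 <= t0 <= t1 by rewrite lexx.
have Kint t X : a < t < b -> Kstar F H V t X -> V (t, X).
  by move=> tab; rewrite -V_contr ?in_itv //= => -[].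
have critK t X : a < t < b -> V (t, X) -> H X t = 0 ->
    (forall v : 'rV[R]_N, A X t *m v^T = 0 -> gF X t *m v^T = 0) -> Kstar F H V t X.
  move=> tab VX HX crit; rewrite -V_contr ?in_itv //=; split => //; split => // v.
  by have [-> -> _] := derivs X t tab; exact: crit.
have [eta [l [eta0 cl l_init l_int [Fl l_eps]]]] :=
  level_exists F_cont HA V_basin Kint at0 t01 t1b eps0 nu0.
have [d d0 hd] := tube_bounds F_cont F_reg HA V_basin critK at0 t1b eta0 cl l_int Fl.
have k0 : 0 < d^-1 + 8 * eta / d by rewrite addr_gt0 ?divr_gt0 ?invr_gt0 // mulr_gt0.
(* Exactly the smallness of [alpha] required by the barrier. *)
exists (d / (d^-1 + 8 * eta / d)) => [|alpha /andP[alpha0]]; first by rewrite divr_gt0.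
rewrite ler_pdivlMr // => alpha_small.
have solE X Y : ode_solution F H alpha t0 t1 X Y <-> Y t0 = X /\
    forall t, t0 <= t <= t1 -> A (Y t) t *m (A (Y t) t)^T \in unitmx /\
     has_deriv_within `[t0, t1] Y t (flow_field (@invmx R p) gF A Ht alpha (Y t) t).
  split=> -[Y0 hY]; split=> // t tI; have [eg eJ eH] := derivs (Y t) t (I_sub t tI).
    have [u /is_derive_withinP dY] := hY t tI.
    by move: u dY; rewrite /ode_rhs eg eJ eH.
  have [u dY] := hY t tI; rewrite is_derive_withinP.
  by rewrite /ode_rhs eg eJ eH.
(* A single flow map needs a value for every [X]; outside the initial set the constant function is a
   dummy. *)
have /choice[sol hsol] : forall X, exists Y : R -> 'rV[R]_N, initial_set F H V t0 X ->
    Y t0 = X /\ forall t, t0 <= t <= t1 ->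
    [/\ basin_K H V t (Y t), F (Y t) t <= l t + 2 * eta,
        A (Y t) t *m (A (Y t) t)^T \in unitmx &
        has_deriv_within `[t0, t1] Y t (flow_field (@invmx R p) gF A Ht alpha (Y t) t)].
  move=> X; have [iX|niX] := pselect (initial_set F H V t0 X); last by exists (fun=> X).
  have [Y hY] := trapped_solution F_cont F_reg HA V_basin at0 t01 t1b eta0 d0 cl
    l_int hd alpha0 alpha_small (proj1 iX) (l_init X iX).
  by exists Y.
have init X : Khat F H V t0 X -> initial_set F H V t0 X.
  exact: (Khat_initial F_cont V_basin (I_sub t0 t0I)).
exists (fun t X => sol X t); split.
- move=> X /init iX; have [Y0 hY] := hsol X iX.
  have HX : H (sol X t0) t0 = 0.
    have [KY _ _ _] := hY t0 t0I.
    by have [/(_ KY)[]] := basin_KE V_basin (sol X t0) (I_sub t0 t0I).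
  split; first by apply/solE; split => // t /hY[].
  move=> Z /solE[Z0 hZ].
  apply: (flow_unique F_reg HA at0 t1b alpha0 HX); last exact: hZ.
    by rewrite Y0.
  by move=> t /hY[].
- by move=> t tI _ [X /init iX <-]; have [_ /(_ t tI)[]] := hsol X iX.
move=> t X /andP[tnu tt1] /init iX; have tI : t0 <= t <= t1 by lra.
have [_ /(_ t tI)[_ Fle _ _]] := hsol X iX.
rewrite (FstarE F_cont V_basin (I_sub t tI)) -EFinB lee_fin.
by have := l_eps t tnu tt1; lra.
Qed.

(** * Gradients and Jacobians from differentiability *)

Lemma jointly_bounded (R : realType) (N : nat) (W : normedModType R) (a b c d M : R)
    (phi : 'rV[R]_N -> R -> W) :
  (forall X t, a < t < b -> jointly_continuous_at phi X t) -> a < c -> d < b ->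
  exists2 B : R, 0 <= B & forall X t, c <= t <= d -> `|X| <= M -> `|phi X t| <= B.
Proof.
move=> h ac db.
have cbox : compact ([set X : 'rV[R]_N | `|X| <= M] `*` `[c, d]%classic).
  by apply: compact_setX; [exact: rV_norm_compact|exact: segment_compact].
have [|e e0 he] := compact_uniform_jointly (P := fun X t e => `|phi X t| <= e^-1) cbox.
  move=> X t [/= _]; rewrite in_itv /= => tcd; have tab : a < t < b by lra.
  have [r r0 hr] := jointly_continuous_ball (h X t tab) ltr01.
  have q0 : 0 < 1 + `|phi X t| by rewrite ltr_wpDr.
  exists (Num.min r (1 + `|phi X t|)^-1); first by rewrite lt_min r0 invr_gt0.
  move=> Y s e _; rewrite !lt_min => /andP[YX _] /andP[st _] e0 /andP[_ eu].
  apply: (@le_trans _ _ (1 + `|phi X t|)).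
    have := hr Y s YX st; have := ler_normD (phi Y s - phi X t) (phi X t).
    by rewrite subrK; lra.
  by rewrite -[leLHS]invrK lef_pV2 ?posrE ?invr_gt0 // ltW.
exists e^-1; first by rewrite invr_ge0 ltW.
by move=> X t tcd XM; apply: he; split => //=; rewrite in_itv.
Qed.

Lemma eq_jointly_continuous (R : realType) (N : nat) (W : normedModType R) (a b : R)
    (phi psi : 'rV[R]_N -> R -> W) (X : 'rV[R]_N) (t : R) :
  (forall Y s, a < s < b -> phi Y s = psi Y s) -> a < t < b ->
  jointly_continuous_at phi X t -> jointly_continuous_at psi X t.
Proof.
move=> eq tab h; apply: ball_jointly_continuous => e e0.
have [r r0 hr] := jointly_continuous_ball h e0.
have [k k0 hk] := open_itv_ball tab; exists (Num.min r k); first by rewrite lt_min r0.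
move=> Y s; rewrite !lt_min => /andP[Y1 _] /andP[s1 s2].
by rewrite -!eq // ?hr //; exact: hk.
Qed.

(** A positive time is interior to the half-line, so relative continuity there is ordinary
    continuity. *)
Lemma within_jointly_continuous (R : realType) (N : nat) (W : normedModType R)
    (phi : 'rV[R]_N -> R -> W) (X : 'rV[R]_N) (t : R) :
  {within [set: 'rV[R]_N] `*` @nonneg_reals R, continuous (fun q => phi q.1 q.2)} ->
  0 < t -> jointly_continuous_at phi X t.
Proof.
move=> /subspace_continuousP h t0.
have At : ([set: 'rV[R]_N] `*` @nonneg_reals R) (X, t) by split => //; exact: ltW.
have := h (X, t) At; rewrite within_interior //.
exists (setT, ball t t); first by split; [exact: filterT|exact: nbhsx_ballx].
move=> [Y s] [_ /=]; rewrite -ball_normE /= => st; split => //=.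
by move: st; rewrite /nonneg_reals /= ltr_norml; lra.
Qed.

Lemma dot_grad (R : realType) (N : nat) (f : 'rV[R]_N -> R) (X v : 'rV[R]_N) :
  differentiable (f : 'rV[R]_N -> R^o) X -> dot (grad f X) v = 'D_v (f : _ -> R^o) X.
Proof.
move=> df; rewrite deriveE // {2}(row_sum_delta v) linear_sum dotE.
apply: eq_bigr => i _; rewrite mxE linearZ /= mulrC.
by rewrite deriveE.
Qed.

Lemma differentiable_has_grad (R : realType) (N : nat) (f : 'rV[R]_N -> R)
    (X : 'rV[R]_N) :
  differentiable (f : 'rV[R]_N -> R^o) X -> has_grad f X (grad f X).
Proof.
move=> df e e0; have /eqaddoP/(_ e e0)/nbhs_ballP[r /= r0 hr] := diff_locally df.
exists r => // Y YX; rewrite dot_grad // deriveE //.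
have YX' : ball (0 : 'rV[R]_N) r (Y - X) by rewrite -ball_normE /= sub0r normrN.
have := hr (Y - X) YX'; rewrite !fctE /= subrK.
by rewrite opprD addrA.
Qed.

Lemma has_grad_grad (R : realType) (N : nat) (f : 'rV[R]_N -> R)
    (X g : 'rV[R]_N) : has_grad f X g -> grad f X = g.
Proof.
move=> h; apply/rowP => i; rewrite mxE; apply: cvg_lim => //.
apply/cvgrPdist_le => e e0; have [r r0 hr] := h e e0.
apply/nbhs_ballP; exists r => //= k; rewrite /ball /= sub0r normrN => kr k0.
set v : 'rV[R]_N := delta_mx 0 i.
have v1 : `|v| <= 1.
  apply: mx_norm_le => // a b; rewrite mxE.
  by case: (_ && _); rewrite ?normr1 ?normr0.
have gv : dot g v = g 0 i.
  rewrite dotE (bigD1 i) //= big1 ?addr0 => [|j ji]; rewrite mxE !eqxx ?mulr1 //.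
  by rewrite (negbTE ji) mulr0.
have kvr : `|k *: v + X - X| < r.
  by rewrite addrK normrZ (le_lt_trans _ kr) // ler_piMr.
have := hr (k *: v + X) kvr; rewrite addrK dotZr gv normrZ => le.
rewrite -(ler_pM2l (_ : 0 < `|k|)) ?normr_gt0 // -normrM mulrBr.
have -> : k * (k^-1 *: (f (k *: v + X) - f X) : R) = f (k *: v + X) - f X.
  by rewrite /GRing.scale /= mulrA mulfV // mul1r.
rewrite distrC; apply: le_trans le _.
by rewrite (mulrC `|k| e) ler_pM2l // ler_piMr.
Qed.

(** The linear map given by [J^T] satisfies the defining expansion of the differential, with a
    common radius for the finitely many components; uniqueness of the differential identifies it. *)
Lemma Jac_has_grad (R : realType) (N p : nat) (f : 'rV[R]_N -> 'rV[R]_p)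
    (X : 'rV[R]_N) (J : 'M[R]_(p, N)) :
  (forall i, has_grad (fun Y => f Y 0 i) X (row i J)) -> Jac f X = J.
Proof.
move=> h; pose df : {linear 'rV[R]_N -> 'rV[R]_p} := mulmxr J^T.
have cdf : continuous df.
  move=> Y.
  by apply: (@cvg_mulmx _ _ (nbhs Y) _ _ _ _ id (fun=> J^T)); [exact: cvg_id|exact: cvg_cst].
rewrite /Jac; suff -> : 'J f X = J^T by rewrite trmxK.
  apply/row_matrixP => i; rewrite !rowE /jacobian mul_rV_lin1.
  rewrite (@diff_unique _ _ _ f df X cdf) //.
  apply/eqaddoP => e e0.
  suff : \forall Y \near (0 : 'rV[R]_N), forall i : 'I_p,
      `|f (Y + X) 0 i - f X 0 i - dot (row i J) Y| <= e * `|Y|.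
    apply: filterS => Y hY; apply: mx_norm_le => [|j k]; first by rewrite mulr_ge0 // ltW.
    have := hY k; rewrite ord1 !mxE dotC /dot mxE.
    rewrite (eq_bigr (fun l => Y 0 l * J^T l k)) ?opprD ?addrA //.
    by move=> l _; rewrite !mxE.
  have /choice[rr hrr] : forall k, exists r : R, 0 < r /\ forall Y, `|Y| < r ->
      `|f (Y + X) 0 k - f X 0 k - dot (row k J) Y| <= e * `|Y|.
    move=> k; have [r r0 hr] := h k e e0; exists r; split => // Y Yr.
    by have := hr (Y + X); rewrite addrK; apply.
  have [r r0 hr] : exists2 r : R, 0 < r & forall k, r <= rr k.
    have : \forall r \near (0 : R)^'+, forall k, r < rr k.
      apply: filter_forall => k; apply: nbhs_right_lt; exact: (hrr k).1.
    move=> hn; have hp : \forall r \near (0 : R)^'+, 0 < r /\ forall k, r < rr k.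
      by apply: filterI => //; exact: nbhs_right_gt.
    by have [r [r0 hr]] := filter_ex hp; exists r => // k; exact: ltW.
  apply/nbhs_ballP; exists r => //= Y; rewrite -ball_normE /= sub0r normrN => Yr k.
  by apply: (hrr k).2; exact: lt_le_trans (hr k).
Qed.

Lemma has_deriv_within_derive1 (R : realType) (W : normedModType R) (a b t : R)
    (u : R -> W) (d : W) :
  a < t < b -> has_deriv_within `]a, b[ u t d -> derive1 u t = d.
Proof.
move=> tab h; apply: cvg_lim => //.
apply/cvgrPdist_le => e e0; have [r r0 hr] := h e e0.
have [r' r'0 hr'] := open_itv_ball tab.
apply/nbhs_ballP; exists (Num.min r r') => /=; first by rewrite lt_min r0.
move=> k; rewrite /ball /= sub0r normrN lt_min => /andP[k1 k2] k0.
have kt : `|k + t - t| = `|k| by rewrite addrK.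
have ktab : `]a, b[%classic (k + t) by rewrite /= in_itv /=; apply: hr'; rewrite kt.
have := hr (k + t) ktab; rewrite kt addrK => /(_ k1) le.
rewrite -(ler_pM2l (_ : 0 < `|k|)) ?normr_gt0 // -normrZ scalerBr scalerA mulfV //.
by rewrite scale1r distrC mulrC.
Qed.

(** The second derivatives are jointly continuous, hence bounded on a compact box, and the mean
    value inequality makes each component of the gradient Lipschitz there. The sum over components
    serves as one constant for the maximum norm. *)
Lemma C2_C11 (R : realType) (N : nat) (a b : R) (f : 'rV[R]_N -> R -> R) :
  (forall X t, a < t < b -> differentiable (f ^~ t : _ -> R^o) X) ->
  (forall v X t, a < t < b ->
     jointly_continuous_at (fun X t => 'D_v (f ^~ t : _ -> R^o) X) X t) ->
  (forall v X t, a < t < b ->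
     differentiable (fun Y => 'D_v (f ^~ t : _ -> R^o) Y) X) ->
  (forall v w X t, a < t < b -> jointly_continuous_at
     (fun X t => 'D_w (fun Y => 'D_v (f ^~ t : _ -> R^o) Y) X) X t) ->
  C11_in_x a b f (fun X t => grad (f ^~ t) X).
Proof.
move=> h1 h2 h3 h4; split=> [X t tab|X t tab|M c d ac db].
- exact/differentiable_has_grad/h1.
- apply: cvg_mx => i j; rewrite mxE; under eq_cvg do rewrite mxE.
  exact: h2.
pose G j X t := grad (fun Y => 'D_(delta_mx 0 j) (f ^~ t : _ -> R^o) Y) X.
have cG j X t : a < t < b -> jointly_continuous_at (G j) X t.
  move=> tab; apply: cvg_mx => i k.
  pose D X t := 'D_(delta_mx 0 k)
    (fun Y => 'D_(delta_mx 0 j) (f ^~ t : _ -> R^o) Y : R^o) X.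
  apply: (@eq_jointly_continuous R N R^o a b D (fun X t => G j X t i k)) => //.
    by move=> Y s _; rewrite [RHS]mxE.
  exact: (h4 (delta_mx 0 j) (delta_mx 0 k) X t tab).
have /choice[B hB] : forall j, exists B : R, 0 <= B /\
    forall X t, c <= t <= d -> `|X| <= M -> `|G j X t| <= B.
  by move=> j; have [B B0 hB] := jointly_bounded M (cG j) ac db; exists B.
exists (\sum_j N%:R * B j).
  by apply: sumr_ge0 => j _; rewrite mulr_ge0 //; exact: (hB j).1.
move=> X Y t tcd XM YM; have tab : a < t < b by lra.
have S0 : 0 <= \sum_j N%:R * B j.
  by apply: sumr_ge0 => j _; rewrite mulr_ge0 //; exact: (hB j).1.
apply: mx_norm_le => [|i j]; first by rewrite mulr_ge0.
rewrite !mxE; apply: (@le_trans _ _ (N%:R * B j * `|X - Y|)); last first.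
  rewrite ler_wpM2r // (bigD1 j) //= lerDl sumr_ge0 // => k _.
  by rewrite mulr_ge0 //; exact: (hB k).1.
have hG Z : has_grad (fun Y => 'D_(delta_mx 0 j) (f ^~ t : _ -> R^o) Y) Z (G j Z t).
  exact/differentiable_has_grad/h3.
have := increment_norm_le hG (X := Y) (Y := X) (v := 0) (c := B j).
rewrite [dot 0 _]/dot mul0mx mxE subr0; apply => s /andP[s0 s1]; rewrite subr0.
apply: (hB j).2 => //.
have -> : Y + s *: (X - Y) = (1 - s) *: Y + s *: X.
  by apply/rowP => k; rewrite !mxE; ring.
have k : 0 <= 1 - s by rewrite subr_ge0.
apply: le_trans (ler_normD _ _) _; rewrite !normrZ (ger0_norm s0) (ger0_norm k).
by have := ler_wpM2l k YM; have := ler_wpM2l s0 XM; lra.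
Qed.

Lemma C2_in_x_C11_coord (R : realType) (N m : nat) (a b : R)
    (h : 'rV[R]_N -> R -> 'rV[R]_m) (i : 'I_m) : 0 <= a -> C2_in_x h ->
  C11_in_x a b (fun X t => h X t 0 i) (fun X t => grad (fun Y => h Y t 0 i) X).
Proof.
move=> a0 [h1 h2 h3 h4].
have t_ge0 t : a < t < b -> 0 <= t by move=> tab; lra.
have t_gt0 t : a < t < b -> 0 < t by move=> tab; lra.
have coord (f : 'rV[R]_N -> 'rV[R]_m) X : differentiable f X ->
    differentiable (fun Y => f Y 0 i : R^o) X.
  move=> df; apply: (@differentiable_comp _ _ _ _ f (fun M : 'rV[R]_m => M 0 i : R^o)) => //.
  exact: differentiable_coord.
have D1 v t : a < t < b -> (fun Y => 'D_v (fun Z => h Z t 0 i : R^o) Y) =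
    (fun Y => ('D_v (h ^~ t) Y) 0 i).
  move=> tab; apply/funext => Y.
  by rewrite derive_mx ?mxE //; apply: diff_derivable; apply: h1; exact: t_ge0.
have D2 v w t X : a < t < b ->
    'D_w (fun Y => 'D_v (fun Z => h Z t 0 i : R^o) Y) X =
    ('D_w (fun Y => 'D_v (h ^~ t) Y) X) 0 i.
  move=> tab; rewrite D1 // derive_mx ?mxE //.
  by apply: diff_derivable; apply: h3; exact: t_ge0.
apply: C2_C11 => [X t tab|v X t tab|v X t tab|v w X t tab].
- by apply: coord; apply: h1; exact: t_ge0.
- apply: (@eq_jointly_continuous R N R^o a b (fun X t => ('D_v (h ^~ t) X) 0 i)
    (fun X t => 'D_v (fun Z => h Z t 0 i : R^o) X)) => //.
    by move=> Y s sab; rewrite (congr1 (fun u => u Y) (D1 v s sab)).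
  have c := within_jointly_continuous (X := X)
    (phi := fun X t => 'D_v (h ^~ t) X) (h2 v) (t_gt0 t tab).
  have : ('D_v (h ^~ q.2) q.1) 0 i @[q --> (X, t)] --> ('D_v (h ^~ t) X) 0 i.
    by apply: cvg_mx_coord; exact: c.
  by [].
- by rewrite D1 //; apply: coord; apply: h3; exact: t_ge0.
- apply: (@eq_jointly_continuous R N R^o a b
    (fun X t => ('D_w (fun Y => 'D_v (h ^~ t) Y) X) 0 i)
    (fun X t => 'D_w (fun Y => 'D_v (fun Z => h Z t 0 i : R^o) Y) X)) => //.
    by move=> Y s sab; rewrite D2.
  have c := within_jointly_continuous (X := X)
    (phi := fun X t => 'D_w (fun Y => 'D_v (h ^~ t) Y) X) (h4 v w) (t_gt0 t tab).
  have : ('D_w (fun Y => 'D_v (h ^~ q.2) Y) q.1) 0 i @[q --> (X, t)] -->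
      ('D_w (fun Y => 'D_v (h ^~ t) Y) X) 0 i.
    by apply: cvg_mx_coord; exact: c.
  by [].
Qed.

Lemma C2_in_x_C11 (R : realType) (N : nat) (a b : R)
    (f : 'rV[R]_N -> R -> R) : 0 <= a -> @C2_in_x R N R^o f ->
  C11_in_x a b f (fun X t => grad (f ^~ t) X).
Proof.
move=> a0 [h1 h2 h3 h4].
have t_ge0 t : a < t < b -> 0 <= t by move=> tab; lra.
have t_gt0 t : a < t < b -> 0 < t by move=> tab; lra.
apply: C2_C11 => [X t tab|v X t tab|v X t tab|v w X t tab].
- by apply: h1; exact: t_ge0.
- exact: (within_jointly_continuous (X := X) (W := R^o)
    (phi := fun X t => 'D_v (f ^~ t : _ -> R^o) X) (h2 v) (t_gt0 t tab)).
- by apply: h3; exact: t_ge0.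
- exact: (within_jointly_continuous (X := X) (W := R^o)
    (phi := fun X t => 'D_w (fun Y => 'D_v (f ^~ t : _ -> R^o) Y) X) (h4 v w) (t_gt0 t tab)).
Qed.

(** * The slack reformulation *)

Lemma free_lincomb (R : realType) (n : nat) (I : eqType) (r : seq I)
    (G : I -> 'rV[R]_n) (c : I -> R) :
  free [seq G x | x <- r] -> \sum_(x <- r) c x *: G x = 0 ->
  forall x, x \in r -> c x = 0.
Proof.
move=> fr sum0 x xr.
have sz : size [seq G x | x <- r] = size r by rewrite size_map.
have := @freeP _ _ _ (in_tuple [seq G x | x <- r]) => /(_ fr).
move=> /(_ (fun i => c (nth x r i))) h.
have xi : (index x r < size [seq G x | x <- r])%N by rewrite sz index_mem.
have := h _ (Ordinal xi); rewrite /= nth_index //; apply.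
rewrite -[RHS]sum0 (big_nth x) big_mkord -[in RHS]sz /=.
apply: eq_bigr => i _; rewrite (nth_map x) //.
by rewrite -sz; exact: ltn_ord.
Qed.

(** If [w] annihilates [J *m J^T] from the left, then the Euclidean square of [w *m J] is zero. *)
Lemma gram_unit (R : realType) (N p : nat) (J : 'M[R]_(p, N)) :
  (forall w : 'rV[R]_p, w *m J = 0 -> w = 0) -> J *m J^T \in unitmx.
Proof.
move=> inj; rewrite -row_free_unit; apply: inj_row_free => w wJ.
apply: inj; apply/eqP; rewrite -dot_eq0 dot_mulmxl -mulmxA wJ.
by rewrite dotC /dot mul0mx mxE.
Qed.

Section BlockNorms.
Context {R : realType} {m n : nat}.

Lemma normr_row_mx_le (u : 'rV[R]_m) (v : 'rV[R]_n) (c : R) :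
  `|u| <= c -> `|v| <= c -> `|row_mx u v| <= c.
Proof.
move=> uc vc; apply: mx_norm_le => [|i j]; first exact: (le_trans (normr_ge0 u) uc).
by rewrite mxE; case: (fintype.split j) => k; apply: le_trans (ler_coord_norm _ _ _) _.
Qed.

Lemma normr_lsubmx (X : 'rV[R]_(m + n)) : `|lsubmx X| <= `|X|.
Proof. by apply: mx_norm_le => // i j; rewrite mxE; exact: ler_coord_norm. Qed.

Lemma dot_row_mx0 (u : 'rV[R]_m) (X : 'rV[R]_(m + n)) :
  dot (row_mx u 0) X = dot u (lsubmx X).
Proof.
rewrite !dotE big_split_ord /= [X in _ + X]big1 ?addr0 => [|j _].
  by apply: eq_bigr => j _; rewrite row_mxEl mxE.
by rewrite row_mxEr mxE mul0r.
Qed.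

End BlockNorms.

(** * Lipschitz gradients under lifting, sums and squared coordinates *)

Section C11Operations.
Context {R : realType} {a b : R}.

Lemma C11_lsubmx (n q : nat) (phi : 'rV[R]_n -> R -> R) (g : 'rV[R]_n -> R -> 'rV[R]_n) :
  C11_in_x a b phi g ->
  C11_in_x a b (fun (X : 'rV[R]_(n + q)) t => phi (lsubmx X) t)
    (fun X t => row_mx (g (lsubmx X) t) 0).
Proof.
move=> [h1 h2 h3]; split=> [X t tab e e0|X t tab|M c d ac db].
- have [r r0 hr] := h1 (lsubmx X) t tab e e0; exists r => // Y YX.
  have k : `|lsubmx Y - lsubmx X| <= `|Y - X| by rewrite -linearB normr_lsubmx.
  rewrite dot_row_mx0 linearB /=; apply: le_trans (hr _ (le_lt_trans k YX)) _.
  by rewrite ler_wpM2l // ltW.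
- apply: (@ball_jointly_continuous _ _ _
    (fun (X : 'rV[R]_(n + q)) t => row_mx (g (lsubmx X) t) 0)) => e e0.
  have e20 : 0 < e / 2 by rewrite divr_gt0.
  have [r r0 hr] := jointly_continuous_ball (h2 (lsubmx X) t tab) e20.
  exists r => // Y s YX st.
  have k : `|lsubmx Y - lsubmx X| <= `|Y - X| by rewrite -linearB normr_lsubmx.
  rewrite opp_row_mx add_row_mx subrr; apply: (@le_lt_trans _ _ (e / 2)); last by lra.
  apply: normr_row_mx_le; last by rewrite normr0 ltW.
  by apply/ltW/hr => //; exact: le_lt_trans k YX.
- have [L L0 hL] := h3 M c d ac db; exists L => // X Y t tcd XM YM.
  rewrite opp_row_mx add_row_mx subrr.
  apply: normr_row_mx_le; last by rewrite normr0 mulr_ge0.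
  apply: le_trans (hL _ _ t tcd _ _) _; rewrite ?(le_trans (normr_lsubmx _)) //.
  by rewrite ler_wpM2l // -linearB normr_lsubmx.
Qed.

Lemma C11D (N : nat) (phi psi : 'rV[R]_N -> R -> R) (g k : 'rV[R]_N -> R -> 'rV[R]_N) :
  C11_in_x a b phi g -> C11_in_x a b psi k ->
  C11_in_x a b (fun X t => phi X t + psi X t) (fun X t => g X t + k X t).
Proof.
move=> [g1 g2 g3] [k1 k2 k3]; split=> [X t tab e e0|X t tab|M c d ac db].
- have e20 : 0 < e / 2 by rewrite divr_gt0.
  have [r r0 hr] := g1 X t tab _ e20; have [s s0 hs] := k1 X t tab _ e20.
  exists (Num.min r s) => [|Y]; first by rewrite lt_min r0.
  rewrite lt_min => /andP[Yr Ys]; rewrite dotDl.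
  have -> : phi Y t + psi Y t - (phi X t + psi X t) -
    (dot (g X t) (Y - X) + dot (k X t) (Y - X)) =
    (phi Y t - phi X t - dot (g X t) (Y - X)) + (psi Y t - psi X t - dot (k X t) (Y - X)).
    by ring.
  apply: le_trans (ler_normD _ _) _.
  by have := hr Y Yr; have := hs Y Ys; lra.
- by apply: cvgD; [exact: g2|exact: k2].
- have [L L0 hL] := g3 M c d ac db; have [K K0 hK] := k3 M c d ac db.
  exists (L + K) => [|X Y t tcd XM YM]; first by rewrite addr_ge0.
  rewrite opprD addrACA mulrDl; apply: le_trans (ler_normD _ _) _.
  by rewrite lerD // ?hL ?hK.
Qed.

Lemma C11_sqr_coord (N : nat) (j : 'I_N) :
  C11_in_x a b (fun (X : 'rV[R]_N) _ => X 0 j ^+ 2)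
    (fun X _ => (2 * X 0 j) *: delta_mx 0 j).
Proof.
have delta1 : `|delta_mx 0 j : 'rV[R]_N| <= 1.
  apply: mx_norm_le => // i k; rewrite mxE.
  by case: (_ && _); rewrite ?normr1 ?normr0.
split=> [X t _ e e0|X t _|M c d _ _].
- exists e => // Y YX; have -> : dot ((2 * X 0 j) *: delta_mx 0 j) (Y - X) =
    2 * X 0 j * (Y 0 j - X 0 j).
    rewrite dotZl dotE (bigD1 j) //= big1 ?addr0 => [|i ij].
      by rewrite !mxE !eqxx mul1r.
    by rewrite mxE (negbTE ij) andbF mul0r.
  have -> : Y 0 j ^+ 2 - X 0 j ^+ 2 - 2 * X 0 j * (Y 0 j - X 0 j) =
    (Y 0 j - X 0 j) ^+ 2 by ring.
  have k : `|Y 0 j - X 0 j| <= `|Y - X|.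
    by have := ler_coord_norm (Y - X) 0 j; rewrite !mxE.
  by rewrite normrX expr2; apply: ler_pM => //; exact: le_trans k (ltW YX).
- apply: cvgZ; last exact: cvg_cst.
  apply: cvgM; first exact: cvg_cst.
  by apply: cvg_mx_coord; exact: cvg_fst.
- exists 2 => // X Y t _ _ _; rewrite -scalerBl normrZ -mulrBr normrM normr_nat.
  rewrite -mulrA ler_wpM2l // -[leRHS]mulr1; apply: ler_pM => //.
  by have := ler_coord_norm (X - Y) 0 j; rewrite !mxE.
Qed.

End C11Operations.

Section Slack.
Context {R : realType} {n m q : nat}.
Variables (h : 'rV[R]_n -> R -> 'rV[R]_m) (g : 'rV[R]_n -> R -> 'rV[R]_q).

Definition slack_grad (i : 'I_(m + q)) (X : 'rV[R]_(n + q)) (t : R) : 'rV[R]_(n + q) :=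
  match fintype.split i with
  | inl k => row_mx (grad (fun y => h y t 0 k) (lsubmx X)) 0
  | inr k => row_mx (grad (fun y => g y t 0 k) (lsubmx X)) 0 +
             (2 * X 0 (rshift n k)) *: delta_mx 0 (rshift n k)
  end.

Definition slack_jac (X : 'rV[R]_(n + q)) (t : R) : 'M[R]_(m + q, n + q) :=
  \matrix_i slack_grad i X t.

Let split_lshift k : fintype.split (lshift q k : 'I_(m + q)) = inl k.
Proof. exact: (unsplitK (inl k)). Qed.

Let split_rshift k : fintype.split (rshift m k : 'I_(m + q)) = inr k.
Proof. exact: (unsplitK (inr k)). Qed.

Lemma slack_consE X t i : slack_cons h g X t 0 i =
  match fintype.split i with
  | inl k => h (lsubmx X) t 0 k
  | inr k => g (lsubmx X) t 0 k + X 0 (rshift n k) ^+ 2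
  end.
Proof. by rewrite /slack_cons mxE; case: (fintype.split i) => k //; rewrite !mxE. Qed.

Lemma slack_C11 (a b : R) i : 0 <= a -> C2_in_x h -> C2_in_x g ->
  C11_in_x a b (fun X t => slack_cons h g X t 0 i) (fun X t => row i (slack_jac X t)).
Proof.
move=> a0 Ch Cg.
have -> : (fun X t => slack_cons h g X t 0 i) = (fun X t => match fintype.split i with
  | inl k => h (lsubmx X) t 0 k
  | inr k => g (lsubmx X) t 0 k + X 0 (rshift n k) ^+ 2
  end) by apply/funext => X; apply/funext => t; exact: slack_consE.
have -> : (fun X t => row i (slack_jac X t)) = slack_grad i.
  by apply/funext => X; apply/funext => t; rewrite rowK.
rewrite /slack_grad; case: (fintype.split i) => k.
  exact: (C11_lsubmx q (C2_in_x_C11_coord b k a0 Ch)).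
apply: C11D; first exact: (C11_lsubmx q (C2_in_x_C11_coord b k a0 Cg)).
exact: C11_sqr_coord.
Qed.

(** In a relation [w *m J = 0] the slack columns give [w_j * z_j = 0]. Since [g_j = - z_j ^ 2] on
    the manifold, inactive constraints have [z_j != 0] and coefficient 0, and the [x] columns become
    a relation among the gradients that LICQ declares independent. *)
Lemma slack_gram_unit t X : 0 <= t -> LICQ h g -> slack_cons h g X t = 0 ->
  slack_jac X t *m (slack_jac X t)^T \in unitmx.
Proof.
move=> t0 licq HX; set x := lsubmx X.
have hx : h x t = 0.
  apply/rowP => k; have := congr1 (fun M : 'rV[R]_(m + q) => M 0 (lshift q k)) HX.
  by rewrite slack_consE split_lshift !mxE.
have gx k : g x t 0 k = - X 0 (rshift n k) ^+ 2.
  have := congr1 (fun M : 'rV[R]_(m + q) => M 0 (rshift m k)) HX.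
  by rewrite slack_consE split_rshift mxE => /eqP; rewrite addr_eq0 => /eqP.
have fx : feasible h g x t by split => // k; rewrite gx oppr_le0 sqr_ge0.
have fr := licq t x t0 fx; apply: gram_unit => w wJ.
have sumE (M : 'rV[R]_(n + q)) : M = w *m slack_jac X t ->
    M = \sum_(i < m) w 0 (lshift q i) *: row_mx (grad (fun y => h y t 0 i) x) 0 +
        \sum_(j < q) w 0 (rshift m j) *: (row_mx (grad (fun y => g y t 0 j) x) 0 +
             (2 * X 0 (rshift n j)) *: delta_mx 0 (rshift n j)).
  move=> ->; rewrite mulmx_sum_row big_split_ord /=; congr (_ + _).
    by apply: eq_bigr => i _; rewrite rowK /slack_grad split_lshift.
  by apply: eq_bigr => i _; rewrite rowK /slack_grad split_rshift.
have S := sumE 0 (esym wJ).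
have zw j : w 0 (rshift m j) * X 0 (rshift n j) = 0.
  have := congr1 (fun M : 'rV[R]_(n + q) => M 0 (rshift n j)) S.
  rewrite mxE [RHS]mxE [X in X + _]summxE big1 ?add0r => [|i _]; last first.
    by rewrite mxE row_mxEr mxE mulr0.
  rewrite summxE (bigD1 j) //= big1 ?addr0 => [|i ij]; last first.
    rewrite 2!mxE row_mxEr !mxE eqxx /= (inj_eq (@rshift_inj _ _)) eq_sym (negbTE ij).
    by rewrite mulr0 addr0 mulr0.
  rewrite 2!mxE row_mxEr !mxE !eqxx mulr1 add0r => /esym/eqP.
  by rewrite !mulf_eq0 pnatr_eq0 /= -mulf_eq0 => /eqP.
(* A sum type indexes both families of gradients, so that LICQ applies to one sequence. *)
pose G (k : 'I_m + 'I_q) := match k with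
  | inl i => grad (fun y => h y t 0 i) x
  | inr j => grad (fun y => g y t 0 j) x end.
pose c (k : 'I_m + 'I_q) := match k with
  | inl i => w 0 (lshift q i) | inr j => w 0 (rshift m j) end.
pose P := [pred j : 'I_q | g x t 0 j == 0].
pose r := [seq inl i | i <- enum 'I_m] ++ [seq inr j | j <- enum P] : seq ('I_m + 'I_q).
have frr : free [seq G k | k <- r].
  by rewrite /r map_cat -[X in X ++ _]map_comp -[X in _ ++ X]map_comp; exact: fr.
have inactive j : j \notin P -> w 0 (rshift m j) = 0.
  rewrite inE gx oppr_eq0 sqrf_eq0 => Xj.
  by have /eqP := zw j; rewrite mulf_eq0 (negbTE Xj) orbF => /eqP.
have cr : \sum_(k <- r) c k *: G k = 0.
  rewrite /r big_cat !big_map /= !big_enum_cond /=.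
  have := congr1 lsubmx S; rewrite linear0 linearD !linear_sum /= => S'.
  rewrite [RHS]S'; congr (_ + _).
    by apply: eq_bigr => i _; rewrite linearZ /= row_mxKl.
  rewrite [RHS](bigID P) /= [X in _ + X]big1 ?addr0 => [|j /inactive ->]; last first.
    by rewrite scale0r linear0.
  apply: eq_big => [j|j _]; first by rewrite andbT.
  rewrite linearZ linearD /= row_mxKl.
  have -> : lsubmx ((2 * X 0 (rshift n j)) *: delta_mx 0 (rshift n j) : 'rV[R]_(n + q)) = 0.
    by apply/rowP => i; rewrite !mxE eq_lrshift andbF mulr0.
  by rewrite addr0.
have c0 := free_lincomb frr cr.
apply/rowP => i; rewrite mxE -(splitK i); case: (fintype.split i) => k /=.
  by apply: (c0 (inl k)); rewrite mem_cat map_f // mem_enum.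
have [kP|/inactive //] := boolP (k \in P).
by apply: (c0 (inr k)); rewrite mem_cat orbC map_f // mem_enum.
Qed.

Lemma slack_time_derivative (a b : R) : 0 <= a -> C1_in_t h -> C1_in_t g ->
  exists Ht : 'rV[R]_(n + q) -> R -> 'rV[R]_(m + q),
    (forall X t, a < t < b -> has_deriv_within `]a, b[ (slack_cons h g X) t (Ht X t)) /\
    (forall X t, a < t < b -> jointly_continuous_at Ht X t).
Proof.
move=> a0 [dh [dhP cdh]] [dg [dgP cdg]].
have sub : `]a, b[ `<=` @nonneg_reals R.
  by move=> s /=; rewrite in_itv /nonneg_reals /=; lra.
exists (fun X t => row_mx (dh (lsubmx X) t) (dg (lsubmx X) t)); split=> X t tab.
  have t0 : 0 <= t by lra.
  have Dh := has_deriv_within_subset sub ((is_derive_withinP _ _ _ _).1 (dhP (lsubmx X) t t0)).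
  have Dg := has_deriv_within_subset sub ((is_derive_withinP _ _ _ _).1 (dgP (lsubmx X) t t0)).
  move=> e e0; have [r r0 hr] := Dh e e0; have [k k0 hk] := Dg e e0.
  exists (Num.min r k) => [|s sab]; first by rewrite lt_min r0.
  rewrite lt_min => /andP[s1 s2]; rewrite /slack_cons scale_row_mx !opp_row_mx !add_row_mx.
  apply: normr_row_mx_le; first exact: hr.
  (* The squared slacks do not depend on time and cancel in the increment. *)
  have := hk s sab s2; congr (`|_| <= _); apply/rowP => j; rewrite !mxE; ring.
apply: (@ball_jointly_continuous _ _ _ (fun (X : 'rV[R]_(n + q)) t =>
  row_mx (dh (lsubmx X) t) (dg (lsubmx X) t))) => e e0.
have e20 : 0 < e / 2 by rewrite divr_gt0.
have t0 : 0 < t by lra.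
have [r r0 hr] := jointly_continuous_ball
  (within_jointly_continuous (X := lsubmx X) (phi := dh) cdh t0) e20.
have [k k0 hk] := jointly_continuous_ball
  (within_jointly_continuous (X := lsubmx X) (phi := dg) cdg t0) e20.
exists (Num.min r k) => [|Y s]; first by rewrite lt_min r0.
rewrite !lt_min => /andP[Y1 Y2] /andP[s1 s2].
have l : `|lsubmx Y - lsubmx X| <= `|Y - X| by rewrite -linearB normr_lsubmx.
rewrite opp_row_mx add_row_mx; apply: (@le_lt_trans _ _ (e / 2)); last by lra.
by apply: normr_row_mx_le; apply: ltW; [apply: hr|apply: hk] => //; exact: le_lt_trans l _.
Qed.

End Slack.

Theorem theorem22 (R : realType) (n m q : nat)
    (f : 'rV[R]_n -> R -> R)
    (h : 'rV[R]_n -> R -> 'rV[R]_m)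
    (g : 'rV[R]_n -> R -> 'rV[R]_q)
    (smooth_fhg : smoothness f h g)
    (feasible_hg : feasibility h g)
    (licq_hg : LICQ h g)
    (a b : R) (a_ge0 : 0 <= a) (a_lt_b : a < b)
    (V : set (R * 'rV[R]_(n + q)))
    (contracting_V :
      contracting_basin (@slack_obj R n q f) (slack_cons h g) `]a, b[ V)
    (t0 t1 : R) (t0_le_t1 : t0 <= t1) (I_sub_I0 : `[t0, t1] `<=` `]a, b[)
    (epsilon nu : R) (epsilon_gt0 : 0 < epsilon) (nu_gt0 : 0 < nu) :
  exists2 alpha_bar : R, 0 < alpha_bar &
    forall alpha : R, 0 < alpha <= alpha_bar ->
      allows_tracking (@slack_obj R n q f) (slack_cons h g) V
        t0 t1 epsilon nu alpha.
Proof.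
have [[Cf Ch Cg] f_time [Dh Dg] _] := smooth_fhg.
have t0I : `[t0, t1]%classic t0 by rewrite /= in_itv /= lexx.
have t1I : `[t0, t1]%classic t1 by rewrite /= in_itv /= lexx andbT.
have /andP[at0 _] : a < t0 < b by have := I_sub_I0 _ t0I; rewrite /= in_itv.
have /andP[_ t1b] : a < t1 < b by have := I_sub_I0 _ t1I; rewrite /= in_itv.
have [Ht [dHt cHt]] := slack_time_derivative b a_ge0 Dh Dg.
have F_reg := C11_lsubmx q (C2_in_x_C11 b a_ge0 Cf).
have H_reg i := slack_C11 b i a_ge0 Ch Cg.
apply: (tracking (gF := fun X t => row_mx (grad (f ^~ t) (lsubmx X)) 0)
  (A := slack_jac h g) (Ht := Ht)) contracting_V at0 t0_le_t1 t1b epsilon_gt0 nu_gt0.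
- move=> X t tab; apply: (C11_jointly_continuous F_reg tab) => e e0.
  have t_gt0 : 0 < t by lra.
  have f_cont : f (lsubmx X) @ t --> f (lsubmx X) t.
    have := (subspace_continuousP _ _).1 (f_time (lsubmx X)) t (ltW t_gt0).
    (* Since [0 <= a < t], the time is interior to the half-line and one-sided continuity of [f] is
       two-sided. *)
    rewrite within_interior // /nonneg_reals.
    apply/nbhs_ballP; exists t => //= s; rewrite /ball /= ltr_norml; lra.
  have /cvgrPdist_lt/(_ e e0)/nbhs_ballP[r /= r0 hr] := f_cont.
  by exists r => // s _ st; rewrite distrC; apply: hr; rewrite /ball /= distrC.
- exact: F_reg.
- split => // X t /andP[at_ _]; apply: slack_gram_unit => //; lra.
move=> X t tab; split; [|apply: Jac_has_grad => i|].
- by apply: has_grad_grad; case: F_reg => hF _ _; exact: (hF X t tab).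
- by have [hH _ _] := H_reg i; exact: (hH X t tab).
- exact: (has_deriv_within_derive1 tab (dHt X t tab)).
Qed.
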